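(* Let $u_0\in H_0^1(\Omega)$ and $u_1\in L^2(\Omega)$. Assume that $u_0\in\mathcal{N}_-$ and that the initial data satisfy $$\|u_0\|^2+2(u_0,u_1)>\frac{4p(1+\lambda_1)}{(p-2)\lambda_1}E(0).$$ Then the weak solution $u(t)$ to problem (P) belongs to $\mathcal{N}_-$ for all $t\in[0,T_{max})$.
   Context: Let $\Omega\subset\mathbb{R}^n$ ($n\ge1$) be a bounded domain with smooth boundary. Problem (P) is $$u_{tt}-\Delta u-\Delta u_t+u_t=f(u)\ \ (x\in\Omega,\ t>0),\qquad u=0\ \ (x\in\partial\Omega,\ t>0),\qquad u(x,0)=u_0(x),\ u_t(x,0)=u_1(x)\ \ (x\in\Omega),$$ with $u_0\in H_0^1(\Omega)$, $u_1\in L^2(\Omega)$. Let $2^*=+\infty$ for $n=1,2$ and $2^*=\frac{2n}{n-2}$ for $n\ge3$. The function $f\in C^1(\mathbb{R})$, with $F(s)=\int_0^s f(t)\,dt$, satisfies: (H1) there is a constant $p>2$ with $sf(s)\ge pF(s)$ for all $s\in\mathbb{R}$; (H2) there are constants $\alpha,\beta>0$ and $q\in(1,2^*-1)$ with $|f(s)|\le\alpha+\beta|s|^q$ for all $s\in\mathbb{R}$; (H3) there are constants $k_0,k_1>0$ and $l_1\in(0,2^*-2)$ with $|f'(s)|\le k_0+k_1|s|^{l_1}$ for all $s\in\mathbb{R}$. Notation: $\|\cdot\|_2$ and $(\cdot,\cdot)$ are the norm and inner product of $L^2(\Omega)$; $\|v\|^2=\|v\|_2^2+\|\nabla v\|_2^2$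 for $v\in H_0^1(\Omega)$; $\langle\cdot,\cdot\rangle_*$ is the duality pairing between $H^{-1}(\Omega)$ and $H_0^1(\Omega)$; $\lambda_1>0$ is the first eigenvalue of $-\Delta$ in $\Omega$ with homogeneous Dirichlet boundary condition. Weak solution: $u$ is a weak solution of (P) over $[0,T]$ if $u\in C([0,T];H_0^1(\Omega))\cap C^1([0,T];L^2(\Omega))\cap C^2([0,T];H^{-1}(\Omega))$ with $u_t\in L^2(0,T;H_0^1(\Omega))$, $u(0)=u_0$, $u_t(0)=u_1$, and for all $\phi\in H_0^1(\Omega)$ and a.e. $t\in[0,T]$ $$\langle u_{tt}(t),\phi\rangle_*+\int_\Omega\nabla u(t)\cdot\nabla\phi\,dx+\int_\Omega\nabla u_t(t)\cdot\nabla\phi\,dx+\int_\Omega u_t(t)\phi\,dx=\int_\Omega f(u(t))\phi\,dx.$$ Under (H2)-(H3), local existence and uniqueness of weak solutions hold. The maximal existence time is $T_{max}=\sup\{T>0: u \text{ exists on }[0,T]\}\in(0,+\infty]$. Energy: $E(t)=\frac12\|u_t(t)\|_2^2+\frac12\|\nabla u(t)\|_2^2-\int_\Omega F(u(t))\,dx$, so $E(0)=\frac12\|u_1\|_2^2+\frac12\|\nabla u_0\|_2^2-\int_\Omega F(u_0)\,dx$. Nehari functional: $I(v)=\|\nabla v\|_2^2-\int_\Omega f(v)v\,dx$ for $v\in H_0^1(\Omega)$. Unstable set: $\mathcal{N}_-=\{v\in H_0^1(\Omega): I(v)<0\}$. *)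

(* Defs.v *)
From HB Require Import structures.
From mathcomp Require Import all_boot all_order all_algebra.
From mathcomp Require Import all_classical all_reals all_analysis.

Set Implicit Arguments.
Unset Strict Implicit.
Unset Printing Implicit Defensive.
Import Order.TTheory GRing.Theory Num.Theory.
Import numFieldNormedType.Exports.

Local Open Scope classical_set_scope.
Local Open Scope ring_scope.

(* R^n is ['rV[R]_n], for an abstract [R : realType]. *)

Section measurable_rV.
Context (R : realType) (n : nat).

Let coord (i : 'I_n) (x : 'rV[R]_n) : R := x ord0 i.

Let rV_set0 : g_sigma_preimage coord set0.
Proof. exact: sigma_algebra0. Qed.

Let rV_setC A : g_sigma_preimage coord A -> g_sigma_preimage coord (~` A).
Proof. exact: sigma_algebraC. Qed.

Let rV_bigcup (F : (set 'rV[R]_n)^nat) :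
  (forall i, g_sigma_preimage coord (F i)) ->
  g_sigma_preimage coord (\bigcup_i (F i)).
Proof. exact: sigma_algebra_bigcup. Qed.

(* The product sigma-algebra, which on R^n is the Borel sigma-algebra. *)
HB.instance Definition _ := @isMeasurable.Build default_measure_display
  'rV[R]_n (g_sigma_preimage coord) rV_set0 rV_setC rV_bigcup.

Lemma measurable_coord (i : 'I_n) :
  measurable_fun [set: 'rV[R]_n] (fun x : 'rV[R]_n => x ord0 i).
Proof.
move=> _ Y mY; rewrite setTI; apply: sub_sigma_algebra => /=.
rewrite -bigcup_seq/=; exists i => /=; first by rewrite mem_index_enum.
by exists Y => //; rewrite setTI.
Qed.

Lemma measurable_fun_rV d (T : measurableType d) (f : T -> 'rV[R]_n) :
  (forall i, measurable_fun [set: T] (fun t => f t ord0 i)) ->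
  measurable_fun [set: T] f.
Proof.
move=> mf _ A mA; rewrite setTI.
suff: g_sigma_preimage coord `<=` [set B | measurable (f @^-1` B)] by exact.
apply: smallest_sub => [|B].
  split=> [|B /= mB|F mF] /=.
  - by rewrite preimage_set0.
  - by rewrite setTD -preimage_setC; exact: measurableC.
  - by rewrite preimage_bigcup; exact: bigcupT_measurable.
rewrite -bigcup_seq/= => -[i _ [C mC <-]].
by rewrite setTI -[X in measurable X]setTI; exact: mf.
Qed.

End measurable_rV.

Section cons_rV.
Context (R : realType) (n : nat).

Definition cons_rV (p : measurableTypeR R * 'rV[R]_n) : 'rV[R]_n.+1 :=
  \row_i (if unlift ord0 i is Some j then p.2 ord0 j else p.1).

Definition uncons_rV (x : 'rV[R]_n.+1) : measurableTypeR R * 'rV[R]_n :=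
  (x ord0 ord0, \row_j x ord0 (lift ord0 j)).

Lemma cons_rVK : cancel cons_rV uncons_rV.
Proof.
move=> [a y]; rewrite /uncons_rV /cons_rV !mxE unlift_none; congr pair.
by apply/rowP => j; rewrite !mxE liftK.
Qed.

Lemma measurable_cons_rV : measurable_fun setT cons_rV.
Proof.
apply: measurable_fun_rV => i.
have [j ->|->] := unliftP ord0 i.
  rewrite (_ : (fun t => _) = (fun y : 'rV[R]_n => y ord0 j) \o snd).
    by apply: measurableT_comp; [exact: measurable_coord|].
  by apply/funext => t /=; rewrite !mxE liftK.
rewrite (_ : (fun t => _) = fst)//.
by apply/funext => t /=; rewrite !mxE unlift_none.
Qed.

Lemma measurable_uncons_rV : measurable_fun setT uncons_rV.
Proof.
apply: measurable_fun_pair; first exact: measurable_coord.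
apply: measurable_fun_rV => i.
rewrite (_ : (fun t => _) = fun x : 'rV[R]_n.+1 => x ord0 (lift ord0 i)).
  exact: measurable_coord.
by apply/funext => t /=; rewrite !mxE.
Qed.

HB.instance Definition _ :=
  isMeasurableFun.Build _ _ _ _ cons_rV measurable_cons_rV.

Variable m : {sigma_finite_measure set 'rV[R]_n -> \bar R}.

Definition lebesgue_rV_step : set 'rV[R]_n.+1 -> \bar R :=
  pushforward (lebesgue_measure \x m)%E cons_rV.

Let step0 : lebesgue_rV_step set0 = 0%E.
Proof. by rewrite /lebesgue_rV_step /pushforward preimage_set0 measure0. Qed.

Let step_ge0 A : (0 <= lebesgue_rV_step A)%E.
Proof. exact: measure_ge0. Qed.

Let step_sigma_additive : semi_sigma_additive lebesgue_rV_step.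
Proof. exact: measure_semi_sigma_additive. Qed.

HB.instance Definition _ := isMeasure.Build _ _ _ lebesgue_rV_step
  step0 step_ge0 step_sigma_additive.

Let step_sigma_finite : sigma_finite setT lebesgue_rV_step.
Proof.
have /sigma_finiteP[F [TF ndF Foo]] := sigma_finiteT (@lebesgue_measure R).
have /sigma_finiteP[G [TG ndG Goo]] := sigma_finiteT m.
exists (fun k => uncons_rV @^-1` (F k `*` G k)) => [|k].
  rewrite -preimage_bigcup (_ : \bigcup_k _ = setT) ?preimage_setT//.
  apply/seteqP; split => // -[a y] _.
  have [i _ Fia] : (\bigcup_i F i) a by rewrite -TF.
  have [j _ Gjy] : (\bigcup_j G j) y by rewrite -TG.
  exists (maxn i j) => //; split => /=.
  - by move: a Fia; exact/subsetPset/ndF/leq_maxl.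
  - by move: y Gjy; exact/subsetPset/ndG/leq_maxr.
have [mF Fk] := Foo k; have [mG Gk] := Goo k; split.
  rewrite -[X in measurable X]setTI; apply: measurable_uncons_rV => //.
  exact: measurableX.
rewrite /lebesgue_rV_step /pushforward -comp_preimage.
rewrite (_ : _ \o _ = id); last by apply/funext => p /=; rewrite cons_rVK.
by rewrite preimage_id product_measure1E// lte_mul_pinfty// ge0_fin_numE.
Qed.

HB.instance Definition _ := Measure_isSigmaFinite.Build _ _ _ lebesgue_rV_step
  step_sigma_finite.

End cons_rV.

(* n-fold product of the one-dimensional Lebesgue measure; its value on boxes is
   [lebesgue_rV_box]. *)
Fixpoint lebesgue_rV (R : realType) (n : nat) :
    {sigma_finite_measure set 'rV[R]_n -> \bar R} :=
  if n is n'.+1 then lebesgue_rV_step (lebesgue_rV R n') else \d_(0 : 'rV[R]_0).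

Lemma lebesgue_rV_box (R : realType) (n : nat)
    (A : 'I_n -> set (measurableTypeR R)) :
  (forall i, measurable (A i)) ->
  lebesgue_rV R n [set x | forall i, A i (x ord0 i)] =
  (\prod_(i < n) lebesgue_measure (A i))%E.
Proof.
elim: n A => [|n IHn] A mA.
  rewrite big_ord0; transitivity (lebesgue_rV R 0 setT); last exact: diracT.
  by congr (lebesgue_rV R 0 _); apply/seteqP; split => // x _ [].
rewrite big_ord_recl -IHn//.
pose B := [set x : 'rV[R]_n | forall i, A (lift ord0 i) (x ord0 i)].
have mB : measurable B.
  rewrite (_ : B = \bigcap_(i in [set: 'I_n])
      ((fun x : 'rV[R]_n => x ord0 i) @^-1` A (lift ord0 i))).
    apply: fin_bigcap_measurable => [|i _]; first exact: finite_finset.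
    by rewrite -[X in measurable X]setTI; apply: measurable_coord => //; apply: mA.
  by apply/seteqP; split => [x Bx i _|x Bx i]; apply: Bx.
transitivity ((lebesgue_measure \x lebesgue_rV R n)%E (A ord0 `*` B)).
  rewrite /= /lebesgue_rV_step /pushforward; congr (product_measure1 _ _ _).
  apply/seteqP; split => -[a x] /=.
    move=> Aax; split => [|i].
      by have := Aax ord0; rewrite mxE unlift_none.
    by have := Aax (lift ord0 i); rewrite mxE liftK.
  move=> [Aa Ax] i; rewrite mxE.
  by have [j ->|->] := unliftP ord0 i; rewrite ?liftK ?unlift_none.
by rewrite product_measure1E.
Qed.

Section smooth.
Context (R : realType).

Definition partial (n : nat) (i : 'I_n) (phi : 'rV[R]_n -> R) : 'rV[R]_n -> R :=
  fun x => 'D_(delta_mx ord0 i) phi x.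

Fixpoint Ck (n k : nat) (phi : 'rV[R]_n -> R) : Prop :=
  continuous phi /\
  if k is k'.+1 then
    (forall x i, derivable phi x (delta_mx ord0 i)) /\
    (forall i, Ck k' (partial i phi))
  else True.

Definition smooth (n : nat) (phi : 'rV[R]_n -> R) : Prop :=
  forall k, Ck k phi.

(* Near each boundary point, up to the choice of a coordinate axis [i] and of
   its orientation [b], the set is the strict epigraph of a smooth function
   of the other coordinates. *)
Definition smooth_boundary (n : nat) (Omega : set 'rV[R]_n) : Prop :=
  forall x0, (closure Omega `\` interior Omega) x0 ->
  exists (i : 'I_n) (b : bool) (gamma : 'rV[R]_n.-1 -> R), smooth gamma /\
    \forall x \near x0, Omega x <->
      (if b then gamma (col' i x) < x ord0 i else x ord0 i < gamma (col' i x)).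

Definition bounded_smooth_domain (n : nat) (Omega : set 'rV[R]_n) : Prop :=
  [/\ Omega !=set0, open Omega, connected Omega, bounded_set Omega &
      smooth_boundary Omega].

Definition test_function (n : nat) (Omega : set 'rV[R]_n)
    (phi : 'rV[R]_n -> R) : Prop :=
  smooth phi /\
  exists K, [/\ compact K, K `<=` Omega & forall x, ~ K x -> phi x = 0].

End smooth.

(* Elements of L^2(Omega), H^1(Omega), H_0^1(Omega) are represented by
   functions defined on all of R^n, of which only the values on Omega matter,
   and only up to a.e. equality. *)

Section sobolev.
Context (R : realType) (n : nat) (Omega : set 'rV[R]_n).
Local Notation mu := (lebesgue_rV R n).
Implicit Types u v g phi : 'rV[R]_n -> R.

Definition L2 v : Prop :=
  measurable_fun Omega v /\ (\int[mu]_(x in Omega) (v x ^+ 2)%:E < +oo)%E.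

Definition l2dot u v : R := \int[mu]_(x in Omega) (u x * v x).

Definition l2norm v : R := Num.sqrt (l2dot v v).

Definition is_weak_partial (i : 'I_n) v g : Prop :=
  L2 g /\ forall phi, test_function Omega phi ->
    l2dot v (partial i phi) = - l2dot g phi.

(* The i-th weak partial derivative in L^2(Omega), unique up to a.e. equality;
   0 by default if there is none. *)
Definition wpartial (i : 'I_n) v : 'rV[R]_n -> R :=
  xget (fun=> 0) [set g | is_weak_partial i v g].

Definition H1 v : Prop :=
  L2 v /\ forall i, exists g, is_weak_partial i v g.

(* \int_Omega \nabla u . \nabla v *)
Definition graddot u v : R :=
  \int[mu]_(x in Omega) \sum_(i < n) wpartial i u x * wpartial i v x.

Definition h1norm v : R := Num.sqrt (l2norm v ^+ 2 + graddot v v).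

Definition H01 v : Prop :=
  H1 v /\ exists phi : nat -> 'rV[R]_n -> R,
    (forall k, test_function Omega (phi k)) /\
    h1norm (phi k - v) @[k --> \oo] --> 0.

(* Elements of the dual of H_0^1(Omega) are represented by functionals, of
   which only the values on H_0^1(Omega) matter. *)
Definition Hm1 (l : ('rV[R]_n -> R) -> R) : Prop :=
  (forall a u v, H01 u -> H01 v -> l (a *: u + v) = a * l u + l v) /\
  exists C, forall v, H01 v -> `|l v| <= C * h1norm v.

Definition hm1norm (l : ('rV[R]_n -> R) -> R) : R :=
  sup [set `|l v| | v in [set v | H01 v /\ h1norm v <= 1]].

(* The embedding of L^2(Omega) into H^{-1}(Omega) *)
Definition l2_hm1 v : ('rV[R]_n -> R) -> R := l2dot v.

(* Weak formulation of -\Delta v = lambda v in Omega, v = 0 on the boundary,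
   with v nonzero. *)
Definition dirichlet_eigenvalue (lambda : R) : Prop :=
  exists v, [/\ H01 v, ~ ae_eq mu Omega v (fun=> 0) &
    forall phi, H01 phi -> graddot v phi = lambda * l2dot v phi].

Definition first_dirichlet_eigenvalue (lambda : R) : Prop :=
  dirichlet_eigenvalue lambda /\
  forall lambda', dirichlet_eigenvalue lambda' -> lambda <= lambda'.

End sobolev.

(* The function space in which the curves take their values is given by a
   vector space [V], a subset [X] of it and a (semi)norm [nrm] on [X]. *)

Section curves.
Context (R : realType) (V : lmodType R) (X : V -> Prop) (nrm : V -> R).
Context (T : R).
Implicit Types u v w : R -> V.

(* u in C([0,T]; X) *)
Definition C0_in u : Prop :=
  forall t, `[0, T]%classic t ->
    X (u t) /\ nrm (u s - u t) @[s --> within `[0, T] (nbhs t)] --> 0.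

(* u in C^1([0,T]; X) with derivative v, one-sided at the endpoints *)
Definition C1_in u v : Prop :=
  [/\ C0_in u, C0_in v &
    forall t, `[0, T]%classic t ->
      nrm ((s - t)^-1 *: (u s - u t) - v t)
        @[s --> within `[0, T] (dnbhs t)] --> 0].

(* u in C^2([0,T]; X) with first and second derivatives v and w *)
Definition C2_in u v w : Prop := C1_in u v /\ C1_in v w.

Definition simple_curve (w : R -> V) : Prop :=
  exists (m : nat) (A : 'I_m -> set (measurableTypeR R)) (x : 'I_m -> V),
    [/\ forall j, measurable (A j), forall j, X (x j) &
        forall t, w t = \sum_(j < m) \1_(A j) t *: x j].

Definition strongly_measurable w : Prop :=
  exists s : nat -> R -> V, (forall k, simple_curve (s k)) /\
    {ae lebesgue_measure, forall t : measurableTypeR R, `[0, T]%classic t ->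
      nrm (s k t - w t) @[k --> \oo] --> 0}.

(* w in L^2(0,T; X) *)
Definition L2_in w : Prop :=
  [/\ {ae lebesgue_measure, forall t : measurableTypeR R,
        `[0, T]%classic t -> X (w t)},
      strongly_measurable w &
      (\int[lebesgue_measure]_(t in `[0%R, T]) (nrm (w t) ^+ 2)%:E < +oo)%E].

End curves.

Section nonlinearity.
Context (R : realType).

Definition C1_fun (f : R -> R) : Prop :=
  (forall s, derivable f s 1) /\ continuous (derive1 f).

(* The oriented integral F(s) = \int_0^s f(t) dt *)
Definition primitive (f : R -> R) (s : R) : R :=
  if 0 <= s then \int[lebesgue_measure]_(t in `[0, s]) f t
  else - \int[lebesgue_measure]_(t in `[s, 0]) f t.

(* 2^* *)
Definition critical_exponent (n : nat) : \bar R :=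
  if (n <= 2)%N then +oo%E else (2 * n%:R / (n%:R - 2))%:E.

End nonlinearity.

(* u_tt - \Delta u - \Delta u_t + u_t = f(u) in Omega,
   u = 0 on the boundary, u(0) = u0, u_t(0) = u1 *)

Section problem.
Context (R : realType) (n : nat) (Omega : set 'rV[R]_n) (f : R -> R).
Local Notation mu := (lebesgue_rV R n).

Definition weak_solution (u0 u1 : 'rV[R]_n -> R) (T : R)
    (u : R -> 'rV[R]_n -> R) : Prop :=
  exists (ut : R -> 'rV[R]_n -> R) (utt : R -> ('rV[R]_n -> R) -> R),
  [/\ C0_in (H01 Omega) (h1norm Omega) T u,
      C1_in (L2 Omega) (l2norm Omega) T u ut,
      C2_in (Hm1 Omega) (hm1norm Omega) T
        (l2_hm1 Omega \o u) (l2_hm1 Omega \o ut) utt &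
      L2_in (H01 Omega) (h1norm Omega) T ut] /\
  [/\ ae_eq mu Omega (u 0) u0,
      ae_eq mu Omega (ut 0) u1 &
      forall phi, H01 Omega phi ->
        {ae lebesgue_measure, forall t : measurableTypeR R,
          `[0, T]%classic t ->
          utt t phi + graddot Omega (u t) phi + graddot Omega (ut t) phi
            + l2dot Omega (ut t) phi
          = \int[mu]_(x in Omega) (f (u t x) * phi x)}].

Definition Tmax (u0 u1 : 'rV[R]_n -> R) (u : R -> 'rV[R]_n -> R) : \bar R :=
  ereal_sup [set T%:E | T in [set T | 0 < T /\ weak_solution u0 u1 T u]].

Definition energy (v w : 'rV[R]_n -> R) : R :=
  2^-1 * l2norm Omega w ^+ 2 + 2^-1 * graddot Omega v v
  - \int[mu]_(x in Omega) primitive f (v x).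

Definition nehari (v : 'rV[R]_n -> R) : R :=
  graddot Omega v v - \int[mu]_(x in Omega) (f (v x) * v x).

Definition unstable_set : set ('rV[R]_n -> R) :=
  [set v | H01 Omega v /\ nehari v < 0].

End problem.

(* Main.v *)
(** By compactness of the embedding of [H01] into [L2], the Rayleigh quotient
    attains its infimum, which is the first eigenvalue; so [lambda1] bounds
    [|grad v|^2 / |v|^2] from below.  A first time [t0] with [I(u) >= 0] is excluded
    as follows.  Put [psi = ||u||^2 + 2(u, u_t)].  Testing the equation with [u] gives
    [psi' = 2(|u_t|^2 - I(u)) >= 0] before [t0], and testing it with [u_t] gives
    [E' = - |grad u_t|^2 - |u_t|^2 <= 0]; hence [psi(t0) > C E(t0)] with the constant
    [C] of the assumption, whereas (H1), [I(u(t0)) >= 0] and the eigenvalue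
    inequality give [C E(t0) >= psi(t0)].

    Testing with [u_t] is legitimate because of strong damping: the equation
    says that [grad u_t] represents a functional that is continuous in time, and,
    tested against smooth functions, this holds at every time, not only almost
    everywhere.  Hence [u] is continuously differentiable with values in [H01].

    The nonlinear terms are estimated with the embedding of [H01] into [L^(l1 + 2)],
    which follows from Gagliardo's inequality by induction on the dimension, with
    a weighted Young inequality in place of Hoelder's.  Compactness of the embedding
    into [L2] follows from a Poincare inequality on small cubes, also by
    induction on the dimension.  No regularity of the boundary enters, since
    [H01] is a closure of test functions. *)

Require Import Defs.
From HB Require Import structures.
From mathcomp Require Import all_boot all_order all_algebra.
From mathcomp Require Import all_classical all_reals all_analysis.
From mathcomp Require Import measurable_realfun ring lra.
Set Implicit Arguments.
Unset Strict Implicit.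
Unset Printing Implicit Defensive.
Import Order.TTheory GRing.Theory Num.Theory.
Import numFieldNormedType.Exports.
Local Open Scope classical_set_scope.
Local Open Scope ring_scope.

(** * Lebesgue measure on row vectors *)

(** The velocity [u_t] is known to lie in [H01] only at almost every time, and the exceptional set
    of times may depend on the test function. So neither [u] nor [u_t], which move with time, can be
    inserted directly into the equation at a prescribed time. The way out is an adjoint: for a test
    function [phi] the gradient pairing of v with [phi] is the [L2] pairing of v with minus the
    Laplacian of [phi], and this is continuous in time along [u_t]. The argument runs in an abstract
    space with two semi-inner products [l] and [g]. They are only semi-definite because functions
    equal almost everywhere are not identified; for the same reason the initial data are transferred
    from [u 0] to [u0] separately. The constant satisfies [C (k/2 + (1/2 - 1/p) G) = c1 k +
    (2/lambda1 + 2) G] with [c1 = 2p(1 + lambda1)/((p - 2) lambda1) >= 1], where [k] and [G] are the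
    squared norms of [u_t] and [grad u]. Since [|u|^2 <= G/lambda1] and [2(u, u_t) <= |u|^2 + k],
    the right side is at least [psi]. *)

Section boxes.
Context (R : realType) (n : nat).
Implicit Types (a b x : 'rV[R]_n) (U : set 'rV[R]_n).

Definition obox a b : set 'rV[R]_n :=
  [set x | forall i, a ord0 i < x ord0 i < b ord0 i].
Definition cbox a b : set 'rV[R]_n :=
  [set x | forall i, a ord0 i <= x ord0 i <= b ord0 i].

Lemma obox_sub_cbox a b : obox a b `<=` cbox a b.
Proof. by move=> x abx i; have /andP[? ?] := abx i; rewrite !ltW. Qed.

Lemma compact_cbox a b : compact (cbox a b).
Proof.
have := @rV_compact R n (fun i => `[a ord0 i, b ord0 i]%classic).
have -> : [set v : 'rV[R]_n | forall i, `[a ord0 i, b ord0 i]%classic (v ord0 i)]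
  = cbox a b.
  by apply/seteqP; split => x xab i; have := xab i; rewrite /= in_itv.
by apply => i; exact: segment_compact.
Qed.

Lemma nbhs_rVP x (A : set 'rV[R]_n) : nbhs x A <->
  exists2 e : R, 0 < e & forall y : 'rV[R]_n,
    (forall i, `|x ord0 i - y ord0 i| < e) -> A y.
Proof.
split=> [/nbhs_ballP[e /= e0 eA]|[e e0 eA]].
  exists e => // y xy; apply: eA; split=> // i j.
  by rewrite ord1; exact: xy.
apply/nbhs_ballP; exists e => //= y [_ xy]; apply: eA => i.
exact: (xy ord0 i).
Qed.

Lemma measurable_rV_forall (A : 'I_n -> set (measurableTypeR R)) :
  (forall i, measurable (A i)) ->
  measurable [set x : 'rV[R]_n | forall i, A i (x ord0 i)].
Proof.
move=> mA; rewrite (_ : [set x | _] = \bigcap_(i in [set: 'I_n])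
    ((fun x : 'rV[R]_n => x ord0 i) @^-1` A i)).
  apply: fin_bigcap_measurable => [|i _]; first exact: finite_finset.
  by rewrite -[X in measurable X]setTI; apply: measurable_coord => //; exact: mA.
by apply/seteqP; split => [x Bx i _|x Bx i]; apply: Bx.
Qed.

Lemma measurable_obox a b : measurable (obox a b).
Proof.
rewrite (_ : obox a b =
  [set x | forall i, `]a ord0 i, b ord0 i[%classic (x ord0 i)]).
  apply: (@measurable_rV_forall (fun i => `]a ord0 i, b ord0 i[%classic)) => i.
  exact: measurable_itv.
by apply/seteqP; split => x xab i; have := xab i; rewrite /= in_itv.
Qed.

Lemma measurable_cbox a b : measurable (cbox a b).
Proof.
rewrite (_ : cbox a b =
  [set x | forall i, `[a ord0 i, b ord0 i]%classic (x ord0 i)]).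
  apply: (@measurable_rV_forall (fun i => `[a ord0 i, b ord0 i]%classic)) => i.
  exact: measurable_itv.
by apply/seteqP; split => x xab i; have := xab i; rewrite /= in_itv.
Qed.

Let ratb (q : 'rV[rat]_n) : 'rV[R]_n := map_mx ratr q.

(** Rational corners make the union countable. Asking the closed box to lie in [U] leaves room for a
    test function supported in that box. *)
Lemma open_cover_obox U : open U ->
  U = \bigcup_(q in [set q : 'rV[rat]_n * 'rV[rat]_n |
                     cbox (ratb q.1) (ratb q.2) `<=` U])
        obox (ratb q.1) (ratb q.2).
Proof.
move=> oU; apply/seteqP; split => [x Ux|x [q /= qU] /obox_sub_cbox]; last exact: qU.
have /nbhs_rVP[e e0 eU] : nbhs x U by exact: open_nbhs_nbhs.
have /choice[a Pa] : forall i, exists q : rat, x ord0 i - e < ratr q < x ord0 i.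
  move=> i; have [|q] := @rat_in_itvoo R (x ord0 i - e) (x ord0 i); first lra.
  by rewrite in_itv/=; exists q.
have /choice[b Pb] : forall i, exists q : rat, x ord0 i < ratr q < x ord0 i + e.
  move=> i; have [|q] := @rat_in_itvoo R (x ord0 i) (x ord0 i + e); first lra.
  by rewrite in_itv/=; exists q.
exists (\row_i a i, \row_i b i) => /=.
  move=> y yab; apply: eU => i; have := yab i; rewrite !mxE.
  have /andP[? ?] := Pa i; have /andP[? ?] := Pb i => /andP[? ?].
  by rewrite ltr_norml; apply/andP; split; lra.
by move=> i; rewrite !mxE; have /andP[_ ->] := Pa i; have /andP[-> _] := Pb i.
Qed.

Lemma open_measurable_rV U : open U -> measurable U.
Proof.
move=> oU; rewrite (open_cover_obox oU) bigcup_mkcond.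
apply: countable_bigcupT_measurable => [|q]; first exact: countableP.
by case: ifP => _; [exact: measurable_obox|exact: measurable0].
Qed.

Lemma continuous_measurable_rV (f : 'rV[R]_n -> R) :
  continuous f -> measurable_fun [set: 'rV[R]_n] f.
Proof.
move=> cf; apply: (measurability _ (RGenOpens.measurableE R)).
move=> _ [_ [a [b ->] <-]]; rewrite setTI; apply: open_measurable_rV.
by move/continuousP : cf; apply; exact: interval_open.
Qed.

End boxes.

(** * Slicing off the first coordinate *)

Section tonelli.
Context (R : realType) (n : nat).
Local Notation cons := (@cons_rV R n).
Local Notation mu1 := (@lebesgue_measure R).
Local Notation mu := (lebesgue_rV R n).
Local Notation muS := (lebesgue_rV R n.+1).
Local Open Scope ereal_scope.

Lemma measurable_slice d (T : measurableType d) (g : 'rV[R]_n.+1 -> T)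
    (a : measurableTypeR R) :
  measurable_fun setT g -> measurable_fun setT (fun y => g (cons_rV (a, y))).
Proof.
move=> mg; apply: (measurableT_comp mg).
apply: (measurableT_comp (@measurable_cons_rV R n)).
exact: measurable_pair1.
Qed.

(** The measure in dimension n + 1 is a pushforward of a product along [cons_rV], so this is the
    product Tonelli theorem after a change of variables. All inductions on the dimension rest on
    it. *)
Lemma tonelli_rV (g : 'rV[R]_n.+1 -> \bar R) :
  measurable_fun setT g -> (forall x, 0 <= g x) ->
  \int[muS]_x g x = \int[mu1]_a \int[mu]_y g (cons_rV (a, y)).
Proof.
move=> mg g0.
rewrite /= /lebesgue_rV_step ge0_integral_pushforward//=.
rewrite preimage_setT (@fubini_tonelli1 _ _ _ _ _ _ _ (g \o _))//.
  exact: (measurableT_comp mg (@measurable_cons_rV R n)).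
by move=> x; exact: g0.
Qed.

Lemma measurable_tonelli_rV (g : 'rV[R]_n.+1 -> \bar R) :
  measurable_fun setT g -> (forall x, 0 <= g x) ->
  measurable_fun setT (fun a => \int[mu]_y g (cons (a, y))).
Proof.
move=> mg g0.
apply: (@measurable_fun_fubini_tonelli_F _ _ _ _ _ _ (g \o cons)) => [|x]; last exact: g0.
exact: (measurableT_comp mg (@measurable_cons_rV R n)).
Qed.

Lemma measurable_line_rV (g : 'rV[R]_n.+1 -> \bar R) :
  measurable_fun setT g -> (forall x, 0 <= g x) ->
  measurable_fun setT (fun y => \int[mu1]_a g (cons (a, y))).
Proof.
move=> mg g0.
apply: (@measurable_fun_fubini_tonelli_G _ _ _ _ _ mu1 (g \o cons)) => [|x]; last exact: g0.
exact: (measurableT_comp mg (@measurable_cons_rV R n)).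
Qed.

Lemma tonelli_rV_swap (g : 'rV[R]_n.+1 -> \bar R) :
  measurable_fun setT g -> (forall x, 0 <= g x) ->
  \int[muS]_x g x = \int[mu]_y \int[mu1]_a g (cons (a, y)).
Proof.
move=> mg g0; rewrite tonelli_rV//.
apply: (@fubini_tonelli _ _ _ _ _ mu1 mu (g \o cons)) => [|x]; last exact: g0.
exact: (measurableT_comp mg (@measurable_cons_rV R n)).
Qed.

End tonelli.

Lemma bounded_set_cbox (R : realType) (n : nat) (Omega : set 'rV[R]_n) :
  bounded_set Omega ->
  exists2 M : R, 0 < M & Omega `<=` cbox (const_mx (- M)) (const_mx M).
Proof.
move=> [M0 [_ /(_ (Num.max M0 0 + 1))]].
have : M0 < Num.max M0 0 + 1 by rewrite ltr_pwDr// le_max lexx.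
move=> /[swap] /[apply] OM.
have M0' : 0 < Num.max M0 0 + 1 by rewrite ltr_pwDr// le_max lexx orbT.
exists (Num.max M0 0 + 1) => // x /OM xM i; rewrite !mxE -ler_norml.
apply: le_trans xM; rewrite [leRHS]/Num.norm /= mx_normrE.
by apply/bigmax_geP; right; exists (ord0, i).
Qed.

Lemma lebesgue_rV_cbox_lty (R : realType) (n : nat) (a b : 'rV[R]_n) :
  (lebesgue_rV R n (cbox a b) < +oo)%E.
Proof.
have -> : cbox a b =
    [set x | forall i, `[a ord0 i, b ord0 i]%classic (x ord0 i)].
  by apply/seteqP; split => x xab i; have := xab i; rewrite /= in_itv.
rewrite (@lebesgue_rV_box _ _ (fun i => `[a ord0 i, b ord0 i]%classic)).
  rewrite -ge0_fin_numE; last by apply: prode_ge0 => i _; exact: measure_ge0.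
  apply: (big_ind (fun x : \bar R => x \is a fin_num)) => // [|i _].
    exact: fin_numM.
  by rewrite lebesgue_measure_itv/=; case: ifP.
by move=> i; exact: measurable_itv.
Qed.

(** * Semi-inner products and square-integrable functions *)

Section semi_inner_product.
Context (R : realType) (V : lmodType R) (X : V -> Prop) (B : V -> V -> R).

(** Definiteness is not asked, since a function vanishing almost everywhere need not be 0. The
    domain is a predicate on one ambient space, so that [L2], [H1] and [H01] share addition and
    scaling. *)
Definition semi_inner : Prop :=
  [/\ X 0, forall a u v, X u -> X v -> X (a *: u + v),
      forall u v, X u -> X v -> B u v = B v u,
      forall a u v w, X u -> X v -> X w -> B (a *: u + v) w = a * B u w + B v w &
      forall u, X u -> 0 <= B u u].

Definition seminorm_of (v : V) : R := Num.sqrt (B v v).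
Local Notation nB := seminorm_of.

Hypothesis siB : semi_inner.
Implicit Types (u v w : V) (a : R).

Lemma si0 : X 0. Proof. by case: siB. Qed.

Lemma siP a u v : X u -> X v -> X (a *: u + v).
Proof. by case: siB => _ + _ _ _; exact. Qed.

Lemma siZ a u : X u -> X (a *: u).
Proof. by move=> Xu; rewrite -[_ *: _]addr0; apply: siP => //; exact: si0. Qed.

Lemma siD u v : X u -> X v -> X (u + v).
Proof. by move=> Xu Xv; rewrite -[u]scale1r; exact: siP. Qed.

Lemma siN u : X u -> X (- u).
Proof. by move=> Xu; rewrite -scaleN1r; exact: siZ. Qed.

Lemma siB_ u v : X u -> X v -> X (u - v).
Proof. by move=> Xu Xv; apply: siD => //; exact: siN. Qed.

Lemma si_sym u v : X u -> X v -> B u v = B v u.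
Proof. by case: siB => _ _ + _ _; exact. Qed.

Lemma siPl a u v w : X u -> X v -> X w -> B (a *: u + v) w = a * B u w + B v w.
Proof. by case: siB => _ _ _ + _; exact. Qed.

Lemma si_ge0 u : X u -> 0 <= B u u.
Proof. by case: siB => _ _ _ _; exact. Qed.

Lemma siDl u v w : X u -> X v -> X w -> B (u + v) w = B u w + B v w.
Proof. by move=> Xu Xv Xw; rewrite -[u]scale1r siPl// mul1r scale1r. Qed.

Lemma si0l w : X w -> B 0 w = 0.
Proof.
move=> Xw; have := siDl si0 si0 Xw; rewrite addr0 => /eqP.
by rewrite -subr_eq0 opprD addrA subrr add0r oppr_eq0 => /eqP.
Qed.

Lemma siZl a u w : X u -> X w -> B (a *: u) w = a * B u w.
Proof. by move=> Xu Xw; rewrite -[_ *: _]addr0 siPl ?si0l ?addr0//; exact: si0. Qed.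

Lemma siNl u w : X u -> X w -> B (- u) w = - B u w.
Proof. by move=> Xu Xw; rewrite -scaleN1r siZl// mulN1r. Qed.

Lemma siBl u v w : X u -> X v -> X w -> B (u - v) w = B u w - B v w.
Proof. by move=> Xu Xv Xw; rewrite siDl// ?siNl//; exact: siN. Qed.

Lemma siDr u v w : X u -> X v -> X w -> B w (u + v) = B w u + B w v.
Proof.
move=> Xu Xv Xw; rewrite si_sym//; last exact: siD.
by rewrite siDl// (si_sym Xw Xu) (si_sym Xw Xv).
Qed.

Lemma siZr a u w : X u -> X w -> B w (a *: u) = a * B w u.
Proof.
by move=> Xu Xw; rewrite si_sym//; [rewrite siZl// (si_sym Xw Xu)|exact: siZ].
Qed.

Lemma siNr u w : X u -> X w -> B w (- u) = - B w u.
Proof. by move=> Xu Xw; rewrite -scaleN1r siZr// mulN1r. Qed.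

Lemma siBr u v w : X u -> X v -> X w -> B w (u - v) = B w u - B w v.
Proof. by move=> Xu Xv Xw; rewrite siDr// ?siNr//; exact: siN. Qed.

Lemma siDD u v : X u -> X v -> B (u + v) (u + v) = B u u + 2 * B u v + B v v.
Proof.
move=> Xu Xv; rewrite siDl//; last exact: siD.
rewrite !siDr// (si_sym Xv Xu); ring.
Qed.

Lemma siBB u v : X u -> X v -> B (u - v) (u - v) = B u u - 2 * B u v + B v v.
Proof.
move=> Xu Xv; rewrite siDD//; last exact: siN.
by rewrite siNr// siNl//; [rewrite siNr//; ring|exact: siN].
Qed.

Lemma nB_ge0 u : 0 <= nB u. Proof. exact: sqrtr_ge0. Qed.

Lemma sqr_nB u : X u -> nB u ^+ 2 = B u u.
Proof. by move=> Xu; rewrite sqr_sqrtr// si_ge0. Qed.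

(* Nonnegativity of B (u - t v) (u - t v) at the optimal t. *)
Lemma si_CS u v : X u -> X v -> `|B u v| <= nB u * nB v.
Proof.
move=> Xu Xv; rewrite -(@ler_pXn2r _ 2)// ?nnegrE// ?mulr_ge0 ?nB_ge0//.
rewrite real_normK ?num_real// exprMn !sqr_nB//.
have Q t : 0 <= B u u - 2 * t * B u v + t ^+ 2 * B v v.
  have := si_ge0 (siB_ Xu (siZ t Xv)); rewrite siBB//; last exact: siZ.
  rewrite siZr// siZl//; last exact: siZ.
  by rewrite siZr// => /le_trans; apply; rewrite le_eqVlt; apply/orP; left; apply/eqP; ring.
have [v0|v0] := eqVneq (B v v) 0.
  have [->|uv0] := eqVneq (B u v) 0; first by rewrite expr0n v0 mulr0.
  (* If [B v v = 0], the expression is affine in t; this t makes it equal to -1, which is absurd. *)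
  have := Q ((B u u + 1) / (2 * B u v)); rewrite v0 mulr0 addr0.
  have -> : B u u - 2 * ((B u u + 1) / (2 * B u v)) * B u v = -1 by field.
  by rewrite ler0N1.
have vgt0 : 0 < B v v by rewrite lt_def v0 si_ge0.
have := Q (B u v / B v v).
have -> : B u u - 2 * (B u v / B v v) * B u v + (B u v / B v v) ^+ 2 * B v v
  = (B u u * B v v - B u v ^+ 2) / B v v by field.
by rewrite pmulr_lge0 ?invr_gt0// subr_ge0.
Qed.

Lemma nB_triangle u v : X u -> X v -> nB (u + v) <= nB u + nB v.
Proof.
move=> Xu Xv; rewrite -(@ler_pXn2r _ 2)// ?nnegrE// ?addr_ge0 ?nB_ge0//.
rewrite sqr_nB; last exact: siD.
rewrite siDD// -!sqr_nB//; have := si_CS Xu Xv => /ler_normlP[_].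
nra.
Qed.

Lemma nBZ a u : X u -> nB (a *: u) = `|a| * nB u.
Proof.
move=> Xu; rewrite /nB siZl//; last exact: siZ.
by rewrite siZr// mulrA -expr2 sqrtrM ?sqr_ge0// sqrtr_sqr.
Qed.

Lemma nB0 : nB 0 = 0. Proof. by rewrite /nB si0l ?sqrtr0//; exact: si0. Qed.

Lemma nBN u : X u -> nB (- u) = nB u.
Proof. by move=> Xu; rewrite -scaleN1r nBZ// normrN1 mul1r. Qed.

Lemma nBC u v : X u -> X v -> nB (u - v) = nB (v - u).
Proof. by move=> Xu Xv; rewrite -nBN ?opprB//; exact: siB_. Qed.

Lemma nB_dist u v w : X u -> X v -> X w -> nB (u - w) <= nB (u - v) + nB (v - w).
Proof.
move=> Xu Xv Xw; have -> : u - w = (u - v) + (v - w) by rewrite addrA subrK.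
by apply: nB_triangle; exact: siB_.
Qed.

Lemma nB_le_dist u v : X u -> X v -> nB u <= nB v + nB (u - v).
Proof.
move=> Xu Xv; rewrite -{1}(subrK v u) addrC; apply: nB_triangle => //.
exact: siB_.
Qed.

End semi_inner_product.

Lemma semi_inner_sub (R : realType) (V : lmodType R) (X Y : V -> Prop)
    (B : V -> V -> R) :
  (forall v, Y v -> X v) -> Y 0 -> (forall a u v, Y u -> Y v -> Y (a *: u + v)) ->
  semi_inner X B -> semi_inner Y B.
Proof.
move=> YX Y0 YP [X0 XP BC BP B0]; split => //.
- by move=> u v /YX Xu /YX Xv; exact: BC.
- by move=> a u v w /YX Xu /YX Xv /YX Xw; exact: BP.
- by move=> u /YX; exact: B0.
Qed.

Lemma semi_innerD (R : realType) (V : lmodType R) (X : V -> Prop)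
    (B C : V -> V -> R) :
  semi_inner X B -> semi_inner X C -> semi_inner X (fun u v => B u v + C u v).
Proof.
move=> [X0 XP BC BP B0] [_ _ CC CP C0]; split => //.
- by move=> u v Xu Xv; rewrite BC// CC.
- by move=> a u v w Xu Xv Xw; rewrite BP// CP//; ring.
- by move=> u Xu; rewrite addr_ge0 ?B0 ?C0.
Qed.

Section pointwise.
Context (R : realType) (T : Type).
Implicit Types u v : T -> R.

Lemma fct_linE a u v x : (a *: u + v) x = a * u x + v x. Proof. by []. Qed.

Lemma fct_subE u v x : (u - v) x = u x - v x. Proof. by []. Qed.

Lemma fct_scaleE a u x : (a *: u) x = a * u x. Proof. by []. Qed.

End pointwise.

Lemma sum_half (R : realType) (N : nat) :
  \sum_(0 <= k < N) (2^-1 ^+ k : R) = 2 - 2 * 2^-1 ^+ N.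
Proof.
elim: N => [|N IH]; first by rewrite big_nil expr0 mulr1 subrr.
by rewrite big_nat_recr//= IH exprS; field.
Qed.

(** Fatou's lemma off the null set where convergence fails. It carries uniform integral bounds to
    almost everywhere limits, for [L2] completeness and for the passage from test functions to
    [H01]. *)
Lemma fatou_bound d (T : measurableType d) (R : realType)
    (mu : {measure set T -> \bar R}) (D : set T) (mD : measurable D)
    (g : nat -> T -> R) (h : T -> R) (M : \bar R) :
  (forall k, measurable_fun D (g k)) -> measurable_fun D h ->
  (forall k x, 0 <= g k x) -> (forall x, 0 <= h x) ->
  {ae mu, forall x, D x -> g k x @[k --> \oo] --> h x} ->
  (forall k, \int[mu]_(x in D) (g k x)%:E <= M)%E ->
  (\int[mu]_(x in D) (h x)%:E <= M)%E.
Proof.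
move=> mg mh g0 h0 [N [mN N0 DN]] gM.
have mDN : measurable (D `\` N) by exact: measurableD.
have gh x : (D `\` N) x -> g k x @[k --> \oo] --> h x.
  by move=> [Dx Nx]; apply: contrapT => ngh; apply: Nx; apply: DN => /(_ Dx).
rewrite (ge0_negligible_integral mN)//; last 2 first.
- exact/measurable_EFinP.
- by move=> x _; rewrite lee_fin.
rewrite (eq_integral (fun x => limn_einf (fun k => (g k x)%:E))); last first.
  move=> x; rewrite inE => /gh gx; apply/esym.
  have /cvg_limn_einf_sup[-> _]// : (g k x)%:E @[k --> \oo] --> (h x)%:E.
  by apply: cvg_EFin => //; exact: nearW.
apply: le_trans (@fatou _ _ _ mu _ mDN (fun k x => (g k x)%:E) _ _) _.
- by move=> k; apply/measurable_EFinP; apply: measurable_funS (mg k).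
- by move=> k x _; rewrite lee_fin.
rewrite limn_einf_lim; apply: lime_le; first exact: is_cvg_einfs.
apply: nearW => k; apply: le_trans (gM k).
apply: le_trans (@ereal_inf_lbound _ _ (\int[mu]_(x in D `\` N) (g k x)%:E)%E _) _.
  by exists k => //=.
apply: ge0_subset_integral => //.
- exact/measurable_EFinP.
- by move=> x _; rewrite lee_fin.
Qed.

Section l2_space.
Context (R : realType) (n : nat) (Omega : set 'rV[R]_n).
Hypothesis mO : measurable Omega.
Local Notation mu := (lebesgue_rV R n).
Implicit Types u v w : 'rV[R]_n -> R.

Lemma L2_integrable_sqr v :
  L2 Omega v -> mu.-integrable Omega (EFin \o (fun x => v x ^+ 2)).
Proof.
move=> [mv voo]; apply/integrableP; split.
  by apply/measurable_EFinP; exact: measurable_funX.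
apply: le_lt_trans voo; rewrite le_eqVlt; apply/orP; left; apply/eqP.
by apply: eq_integral => x _ /=; rewrite ger0_norm// sqr_ge0.
Qed.

Lemma L2_integrableM u v : L2 Omega u -> L2 Omega v ->
  mu.-integrable Omega (EFin \o (fun x => u x * v x)).
Proof.
move=> Lu Lv; have [mu_ _] := Lu; have [mv _] := Lv.
apply: (@le_integrable _ _ _ mu Omega mO _
  ((fun x => (u x ^+ 2)%:E) \+ (fun x => (v x ^+ 2)%:E))%E).
- by apply/measurable_EFinP; exact: measurable_funM.
- move=> x _ /=; rewrite lee_fin.
  rewrite [leRHS]ger0_norm ?addr_ge0 ?sqr_ge0// ler_norml; apply/andP; split; nra.
- by apply: integrableD => //; exact: L2_integrable_sqr.
Qed.

Lemma L2_lin a u v : L2 Omega u -> L2 Omega v -> L2 Omega (a *: u + v).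
Proof.
move=> Lu Lv; have [mu_ _] := Lu; have [mv _] := Lv; split.
  apply: (@measurable_funD _ _ _ _ (fun x => a * u x)) => //.
  exact: (measurable_funM (@measurable_cst _ _ _ _ _ a)).
have : mu.-integrable Omega ((fun x => ((a ^+ 2)%:E * (u x ^+ 2)%:E)) \+
    ((fun x => ((2 * a)%:E * (u x * v x)%:E)) \+ (fun x => (v x ^+ 2)%:E)))%E.
  apply: integrableD => //; first exact/integrableZl/L2_integrable_sqr.
  apply: integrableD => //; first exact/integrableZl/L2_integrableM.
  exact: L2_integrable_sqr.
move=> /integrableP[_]; apply: le_lt_trans; rewrite le_eqVlt; apply/orP; left.
apply/eqP/eq_integral => x _ /=; congr EFin.
rewrite ger0_norm.
  rewrite fct_linE; ring.
have -> : a ^+ 2 * u x ^+ 2 + (2 * a * (u x * v x) + v x ^+ 2) = (a * u x + v x) ^+ 2.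
  by ring.
exact: sqr_ge0.
Qed.

Lemma L2_0 : L2 Omega 0.
Proof.
split; first exact: measurable_cst.
rewrite (eq_integral (cst 0%E)) ?integral0// => x _.
by rewrite /= /cst /GRing.zero/= expr0n.
Qed.

Lemma l2_semi_inner : semi_inner (L2 Omega) (l2dot Omega).
Proof.
split.
- exact: L2_0.
- exact: L2_lin.
- by move=> u v _ _; apply: eq_Rintegral => x _; rewrite mulrC.
- move=> a u v w Lu Lv Lw; rewrite /l2dot -RintegralZl//; last exact: L2_integrableM.
  rewrite -RintegralD//.
  + by apply: eq_Rintegral => x _; rewrite fct_linE; ring.
  + have := integrableZl mO a (L2_integrableM Lu Lw).
    by apply: eq_integrable => // x _ /=; rewrite EFinM.
  + exact: L2_integrableM.
- by move=> u _; apply: Rintegral_ge0 => x _; rewrite -expr2 sqr_ge0.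
Qed.

Lemma l2norm_seminorm v : l2norm Omega v = seminorm_of (l2dot Omega) v.
Proof. by []. Qed.

Lemma l2dotE u v : L2 Omega u -> L2 Omega v ->
  (l2dot Omega u v)%:E = (\int[mu]_(x in Omega) (u x * v x)%:E)%E.
Proof.
move=> Lu Lv; rewrite /l2dot /Rintegral fineK//.
exact/integrable_fin_num/L2_integrableM.
Qed.

Lemma l2normE v : L2 Omega v ->
  ((l2norm Omega v ^+ 2)%:E = \int[mu]_(x in Omega) (v x ^+ 2)%:E)%E.
Proof. by move=> Lv; rewrite (sqr_nB l2_semi_inner)// l2dotE. Qed.

Lemma L2_bounded_by (w v : 'rV[R]_n -> R) : measurable_fun Omega v -> L2 Omega w ->
  (forall x, Omega x -> `|v x| <= `|w x|) -> L2 Omega v.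
Proof.
move=> mv [mw woo] vw; split=> //; apply: le_lt_trans woo.
apply: ge0_le_integral => //.
- by move=> x _; rewrite lee_fin sqr_ge0.
- by apply/measurable_EFinP; exact: measurable_funX.
- by apply/measurable_EFinP; exact: measurable_funX.
- by move=> x Ox; rewrite lee_fin -(real_normK (num_real (v x)))
    -(real_normK (num_real (w x))) ler_pXn2r// ?nnegrE// vw.
Qed.

Lemma l2dot_ae_eq u u' v : L2 Omega u -> L2 Omega u' -> L2 Omega v ->
  ae_eq mu Omega u u' -> l2dot Omega u v = l2dot Omega u' v.
Proof.
move=> [mu_ _] [mu'_ _] [mv _] uu'; rewrite /l2dot /Rintegral; congr fine.
apply: ae_eq_integral => //.
- by apply/measurable_EFinP; exact: measurable_funM.
- by apply/measurable_EFinP; exact: measurable_funM.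
- by apply: filterS uu' => x /[apply] ->.
Qed.

Lemma l2norm_eq0_ae v : L2 Omega v -> l2norm Omega v = 0 -> ae_eq mu Omega v (cst 0).
Proof.
move=> Lv v0; have [mv _] := Lv.
have := l2normE Lv; rewrite v0 expr0n => /esym iv0.
have mv2 : measurable_fun Omega (EFin \o (fun x => v x ^+ 2)).
  by apply/measurable_EFinP; exact: measurable_funX.
have [+ _] := ae_eq_integral_abs mu mO mv2.
have -> : (\int[mu]_(x in Omega) `|(EFin \o (fun x => v x ^+ 2)%R) x| = 0)%E.
  by rewrite -[RHS]iv0; apply: eq_integral => x _ /=; rewrite ger0_norm ?sqr_ge0.
move=> /(_ erefl).
by apply: filterS => x /[apply] /= -[] /eqP; rewrite sqrf_eq0 => /eqP.
Qed.

Lemma l2norm_ae0 v : measurable_fun Omega v -> ae_eq mu Omega v (cst 0) ->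
  l2norm Omega v = 0.
Proof.
move=> mv v0; rewrite /l2norm (_ : l2dot _ _ _ = 0) ?sqrtr0//.
rewrite /l2dot /Rintegral (@ae_eq_integral _ _ _ _ _ (cst 0%E)) ?integral0//.
- by apply/measurable_EFinP; exact: measurable_funM.
- by apply: filterS v0 => x /[apply] -> /=; rewrite /cst mulr0.
Qed.

(* A sequence with summable increments converges a.e. because the integral of
   the sum of the increments is finite; Fatou's lemma gives the norm
   convergence. *)
Lemma L2_complete (v : nat -> 'rV[R]_n -> R) : (mu Omega < +oo)%E ->
  (forall k, L2 Omega (v k)) ->
  (forall k, l2norm Omega (v k.+1 - v k) <= 2^-1 ^+ k) ->
  exists w, [/\ L2 Omega w, forall k, l2norm Omega (v k - w) <= 2 * 2^-1 ^+ k &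
    {ae mu, forall x, Omega x -> v k x @[k --> \oo] --> w x}].
Proof.
move=> Ofin Lv dv.
have L1 : L2 Omega (cst 1).
  split; first exact: measurable_cst.
  under eq_integral do rewrite /cst expr1n.
  by rewrite integral_cst// mul1e.
pose c := l2norm Omega (cst 1).
pose d k x : R := `|v k.+1 x - v k x|.
have d0 k x : (0 <= (d k x)%:E)%E by rewrite lee_fin; exact: normr_ge0.
have Ld k : L2 Omega (v k.+1 - v k) by exact: (siB_ l2_semi_inner).
have md k : measurable_fun Omega (d k).
  by apply: measurableT_comp => //; have [] := Ld k.
have id k : (\int[mu]_(x in Omega) (d k x)%:E <= (2^-1 ^+ k * c)%:E)%E.
  have Ldk : L2 Omega (d k).
    apply: (L2_bounded_by (md k) (Ld k)) => x _.
    by rewrite /d normr_id.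
  have -> : (\int[mu]_(x in Omega) (d k x)%:E = (l2dot Omega (d k) (cst 1))%:E)%E.
    by rewrite l2dotE//; apply: eq_integral => x _; rewrite mulr1.
  rewrite lee_fin; apply: le_trans (ler_norm _) _.
  apply: le_trans (si_CS l2_semi_inner Ldk L1) _.
  apply: ler_wpM2r; first exact: sqrtr_ge0.
  apply: le_trans (dv k); rewrite le_eqVlt; apply/orP; left; apply/eqP.
  rewrite /seminorm_of /l2norm; congr Num.sqrt; apply: eq_Rintegral => x _.
  by rewrite /d -expr2 real_normK ?num_real.
pose S x := (\sum_(k <oo) (d k x)%:E)%E.
have mS : measurable_fun Omega S.
  apply: ge0_emeasurable_sum => [k x _ _|k _]; first exact: d0.
  exact/measurable_EFinP.
have S0 x : (0 <= S x)%E by apply: nneseries_ge0.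
have c0 : 0 <= c by exact: sqrtr_ge0.
have iS : mu.-integrable Omega S.
  apply/integrableP; split=> //.
  under eq_integral do rewrite gee0_abs//.
  rewrite integral_nneseries//; last by move=> k; exact/measurable_EFinP.
  apply: (@le_lt_trans _ _ (2 * c)%:E); last exact: ltry.
  apply: lime_le.
    by apply: is_cvg_nneseries => k _ _; apply: integral_ge0.
  apply: nearW => N.
  apply: (@le_trans _ _ (\sum_(0 <= k < N) (2^-1 ^+ k * c))%:E).
    by rewrite -sumEFin; apply: lee_sum => k _; exact: id.
  rewrite lee_fin -mulr_suml ler_wpM2r// sum_half.
  by rewrite gerBl// mulr_ge0// exprn_ge0.
have aeS := integrable_ae mO iS.
pose G := Omega `&` [set x | S x \is a fin_num].
have mG : measurable G by exact: emeasurable_fin_num.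
have GO : G `<=` Omega by move=> x [].
(* Outside [G], where the increments need not be summable, the sequence is set to 0. It then
   converges at every point, which makes the limit [w] measurable. *)
pose v' k x : R := if x \in G then v k x else 0.
have cv' x : cvgn (fun k => v' k x).
  rewrite /v'; have [|_] := boolP (x \in G); last exact: is_cvg_cst.
  rewrite inE => -[Ox Sx].
  have : cvgn (series (fun k => v k.+1 x - v k x)).
    apply: normed_cvg; apply: nondecreasing_is_cvgn.
      apply/nondecreasing_seqP => N; rewrite /= -subr_ge0 -/(series _).
      by rewrite /series/= big_nat_recr//= addrAC subrr add0r.
    exists (fine (S x)) => _ [N _ <-]; rewrite -lee_fin fineK// /= -sumEFin.
    by apply: nneseries_lim_ge.
  move=> /cvg_ex[l /= sl]; apply/cvg_ex; exists (v 0 x + l).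
  have -> : (fun k => v k x) = (fun k => v 0 x + series (fun k => v k.+1 x - v k x) k).
    by apply/funext => k; rewrite seriesEnat/= telescope_sumr// addrC subrK.
  by apply: cvgD => //; exact: cvg_cst.
pose w x := limn (fun k => v' k x).
have mv' k : measurable_fun Omega (v' k).
  apply/(measurable_restrict (v k) mG mO); rewrite setIidr//.
  by apply: measurable_funS (Lv k).1.
have mw : measurable_fun Omega w.
  by apply: (measurable_fun_cvg mv') => x _; exact: cv'.
have aew : {ae mu, forall x, Omega x -> v k x @[k --> \oo] --> w x}.
  apply: filterS aeS => x /[swap] Ox /(_ Ox) Sx.
  have -> : (fun k => v k x) = (fun k => v' k x).
    by apply/funext => k; rewrite /v' mem_set.
  exact: cv'.
have tail k m : l2norm Omega (v k - v (m + k)%N) <= 2 * 2^-1 ^+ k.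
  (* The exact geometric sum is what the induction on m preserves; the stated bound is not
     inductive. *)
  apply: (@le_trans _ _ (2 * 2^-1 ^+ k - 2 * 2^-1 ^+ (m + k))); last first.
    by rewrite gerBl// mulr_ge0// exprn_ge0.
  elim: m => [|m IH].
    by rewrite add0n !subrr l2norm_seminorm (nB0 l2_semi_inner).
  apply: le_trans (nB_dist l2_semi_inner (Lv k) (Lv (m + k)%N) (Lv _)) _.
  rewrite addSn (nBC l2_semi_inner (Lv (m + k)%N) (Lv (m + k).+1)).
  apply: le_trans (lerD IH (dv (m + k)%N)) _.
  by rewrite exprS le_eqVlt; apply/orP; left; apply/eqP; field.
have kw k : (\int[mu]_(x in Omega) ((v k - w) x ^+ 2)%:E <= ((2 * 2^-1 ^+ k) ^+ 2)%:E)%E.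
  apply: (@fatou_bound _ _ _ mu Omega mO (fun m x => (v k x - v (m + k)%N x) ^+ 2)).
  - by move=> m; apply: measurable_funX; apply: measurable_funB; apply: (Lv _).1.
  - by apply: measurable_funX; apply: measurable_funB => //; apply: (Lv _).1.
  - by move=> m x; rewrite sqr_ge0.
  - by move=> x; rewrite sqr_ge0.
  - apply: filterS aew => x /[apply] vw.
    have {}vw : v (m + k)%N x @[m --> \oo] --> w x by rewrite (@cvg_shiftn k _ (fun m => v m x)).
    by under eq_fun do rewrite expr2; apply: cvgM; apply: cvgB => //; exact: cvg_cst.
  - move=> m; rewrite -(@l2normE (v k - v (m + k)%N)); last exact: (siB_ l2_semi_inner).
    by rewrite lee_fin ler_pXn2r ?nnegrE ?tail// ?mulr_ge0 ?exprn_ge0 ?sqrtr_ge0.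
have Lvw k : L2 Omega (v k - w).
  split; first by apply: measurable_funB => //; apply: (Lv _).1.
  exact: le_lt_trans (kw k) (ltry _).
exists w; split => //.
  rewrite -(subKr (v 0) w); apply: (siB_ l2_semi_inner) => //.
move=> k; rewrite -(@ler_pXn2r _ 2)// ?nnegrE ?sqrtr_ge0 ?mulr_ge0 ?exprn_ge0//.
by rewrite -lee_fin l2normE.
Qed.

End l2_space.

(** * Test functions *)

Section lines.
Context (R : realType) (n : nat).
Implicit Types (x e : 'rV[R]_n) (f : 'rV[R]_n -> R).

Lemma is_derive_line f x e (t df : R) :
  is_derive (t *: e + x) e f df -> is_derive t 1 (fun s : R => f (s *: e + x)) df.
Proof.
move=> [dx dxE].
have E : (fun h : R => h^-1 *: (((fun s : R => f (s *: e + x)) \o shift t) (h *: 1)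
             - f (t *: e + x))) =
  (fun h : R => h^-1 *: ((f \o shift (t *: e + x)) (h *: e) - f (t *: e + x))).
  apply/funext => h /=; congr (_ *: (f _ - _)).
  by rewrite scalerDl addrA /GRing.scale/= mulr1.
by split; [rewrite /derivable E|rewrite -dxE /derive E].
Qed.

(** As t varies this runs along the line through [x] parallel to axis [i]. The result ignores the
    old coordinate, so a function of [x] built from it is constant along that line. *)
Definition setc (i : 'I_n) (t : R) x : 'rV[R]_n :=
  \row_j (if j == i then t else x ord0 j).

Lemma setcE i t x : setc i t x = t *: delta_mx ord0 i + setc i 0 x.
Proof.
apply/rowP => j; rewrite !mxE eqxx /=; case: eqP => _; first by rewrite mulr1 addr0.
by rewrite mulr0 add0r.
Qed.

Lemma setc_id i x : setc i (x ord0 i) x = x.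
Proof. by apply/rowP => j; rewrite !mxE; case: eqP => [->|]. Qed.

Lemma setc_eq i t x : setc i t x ord0 i = t.
Proof. by rewrite mxE eqxx. Qed.

End lines.

Lemma setc_cons0 (R : realType) n (s t : R) (y : 'rV[R]_n) :
  setc ord0 t (cons_rV (s, y)) = cons_rV (t : measurableTypeR R, y).
Proof.
apply/rowP => j; rewrite !mxE; case: unliftP => [k ->|->]; last by rewrite eqxx.
by rewrite eq_sym (negbTE (neq_lift _ _)).
Qed.

Lemma setc_consS (R : realType) n (i : 'I_n) (s t : R) (y : 'rV[R]_n) :
  setc (lift ord0 i) t (cons_rV (s, y)) = cons_rV (s : measurableTypeR R, setc i t y).
Proof.
apply/rowP => j; rewrite !mxE; case: unliftP => [k ->|->] /=.
  by rewrite (inj_eq lift_inj) mxE.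
by [].
Qed.

Section continuous_pointwise.
Context (R : realType) (T : topologicalType) (f g : T -> R).
Hypotheses (cf : continuous f) (cg : continuous g).

Lemma continuous_addf : continuous (fun x => f x + g x).
Proof. by move=> x; apply: cvgD; [exact: cf|exact: cg]. Qed.

Lemma continuous_mulf : continuous (fun x => f x * g x).
Proof. by move=> x; apply: cvgM; [exact: cf|exact: cg]. Qed.

End continuous_pointwise.

(** * Smooth bumps from the flat function exp(-1/s) *)

Section smooth_bump.
Context (R : realType).
Implicit Types (P : {poly R}) (s : R).

(** Polynomials in 1/s times the classical flat function. The family is closed under
    differentiation, also at 0, which is how smoothness is obtained. *)
Definition expinv P s : R := if 0 < s then P.[s^-1] * expR (- s^-1) else 0.

(** With y = 1/s and dy/ds = -y^2, the derivative of P(y) exp(-y) in s is y^2 (P(y) - P'(y))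
    exp(-y). *)
Definition expinv_deriv P : {poly R} := 'X^2 * (P - P^`()).

Lemma poly_le_expR P : exists C, forall y, 0 <= y -> `|P.[y]| <= C * expR y.
Proof.
exists (\sum_(i < size P) `|P`_i| * i`!%:R) => y y0.
rewrite horner_coef mulr_suml; apply: le_trans (ler_norm_sum _ _ _) _.
apply: ler_sum => i _; rewrite normrM -mulrA ler_wpM2l//.
rewrite normrX ger0_norm//; case: (nat_of_ord i) => [|m].
  by rewrite expr0 fact0 mul1r; have := expR_ge1Dx y; lra.
have := expR_ge1Dxn m y0; set z := _ / _ => zle.
rewrite (_ : y ^+ m.+1 = m.+1`!%:R * z); last first.
  by rewrite /z; field; rewrite pnatr_eq0 -lt0n fact_gt0.
by rewrite ler_wpM2l//; lra.
Qed.

(** Bounding the polynomial ['X * P] by the exponential, instead of [P], gains the factor s. *)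
Lemma expinv_le P : exists C, forall s, `|expinv P s| <= C * `|s|.
Proof.
have [C PC] := poly_le_expR ('X * P); exists `|C| => s; rewrite /expinv.
case: ifPn => [s0|_]; last by rewrite normr0 mulr_ge0.
have si0 : 0 <= s^-1 by rewrite invr_ge0 ltW.
have := PC _ si0; rewrite hornerM hornerX !normrM.
rewrite (gtr0_norm (expR_gt0 _)) (ger0_norm si0) (gtr0_norm s0) expRN => H.
rewrite ler_pdivrMr ?expR_gt0//.
have : C * expR s^-1 <= `|C| * expR s^-1 by rewrite ler_wpM2r ?expR_ge0 ?ler_norm.
move=> /(le_trans H); rewrite ler_pdivrMl// => /le_trans; apply.
by rewrite le_eqVlt; apply/orP; left; apply/eqP; ring.
Qed.

Lemma is_derive_expinv P s : is_derive s 1 (expinv P) (expinv (expinv_deriv P) s).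
Proof.
have [s0|s0|<-] := ltgtP 0 s.
- apply: (@near_eq_is_derive _ _ _ (fun s => P.[s^-1] * expR (- s^-1))).
    near=> t; rewrite /expinv ifT//.
    by near: t; exact: lt_nbhsr.
  have sN0 : s != 0 by rewrite gt_eqF.
  have dV : is_derive s 1 (fun s : R => s^-1) (- s ^- 2).
    have := is_deriveV (f := id) sN0 (is_derive_id s 1).
    by rewrite /GRing.scale/= mulr1.
  have dP := is_derive1_comp (is_derive_poly P s^-1) dV.
  have dE := @is_derive1_comp _ expR (fun s => - s^-1) _ _ _
    (is_derive_expR (- s^-1)) (is_deriveN dV).
  apply: (@is_derive_eq _ _ _ _ _ _ _ _ (is_deriveM dP dE)).
  rewrite /expinv s0 /expinv_deriv !hornerE/= /GRing.scale/= opprK.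
  by rewrite exprVn; ring.
- rewrite {2}/expinv ltNge (ltW s0)/=.
  apply: (@near_eq_is_derive _ _ _ (cst 0)).
  near=> t; rewrite /expinv ifF//; apply/negbTE; rewrite -leNgt ltW//.
  by near: t; exact: lt_nbhsl.
- rewrite {2}/expinv ltxx.
  have [C HC] := expinv_le ('X * P).
  suff H : (fun h : R => h^-1 *: ((expinv P \o shift 0) (h *: 1) - expinv P 0))
      @ 0^' --> (0 : R).
    by split; [apply: cvgP; exact: H|exact: cvg_lim H].
  (* At 0 the difference quotient is again a member of the family, for the polynomial ['X * P], and
     [expinv_le] sends it to 0. *)
  have E : (fun h : R => h^-1 *: ((expinv P \o shift 0) (h *: 1) - expinv P 0)) =
      expinv ('X * P).
    apply/funext => h; rewrite /= addr0 /GRing.scale/= mulr1 /expinv ltxx subr0.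
    case: ifPn => // h0; last by rewrite mulr0.
    by rewrite hornerM hornerX mulrA.
  rewrite E; apply/cvgrPdist_le => e e0.
  near=> h; rewrite sub0r normrN; apply: le_trans (HC h) _.
  have C0 : 0 < `|C| + 1 by rewrite ltr_wpDl.
  have hC : `|h| <= e / (`|C| + 1) by near: h; apply: dnbhs0_le; rewrite divr_gt0.
  move: hC; rewrite ler_pdivlMr// => hC; apply: le_trans hC.
  rewrite mulrC ler_wpM2l//; have := ler_norm C; lra.
Unshelve. all: by end_near. Qed.

Definition expinv_n (j : nat) : R -> R := expinv (iter j expinv_deriv 1).

Lemma is_derive_expinv_n j s : is_derive s 1 (expinv_n j) (expinv_n j.+1 s).
Proof. exact: is_derive_expinv. Qed.

Definition bump1 : R -> R := expinv 1.

Lemma bump1_le0 s : s <= 0 -> bump1 s = 0.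
Proof. by move=> s0; rewrite /bump1 /expinv ltNge s0. Qed.

Lemma bump1_ge0 s : 0 <= bump1 s.
Proof. by rewrite /bump1 /expinv; case: ifP => // _; rewrite hornerE mul1r expR_ge0. Qed.

Lemma bump1_le1 s : bump1 s <= 1.
Proof.
rewrite /bump1 /expinv; case: ifP => // s0.
by rewrite hornerE mul1r expR_le1 oppr_le0 invr_ge0 ltW.
Qed.

Lemma bump1_cvg s : 0 < s -> bump1 (k%:R * s) @[k --> \oo] --> (1 : R).
Proof.
move=> s0; suff : bump1 (k%:R * s) @[k --> \oo] --> expR (0 : R) by rewrite expR0.
apply: (@cvg_trans _ (expR (- (k%:R * s)^-1) @[k --> \oo])).
  apply: near_eq_cvg; near=> k; rewrite /bump1 /expinv ifT ?hornerE ?mul1r//.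
  by rewrite mulr_gt0// ltr0n; near: k; exact: nbhs_infty_gt.
apply: continuous_cvg; first exact: continuous_expR.
rewrite -oppr0; apply: cvgN.
apply/cvgrPdist_le => e e0; near=> k; rewrite sub0r normrN.
have k0 : (0 : R) < k%:R by rewrite ltr0n; near: k; exact: nbhs_infty_gt.
rewrite ger0_norm ?invr_ge0 ?mulr_ge0 ?ltW//.
rewrite invf_plt ?posrE ?mulr_gt0// -ltr_pdivrMr//.
by near: k; exact: nbhs_infty_gtr.
Unshelve. all: by end_near. Qed.

End smooth_bump.


Section smooth_functions.
Context (R : realType) (n : nat).
Implicit Types (f g : 'rV[R]_n -> R) (i : 'I_n).

Lemma Ck_continuous k f : Ck k f -> continuous f.
Proof. by case: k => [|k] [cf _]. Qed.

Lemma CkW k f : Ck k.+1 f -> Ck k f.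
Proof.
elim: k f => [|k IH] f [cf [df pf]]; first by split.
by split=> //; split=> // i; apply: IH; exact: pf.
Qed.

Lemma partialD f g i : (forall x, derivable f x (delta_mx ord0 i)) ->
  (forall x, derivable g x (delta_mx ord0 i)) ->
  partial i (fun x => f x + g x) = (fun x => partial i f x + partial i g x).
Proof. by move=> df dg; apply/funext => x; rewrite /partial; exact: deriveD. Qed.

Lemma partialM f g i : (forall x, derivable f x (delta_mx ord0 i)) ->
  (forall x, derivable g x (delta_mx ord0 i)) ->
  partial i (fun x => f x * g x) =
  (fun x => f x * partial i g x + g x * partial i f x).
Proof. by move=> df dg; apply/funext => x; rewrite /partial; exact: deriveM. Qed.

Lemma CkD k f g : Ck k f -> Ck k g -> Ck k (fun x => f x + g x).
Proof.
elim: k f g => [|k IH] f g [cf pf] [cg pg].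
  by split=> //; exact: continuous_addf.
case: pf pg => [df pf] [dg pg].
split; first exact: continuous_addf.
split; first by move=> x i; exact: derivableD.
by move=> i; rewrite partialD//; apply: IH; [exact: pf|exact: pg].
Qed.

Lemma CkM k f g : Ck k f -> Ck k g -> Ck k (fun x => f x * g x).
Proof.
elim: k f g => [|k IH] f g Cf Cg.
  by split=> //; apply: continuous_mulf;
    [exact: (Ck_continuous Cf)|exact: (Ck_continuous Cg)].
have [cf [df pf]] := Cf; have [cg [dg pg]] := Cg.
split; first exact: continuous_mulf.
split; first by move=> x i; exact: derivableM.
move=> i; rewrite partialM//; apply: CkD; apply: IH;
  [exact: (CkW Cf)|exact: pg|exact: (CkW Cg)|exact: pf].
Qed.

Lemma Ck_cst k (c : R) : Ck k (fun _ : 'rV[R]_n => c).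
Proof.
elim: k c => [|k IH] c; first by split=> //; exact: cst_continuous.
split; first exact: cst_continuous.
split; first by move=> x i; exact: derivable_cst.
move=> i; rewrite (_ : partial i _ = fun=> 0); first exact: IH.
by apply/funext => x; exact: derive_cst.
Qed.

(** Derivatives are supplied as a sequence, each term the derivative of the one before, so that the
    induction on k only shifts the index j. *)
Lemma Ck_coord (h : nat -> R -> R) :
  (forall j (s : R), is_derive s 1 (h j) (h j.+1 s)) ->
  forall i j k, Ck k (fun x : 'rV[R]_n => h j (x ord0 i)).
Proof.
move=> dh i j k.
have ch j' : continuous (fun x : 'rV[R]_n => h j' (x ord0 i)).
  move=> x; apply: (@continuous_comp _ _ _ (fun x : 'rV[R]_n => x ord0 i)).
    exact: coord_continuous.
  by apply: differentiable_continuous; apply/derivable1_diffP; have [] := dh j' (x ord0 i).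
elim: k j => [|k IH] j; first by split=> //; exact: ch.
have dv x i' : is_derive x (delta_mx ord0 i' : 'rV[R]_n)
    (fun x : 'rV[R]_n => h j (x ord0 i))
    ((i == i')%:R * h j.+1 (x ord0 i)).
  have [->|ii'] := eqVneq i i'; last first.
    rewrite mul0r.
    have E : (fun l : R => l^-1 *: (((fun x : 'rV[R]_n => h j (x ord0 i)) \o shift x)
      (l *: delta_mx ord0 i') - h j (x ord0 i))) = (fun=> 0).
      apply/funext => l /=.
      by rewrite !mxE (negbTE ii') mulr0 add0r subrr scaler0.
    by split; rewrite /derivable ?/derive E; [exact: is_cvg_cst|exact: lim_cst].
  have [dd ddE] := dh j (x ord0 i').
  have E : (fun l : R => l^-1 *: (((fun x : 'rV[R]_n => h j (x ord0 i')) \o shift x)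
      (l *: delta_mx ord0 i') - h j (x ord0 i'))) =
      (fun l : R => l^-1 *: (((h j) \o shift (x ord0 i')) (l *: 1) - h j (x ord0 i'))).
    apply/funext => l /=.
    congr (_ *: (h j _ - _)); by rewrite !mxE !eqxx.
  by rewrite mul1r -ddE; split; rewrite /derivable ?/derive E.
split; first exact: ch.
split; first by move=> x i'; have [] := dv x i'.
move=> i'; rewrite (_ : partial i' _ = fun x => (i == i')%:R * h j.+1 (x ord0 i)).
  by apply: CkM; [exact: Ck_cst|exact: IH].
by apply/funext => x; have [_] := dv x i'.
Qed.

Lemma smooth_prod (I : Type) (s : seq I) (F : I -> 'rV[R]_n -> R) :
  (forall j, smooth (F j)) -> smooth (fun x => \prod_(i <- s) F i x).
Proof.
move=> sF k; elim: s => [|i s IH].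
  by under eq_fun do rewrite big_nil; exact: Ck_cst.
by under eq_fun do rewrite big_cons; apply: CkM => //; exact: sF.
Qed.

Lemma smooth_partial f i : smooth f -> smooth (partial i f).
Proof. by move=> sf k; have [_ [_]] := sf k.+1; exact. Qed.

Lemma smooth_continuous f : smooth f -> continuous f.
Proof. by move=> /(_ 0%N) []. Qed.

Lemma smooth_derivable f i x : smooth f -> derivable f x (delta_mx ord0 i).
Proof. by move=> /(_ 1%N) [_ []]. Qed.

Lemma smooth_is_derive f i x : smooth f ->
  is_derive x (delta_mx ord0 i) f (partial i f x).
Proof. by move=> sf; apply: derivableP; exact: smooth_derivable. Qed.

Lemma smooth_mul f g : smooth f -> smooth g -> smooth (fun x => f x * g x).
Proof. by move=> sf sg k; exact: CkM. Qed.

End smooth_functions.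

Section box_bump.
Context (R : realType) (n : nat).
Implicit Types (a b x : 'rV[R]_n).

Let is_derive_affine (k c s : R) (e : R) : is_derive s (1 : R) (fun t : R => k * (e * (t - c))) (k * e).
Proof.
have := is_deriveZ (k * e) (is_deriveB (is_derive_id s (1 : R)) (is_derive_cst c s 1)).
rewrite subr0 /GRing.scale/= mulr1.
move=> H; have -> : (fun t : R => k * (e * (t - c))) = (k * e) \*: (id - cst c).
  by apply/funext => t; rewrite mulrA.
exact: H.
Qed.

(** The sign [e] is 1 or -1 in the applications, for the two faces of a box orthogonal to axis [i].
    The powers of [k * e] in the proof come from the chain rule. *)
Lemma smooth_bump_coord (k c e : R) (i : 'I_n) :
  smooth (fun x : 'rV[R]_n => bump1 (k * (e * (x ord0 i - c)))).
Proof.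
move=> m.
pose h j s : R := (k * e) ^+ j * @expinv_n R j (k * (e * (s - c))).
have dh j (s : R) : is_derive s 1 (h j) (h j.+1 s).
  have := is_deriveZ ((k * e) ^+ j) (@is_derive1_comp _ (@expinv_n R j)
     (fun t : R => k * (e * (t - c))) _ _ _
     (is_derive_expinv_n j (k * (e * (s - c)))) (is_derive_affine k c s e)).
  move=> H; apply: (is_derive_eq H); rewrite /h exprS /GRing.scale/=; ring.
have := Ck_coord dh i 0%N m.
by rewrite /h; under eq_fun do rewrite expr0 mul1r.
Qed.

(** Each factor is exp(-1/(k s)) in the distance s to a face, and tends to 1 as k grows. So these
    are test functions that converge boundedly to the indicator of the open box. *)
Definition box_bump a b (k : nat) x : R :=
  \prod_(i < n) (bump1 (k%:R * (x ord0 i - a ord0 i)) *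
                 bump1 (k%:R * (b ord0 i - x ord0 i))).

Lemma smooth_box_bump a b k : smooth (box_bump a b k).
Proof.
apply: smooth_prod => i; apply: smooth_mul.
  by have := smooth_bump_coord k%:R (a ord0 i) 1 i; under eq_fun do rewrite mul1r.
have := smooth_bump_coord k%:R (b ord0 i) (-1) i.
by under eq_fun do rewrite mulN1r opprB.
Qed.

Lemma box_bump_out a b k x : ~ obox a b x -> box_bump a b k x = 0.
Proof.
move=> /existsNP[i /negP]; rewrite negb_and -!leNgt => abx.
rewrite /box_bump (bigD1 i)//=.
case/orP: abx => abx.
  by rewrite (bump1_le0 (s := _ * (x _ _ - _))) ?mul0r// mulr_ge0_le0// subr_le0.
by rewrite (bump1_le0 (s := _ * (b _ _ - _))) ?mulr0 ?mul0r// mulr_ge0_le0// subr_le0.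
Qed.

Lemma box_bump_ge0 a b k x : 0 <= box_bump a b k x.
Proof. by apply: prodr_ge0 => i _; rewrite mulr_ge0// bump1_ge0. Qed.

Lemma box_bump_le1 a b k x : box_bump a b k x <= 1.
Proof.
suff /andP[] : 0 <= box_bump a b k x <= 1 by [].
apply: (big_ind (fun y : R => 0 <= y <= 1)) => [|y z /andP[y0 y1] /andP[z0 z1]|i _].
- by rewrite ler01 lexx.
- by rewrite mulr_ge0//= mulr_ile1.
- by rewrite mulr_ge0 ?bump1_ge0//= mulr_ile1 ?bump1_ge0 ?bump1_le1.
Qed.

Lemma box_bump_cvg a b x : box_bump a b k x @[k --> \oo] --> (\1_(obox a b) x : R).
Proof.
rewrite indicE; have [|abx] := boolP (x \in obox a b); last first.
  have -> : (box_bump a b)^~ x = (fun=> 0); last exact: cvg_cst.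
  by apply/funext => k; rewrite box_bump_out//; rewrite notin_setE in abx.
rewrite inE => abx.
rewrite (_ : true%:R = \prod_(i < n) (1 * 1 : R)); last by rewrite big1 ?mulr1.
rewrite /box_bump; apply: (@cvg_big R _ *%R 1) => // [|i _].
  by move=> [y z]; apply: (@cvgM _ _ _ _ fst snd); [exact: cvg_fst|exact: cvg_snd].
have /andP[ax xb] := abx i.
by apply: cvgM; apply: bump1_cvg; rewrite subr_gt0.
Qed.

Lemma test_box_bump (Omega : set 'rV[R]_n) a b k : cbox a b `<=` Omega ->
  test_function Omega (box_bump a b k).
Proof.
move=> abO; split; first exact: smooth_box_bump.
exists (cbox a b); split=> //; first exact: compact_cbox.
by move=> x abx; apply: box_bump_out => /obox_sub_cbox.
Qed.

End box_bump.

Section measurable_boxes.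
Context (R : realType) (n : nat).

Definition oboxes : set (set 'rV[R]_n) := [set A | exists a b, A = obox a b].

(** The inclusion of closed boxes keeps the intersection admissible for [box_integral0] when the
    first box is. *)
Lemma obox_setI (a b c d : 'rV[R]_n) :
  let e := \row_i Num.max (a ord0 i) (c ord0 i) in
  let h := \row_i Num.min (b ord0 i) (d ord0 i) in
  obox a b `&` obox c d = obox e h /\ cbox e h `<=` cbox a b.
Proof.
split; last first.
  move=> x abcdx i; have := abcdx i; rewrite !mxE ge_max le_min =>
    /andP[/andP[? ?] /andP[? ?]]; exact/andP.
apply/seteqP; split => [x [abx cdx] i|x abcdx].
  rewrite !mxE gt_max lt_min.
  by have /andP[-> ->] := abx i; have /andP[-> ->] := cdx i.
by split=> i; have := abcdx i; rewrite !mxE gt_max lt_min =>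
  /andP[/andP[? ?] /andP[? ?]]; apply/andP.
Qed.

Lemma setI_closed_oboxes : setI_closed oboxes.
Proof.
move=> _ _ [a [b ->]] [c [d ->]]; have [-> _] := obox_setI a b c d.
by do 2 eexists.
Qed.

(** Open boxes form a pi-system; this presentation of the sigma-algebra allows Dynkin induction.
    Coordinates are measurable for it because every open set is a countable union of boxes. *)
Lemma measurable_g_oboxes : @measurable _ 'rV[R]_n = <<s oboxes >>.
Proof.
apply/seteqP; split; last first.
  apply: smallest_sub; first by split=> [|A mA|F mF]; [exact: measurable0|
    rewrite setTD; exact: measurableC|exact: bigcupT_measurable].
  by move=> _ [a [b ->]]; exact: measurable_obox.
have oU (U : set 'rV[R]_n) : open U ->
    @measurable _ (g_sigma_algebraType oboxes) U.
  move=> oU; rewrite (open_cover_obox oU) bigcup_mkcond.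
  apply: countable_bigcupT_measurable => [|q]; first exact: countableP.
  case: ifP => _; last exact: measurable0.
  by apply: sub_sigma_algebra; do 2 eexists.
apply: smallest_sub; first exact: smallest_sigma_algebra.
rewrite -bigcup_seq => A [i _ [Y mY <-]].
suff mc : measurable_fun setT
    ((fun x => x ord0 i) : g_sigma_algebraType oboxes -> measurableTypeR R).
  exact: mc.
apply: (measurability _ (RGenOpens.measurableE R)).
move=> _ [_ [c [d ->]] <-]; rewrite setTI; apply: oU.
apply: open_comp; last exact: interval_open.
by move=> x _; exact: coord_continuous.
Qed.

End measurable_boxes.

(** * The fundamental lemma of the calculus of variations *)

Section fundamental_lemma.
Context (R : realType) (n : nat) (Omega : set 'rV[R]_n).
Hypotheses (oO : open Omega) (bO : bounded_set Omega).
Local Notation mu := (lebesgue_rV R n).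

Lemma domain_measurable : measurable Omega.
Proof. exact: open_measurable_rV. Qed.

Lemma domain_lty : (mu Omega < +oo)%E.
Proof.
have [M _ OM] := bounded_set_cbox bO.
apply: le_lt_trans (lebesgue_rV_cbox_lty (const_mx (- M)) (const_mx M)).
apply: le_measure => //; rewrite inE; first exact: domain_measurable.
exact: measurable_cbox.
Qed.

Lemma L2_bounded (v : 'rV[R]_n -> R) (M : R) : measurable_fun Omega v ->
  (forall x, Omega x -> `|v x| <= M) -> L2 Omega v.
Proof.
have mO := domain_measurable.
move=> mv vM; apply: (@L2_bounded_by _ _ _ mO (cst M) v) => //; last first.
  by move=> x Ox; apply: le_trans (vM x Ox) (ler_norm _).
split; first exact: measurable_cst.
rewrite (eq_integral (cst (M ^+ 2)%:E))// integral_cst//; apply: lte_mul_pinfty => //.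
  by rewrite lee_fin sqr_ge0.
exact: domain_lty.
Qed.

Lemma L2_cst (c : R) : L2 Omega (cst c).
Proof. by apply: (@L2_bounded _ `|c|) => [|x _]; [exact: measurable_cst|exact: lexx]. Qed.

Lemma L2_integrable (v : 'rV[R]_n -> R) : L2 Omega v ->
  mu.-integrable Omega (EFin \o v).
Proof.
move=> Lv; have := L2_integrableM domain_measurable (L2_cst 1) Lv.
by apply: eq_integrable; [exact: domain_measurable|move=> x _ /=; rewrite mul1r].
Qed.

(** Dominated convergence along [box_bump], with dominating function |g|, which is integrable
    because [Omega] has finite measure. *)
Lemma box_integral0 (g : 'rV[R]_n -> R) a b : L2 Omega g ->
  (forall phi, test_function Omega phi -> l2dot Omega g phi = 0) ->
  cbox a b `<=` Omega -> (\int[mu]_(x in obox a b) (g x)%:E = 0)%E.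
Proof.
move=> Lg g0 abO; have mO := domain_measurable; have [mg _] := Lg.
have ig := L2_integrable Lg.
have oabO : obox a b `<=` Omega by move=> x /obox_sub_cbox; exact: abO.
have mb := measurable_obox a b.
have mbump k : measurable_fun Omega (box_bump a b k).
  apply: measurable_funS (continuous_measurable_rV _) => //.
  exact/smooth_continuous/smooth_box_bump.
have [] := @dominated_convergence _ _ _ mu Omega mO
  (fun k x => (g x * box_bump a b k x)%:E) (fun x => (g x * \1_(obox a b) x)%:E)
  (fun x => `|g x|%:E).
- by move=> k; apply/measurable_EFinP; exact: measurable_funM.
- by apply/measurable_EFinP; apply: measurable_funM => //; exact: measurable_indic.
- apply: aeW => x _; apply: cvg_EFin; first exact: nearW.
  by apply: cvgM; [exact: cvg_cst|exact: box_bump_cvg].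
- by move/integrable_abse : ig.
- apply: aeW => x k _ /=; rewrite lee_fin normrM ler_piMr//.
  by rewrite ger0_norm ?box_bump_ge0 ?box_bump_le1.
move=> _ _ /cvg_lim lim0.
have E k : (\int[mu]_(x in Omega) (g x * box_bump a b k x)%:E = 0)%E.
  have tk := test_box_bump k abO.
  rewrite -l2dotE//; first by rewrite g0.
  apply: (@L2_bounded _ 1) => // x _.
  by rewrite ger0_norm ?box_bump_ge0 ?box_bump_le1.
have <- : (\int[mu]_(x in Omega) (g x * \1_(obox a b) x)%:E =
    \int[mu]_(x in obox a b) (g x)%:E)%E.
  rewrite -[in RHS](setIidr oabO) integral_mkcondr; apply: eq_integral => x _.
  by rewrite patchE indicE; case: ifP; rewrite ?mulr1 ?mulr0.
rewrite -lim0//; under eq_fun do rewrite E.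
exact: lim_cst.
Qed.

(** Inside one box the integrals of [g] over subboxes vanish, hence by Dynkin induction those over
    all measurable subsets, hence [g] vanishes almost everywhere there. Countably many boxes exhaust
    [Omega]. *)
Lemma fundamental_lemma (g : 'rV[R]_n -> R) : L2 Omega g ->
  (forall phi, test_function Omega phi -> l2dot Omega g phi = 0) ->
  ae_eq mu Omega g (cst 0).
Proof.
move=> Lg g0; have mO := domain_measurable; have [mg _] := Lg.
have ig := L2_integrable Lg.
have main a b : cbox a b `<=` Omega -> ae_eq mu (obox a b) g (cst 0).
  move=> abO; have oabO : obox a b `<=` Omega by move=> x /obox_sub_cbox; exact: abO.
  have mab := measurable_obox a b.
  have P A : measurable A -> (\int[mu]_(x in obox a b `&` A) (g x)%:E = 0)%E.
    rewrite measurable_g_oboxes => GA; pattern A.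
    apply: (dynkin_induction (measurable_g_oboxes R n)) GA => //=.
    - exact: setI_closed_oboxes.
    - by rewrite setIT box_integral0.
    - move=> _ [c [d ->]]; have [-> cab] := obox_setI a b c d.
      by apply: box_integral0 => //; exact: subset_trans abO.
    - move=> S mS S0.
      have := box_integral0 Lg g0 abO.
      rewrite -{1}(setIT (obox a b)) -(setvU S) setIUr integral_setU.
      + by rewrite S0 adde0.
      + by apply: measurableI => //; exact: measurableC.
      + exact: measurableI.
      + apply/measurable_EFinP; apply: (measurable_funS mO _ mg).
        by move=> x [|] [/oabO].
      + by apply/disj_setPS => x [[_ ?] [_ ?]].
    - move=> F mF tF F0; rewrite setI_bigcupr integral_bigcup.
      + by rewrite eseries0.
      + exact: trivIset_setIl.
      + by move=> k; exact: measurableI.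
      + rewrite -setI_bigcupr; apply: (integrableS mO) ig => //.
          by apply: measurableI => //; exact: bigcupT_measurable.
        by move=> x [/oabO].
  have : ae_eq mu (obox a b) (EFin \o g) (cst 0%E).
    apply: integral_ae_eq => //; last first.
      by move=> E Eab mE; rewrite -[in LHS](setIidr Eab) P// integral0.
    exact: (integrableS mO mab oabO ig).
  by apply: filterS => x /[apply] -[].
(* The rational boxes are numbered by [unpickle], so that their null sets can be merged by a
   countable union. *)
have H k : {ae mu, forall x, forall q, unpickle k = Some q ->
    cbox (map_mx ratr q.1) (map_mx ratr q.2) `<=` Omega ->
    obox (map_mx ratr q.1) (map_mx ratr q.2) x -> g x = 0}.
  case: (@unpickle ('rV[rat]_n * 'rV[rat]_n)%type k) => [q|]; last by apply: aeW.
  have [qO|nqO] := pselect (cbox (map_mx ratr q.1) (map_mx ratr q.2) `<=` Omega); last first.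
    by apply: aeW => x q' [<-].
  by apply: filterS (main _ _ qO) => x gx q' [<-] _ /gx.
have := ae_foralln H; apply: filterS => x gx.
rewrite {1}(open_cover_obox oO) => -[q /= qO qx].
exact: (gx (pickle q) q (pickleK _) qO qx).
Qed.

End fundamental_lemma.

(** * Fubini's theorem and integration by parts *)

Section fubini_rV.
Context (R : realType) (n : nat).
Local Notation mu1 := (@lebesgue_measure R).
Local Notation mu := (lebesgue_rV R n).
Local Notation muS := (lebesgue_rV R n.+1).
Local Notation cons := (@cons_rV R n).
Implicit Types g : 'rV[R]_n.+1 -> R.

Let integrable_cons g : muS.-integrable setT (EFin \o g) ->
  (mu1 \x mu)%E.-integrable setT (EFin \o (g \o cons)).
Proof.
move=> /integrableP[mg goo]; apply/integrableP; split.
  exact: (measurableT_comp mg (@measurable_cons_rV R n)).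
move: goo; rewrite /= /lebesgue_rV_step ge0_integral_pushforward//=.
exact: (measurableT_comp (@abse_measurable R setT) mg).
Qed.

Let integral_cons g : muS.-integrable setT (EFin \o g) ->
  (\int[muS]_x (g x)%:E = \int[mu1 \x mu]_z (g (cons z))%:E)%E.
Proof.
move=> ig; have [mg _] := integrableP _ _ _ ig.
rewrite /= /lebesgue_rV_step integral_pushforward//.
exact: integrable_cons.
Qed.

Lemma fubini_rV g : muS.-integrable setT (EFin \o g) ->
  (\int[muS]_x (g x)%:E = \int[mu1]_a \int[mu]_y (g (cons (a, y)))%:E)%E.
Proof.
move=> ig; rewrite integral_cons//.
by rewrite -(integral12_prod_meas1 (integrable_cons ig)).
Qed.

Lemma fubini_rV_swap g : muS.-integrable setT (EFin \o g) ->
  (\int[muS]_x (g x)%:E = \int[mu]_y \int[mu1]_a (g (cons (a, y)))%:E)%E.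
Proof.
move=> ig; rewrite integral_cons//.
by rewrite -(integral21_prod_meas1 (integrable_cons ig)).
Qed.

End fubini_rV.

Section cube.
Context (R : realType).

Definition cube n (L : R) : set 'rV[R]_n := cbox (const_mx (- L)) (const_mx L).

Lemma cubeP n L (x : 'rV[R]_n) : cube L x <-> forall i, `|x ord0 i| <= L.
Proof.
by split=> xL i; have := xL i; rewrite !mxE ler_norml.
Qed.

Lemma bounded_integrable n (g : 'rV[R]_n -> R) (M L : R) :
  measurable_fun setT g -> (forall x, `|g x| <= M) ->
  (forall x, ~ cube L x -> g x = 0) ->
  (lebesgue_rV R n).-integrable setT (EFin \o g).
Proof.
move=> mg gM gL.
have mC : measurable (cube L : set 'rV[R]_n) by exact: measurable_cbox.
apply: (@le_integrable _ _ _ _ _ _ _ (fun x => (M * \1_(cube L) x)%:E)) => //.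
- exact/measurable_EFinP.
- move=> x _ /=; rewrite lee_fin indicE.
  have [|] := boolP (x \in cube L); first by rewrite mulr1 => _; apply: le_trans (gM x) (ler_norm _).
  by rewrite notin_setE => /gL ->; rewrite normr0.
- apply: (@integrableZl _ _ _ _ _ _ M (fun x => (\1_(cube L) x)%:E)) => //.
  apply/integrableP; split; first exact/measurable_EFinP/measurable_indic.
  rewrite (eq_integral (fun x => (\1_(cube L) x)%:E)).
    by rewrite integral_indic// setIT; exact: lebesgue_rV_cbox_lty.
  by move=> x _; rewrite gee0_abs// lee_fin.
Qed.

Lemma cube_cons n L (a : R) (y : 'rV[R]_n) :
  cube L (cons_rV (a : measurableTypeR R, y)) <-> `|a| <= L /\ cube L y.
Proof.
rewrite !cubeP; split=> [H|[aL yL] i].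
  split; first by have := H ord0; rewrite mxE unlift_none.
  by move=> i; have := H (lift ord0 i); rewrite mxE liftK.
by rewrite mxE; case: unliftP => [j _|_] //=.
Qed.

(** If [i] is the first coordinate, integrate it first. Otherwise slice off the first coordinate and
    use induction on the slices, whose lines are lines of the whole space by [setc_consS]. *)
Lemma integral0_lines n (i : 'I_n) (g : 'rV[R]_n -> R) (M L : R) :
  measurable_fun setT g -> (forall x, `|g x| <= M) ->
  (forall x, ~ cube L x -> g x = 0) ->
  (forall x, \int[lebesgue_measure]_t (g (setc i t x))%:E = 0)%E ->
  (\int[lebesgue_rV R n]_x (g x)%:E = 0)%E.
Proof.
elim: n i g => [[]//|n IH] i g mg gM gL g0.
have ig := bounded_integrable mg gM gL.
have [j ij|i0] := unliftP ord0 i; last first.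
  rewrite fubini_rV_swap//; apply: integral0_eq => y _.
  rewrite -(g0 (cons_rV (0 : measurableTypeR R, y))); apply: eq_integral => a _.
  by rewrite i0 setc_cons0.
rewrite fubini_rV//; apply: integral0_eq => a _.
apply: (IH j) => [|y|y yL|y].
- exact: measurable_slice.
- exact: gM.
- by apply: gL => /cube_cons[_].
- rewrite -(g0 (cons_rV (a, y))); apply: eq_integral => t _.
  by rewrite ij setc_consS.
Qed.

End cube.

Section one_dimensional.
Context (R : realType).
Local Notation mu1 := (@lebesgue_measure R).

Lemma FTC_segment (H h : R -> R) (a b : R) : a <= b ->
  (forall t : R, is_derive t 1 H (h t)) -> continuous h ->
  (\int[mu1]_(t in `[a, b]) (h t)%:E = (H b - H a)%:E)%E.
Proof.
rewrite le_eqVlt => /orP[/eqP <- _ _|ab dH ch].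
  by rewrite set_itv1 integral_set1 subrr.
rewrite EFinB; apply: continuous_FTC2 => //.
- exact: continuous_subspaceT.
- have cH x : {for x, continuous H}.
    by apply/differentiable_continuous/derivable1_diffP; have [] := dH x.
  split.
  + by move=> x _; have [] := dH x.
  + exact/cvg_at_right_filter/cH.
  + exact/cvg_at_left_filter/cH.
- by move=> x _; rewrite derive1E; have [_] := dH x.
Qed.

Lemma integral_derivative0 (H h : R -> R) (L : R) : 0 < L ->
  (forall t : R, is_derive t 1 H (h t)) -> continuous h ->
  (forall t, L < `|t| -> H t = 0) -> (forall t, L < `|t| -> h t = 0) ->
  (\int[mu1]_t (h t)%:E = 0)%E.
Proof.
move=> L0 dH ch H0 h0.
(* Vanishing is assumed only strictly beyond L, so the segment ends at L + 1. *)
have L1 : L < `|L + 1| by rewrite ger0_norm; lra.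
have NL1 : L < `|- (L + 1)| by rewrite normrN.
have E : (\int[mu1]_(t in `[(- (L + 1))%R, (L + 1)%R]) (h t)%:E = 0)%E.
  by rewrite (FTC_segment _ dH ch) ?H0 ?subr0//; lra.
rewrite -[RHS]E [RHS]integral_mkcond; apply: eq_integral => t _.
rewrite patchE; case: ifPn => // /negP tL; rewrite h0//.
rewrite inE/= in_itv/= -ler_norml in tL; move/negP : tL; rewrite -ltNge; lra.
Qed.

End one_dimensional.

Section test_functions.
Context (R : realType) (n : nat) (Omega : set 'rV[R]_n).
Hypotheses (oO : open Omega) (bO : bounded_set Omega).
Local Notation mu := (lebesgue_rV R n).
Local Notation test := (test_function Omega).
Implicit Types (phi psi : 'rV[R]_n -> R).

Lemma domain_cube : exists2 L : R, 0 < L & Omega `<=` cube L.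
Proof. exact: bounded_set_cbox. Qed.

Lemma test_out phi x : test phi -> ~ Omega x -> phi x = 0.
Proof. by move=> [_ [K [_ KO phi0]]] Ox; apply: phi0 => /KO. Qed.

Lemma test_smooth phi : test phi -> smooth phi.
Proof. by case. Qed.

Lemma test_continuous phi : test phi -> continuous phi.
Proof. by move=> /test_smooth/smooth_continuous. Qed.

Lemma test_bounded phi : test phi -> exists2 M, 0 <= M & forall x, `|phi x| <= M.
Proof.
move=> [sphi [K [cK KO phi0]]].
have cp : {within K, continuous (fun x => `|phi x|)}.
  apply: continuous_subspaceT => x; apply: continuous_comp; last exact: norm_continuous.
  exact: smooth_continuous.
have [K0|/set0P K0] := eqVneq K set0.
  by exists 0 => // x; rewrite phi0 ?normr0// K0.
have [c Kc Hc] := compact_EVT_max K0 cK cp.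
exists `|phi c| => // x; have [Kx|nKx] := pselect (K x); first by apply: Hc; rewrite inE.
by rewrite phi0// normr0.
Qed.

Lemma test_measurable phi : test phi -> measurable_fun setT phi.
Proof. by move=> tp; apply: continuous_measurable_rV; exact: test_continuous. Qed.

Lemma test_L2 phi : test phi -> L2 Omega phi.
Proof.
move=> tp; have [M _ pM] := test_bounded tp.
apply: (@L2_bounded _ _ _ oO bO _ M) => //.
by apply: measurable_funS (test_measurable tp).
Qed.

Lemma test_partial phi i : test phi -> test (partial i phi).
Proof.
move=> [sphi [K [cK KO phi0]]]; split; first exact: smooth_partial.
exists K; split=> // x nKx.
have nK : \near x, cst 0 x = phi x.
  have : open (~` K).
    by apply: closed_openC; apply: compact_closed => //; exact: norm_hausdorff.
  move=> oK; have : nbhs x (~` K) by exact: open_nbhs_nbhs.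
  by apply: filterS => y nKy; rewrite phi0.
rewrite /partial -(near_eq_derive _ nK).
exact: derive_cst.
Qed.

Lemma test_mul phi psi : test phi -> test psi -> test (fun x => phi x * psi x).
Proof.
move=> [sphi [K [cK KO phi0]]] [spsi _]; split; first exact: smooth_mul.
by exists K; split=> // x /phi0 ->; rewrite mul0r.
Qed.

Lemma test0 : test 0.
Proof.
split; first by move=> k; exact: Ck_cst.
by exists set0; split => //; exact: compact0.
Qed.

Lemma test_lin a phi psi : test phi -> test psi -> test (a *: phi + psi).
Proof.
move=> [sphi [K [cK KO phi0]]] [spsi [K' [cK' K'O psi0]]]; split.
  move=> k; apply: (@CkD _ _ _ (fun x => a * phi x)) => //.
  by apply: CkM => //; exact: Ck_cst.
exists (K `|` K'); split => [||x /not_orP[nK nK']].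
- by apply: compactU.
- by rewrite subUset.
- by rewrite fct_linE phi0// psi0// mulr0 addr0.
Qed.

Lemma integral_test phi : test phi ->
  (\int[mu]_(x in Omega) (phi x)%:E = \int[mu]_x (phi x)%:E)%E.
Proof.
move=> tp; rewrite integral_mkcond; apply: eq_integral => x _.
rewrite patchE; case: ifPn => //; rewrite notin_setE => Ox.
by rewrite (test_out tp).
Qed.

(** On each line parallel to axis [i] the integrand is the derivative of a function that vanishes
    far away. *)
Lemma integral_partial phi i : test phi ->
  (\int[mu]_(x in Omega) (partial i phi x)%:E = 0)%E.
Proof.
move=> tp; have tip := test_partial i tp; rewrite integral_test//.
have [M _ pM] := test_bounded tip; have [L L0 OL] := domain_cube.
apply: (@integral0_lines _ _ i _ M L) => //.
- exact: test_measurable.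
- by move=> x nx; apply: (test_out tip) => /OL.
move=> x.
pose H t := phi (t *: delta_mx ord0 i + setc i 0 x).
pose h t := partial i phi (t *: delta_mx ord0 i + setc i 0 x).
have out psi (t : R) : test psi -> L < `|t| -> psi (t *: delta_mx ord0 i + setc i 0 x) = 0.
  move=> tpsi Lt; apply: (test_out tpsi) => /OL /cubeP /(_ i).
  by rewrite -setcE setc_eq leNgt Lt.
have -> : (fun t : R => (partial i phi (setc i t x))%:E) = (fun t => (h t)%:E).
  by apply/funext => t; rewrite /h -setcE.
apply: (@integral_derivative0 _ H h L) => //.
- move=> t; apply: is_derive_line; apply: smooth_is_derive; exact: test_smooth.
- move=> t; apply: continuous_comp; last exact: test_continuous.
  apply: cvgD; last exact: cvg_cst.
  by apply: cvgZl; exact: cvg_id.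
- by move=> t; exact: out.
- by move=> t; exact: out.
Qed.

Lemma test_by_parts phi psi i : test phi -> test psi ->
  l2dot Omega phi (partial i psi) = - l2dot Omega (partial i phi) psi.
Proof.
move=> tp ts; have mO := domain_measurable oO.
have tip := test_partial i tp; have tis := test_partial i ts.
have Lp := test_L2 tp; have Ls := test_L2 ts.
have Lip := test_L2 tip; have Lis := test_L2 tis.
have := integral_partial i (test_mul tp ts).
rewrite (_ : partial i (fun x => phi x * psi x) =
  (fun x => phi x * partial i psi x + psi x * partial i phi x)); last first.
  by apply: partialM => x; apply: smooth_derivable; exact: test_smooth.
move=> /(congr1 fine); rewrite -/(Rintegral _ _ _).
rewrite RintegralD//; [|exact: L2_integrableM..].
rewrite /l2dot => /eqP; rewrite addr_eq0 => /eqP ->; congr (- _).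
by apply: eq_Rintegral => x _; rewrite mulrC.
Qed.

Lemma test_weak_partial phi i : test phi -> is_weak_partial Omega i phi (partial i phi).
Proof.
move=> tp; split; first exact/test_L2/test_partial.
by move=> psi; exact: test_by_parts.
Qed.

End test_functions.

(** * Weak gradients and completeness of H01 *)

Section weak_partials.
Context (R : realType) (n : nat) (Omega : set 'rV[R]_n).
Hypotheses (oO : open Omega) (bO : bounded_set Omega).
Local Notation mu := (lebesgue_rV R n).
Local Notation test := (test_function Omega).
Implicit Types (u v g phi psi : 'rV[R]_n -> R).

Let mO : measurable Omega. Proof. exact: domain_measurable. Qed.
Let si2 := l2_semi_inner mO.

Lemma weak_partial_unique i v g h : is_weak_partial Omega i v g ->
  is_weak_partial Omega i v h -> ae_eq mu Omega g h.
Proof.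
move=> [Lg vg] [Lh vh].
have : ae_eq mu Omega (g - h) (cst 0).
  apply: fundamental_lemma => //; first exact: (siB_ si2).
  move=> phi tp; have Lp := test_L2 oO bO tp.
  by rewrite (siBl si2)// -[l2dot _ g _]opprK -vg// vh// opprK subrr.
by apply: filterS => x /[apply] /eqP; rewrite fct_subE subr_eq0 => /eqP.
Qed.

Lemma weak_partial_lin i a u v g h : L2 Omega u -> L2 Omega v ->
  is_weak_partial Omega i u g -> is_weak_partial Omega i v h ->
  is_weak_partial Omega i (a *: u + v) (a *: g + h).
Proof.
move=> Lu Lv [Lg ug] [Lh vh]; split; first exact: (siP si2).
move=> phi tp; have Lp := test_L2 oO bO tp.
have Lip := test_L2 oO bO (test_partial i tp).
by rewrite !(siPl si2)// ug// vh//; ring.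
Qed.

Lemma wpartialP i v : H1 Omega v -> is_weak_partial Omega i v (wpartial Omega i v).
Proof. by move=> [_ /(_ i)[g vg]]; apply: (@xgetPex _ (fun=> 0) [set g | is_weak_partial Omega i v g]); exists g. Qed.

Lemma wpartial_L2 i v : H1 Omega v -> L2 Omega (wpartial Omega i v).
Proof. by move=> /(wpartialP i)[]. Qed.

Lemma wpartial_ae i v g : H1 Omega v -> is_weak_partial Omega i v g ->
  ae_eq mu Omega (wpartial Omega i v) g.
Proof. by move=> /(wpartialP i) /weak_partial_unique; exact. Qed.

Lemma H1_lin a u v : H1 Omega u -> H1 Omega v -> H1 Omega (a *: u + v).
Proof.
move=> Hu Hv; have [Lu _] := Hu; have [Lv _] := Hv; split; first exact: (siP si2).
move=> i; exists (a *: wpartial Omega i u + wpartial Omega i v).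
by apply: weak_partial_lin => //; exact: wpartialP.
Qed.

Lemma wpartial_lin i a u v : H1 Omega u -> H1 Omega v ->
  ae_eq mu Omega (wpartial Omega i (a *: u + v))
    (a *: wpartial Omega i u + wpartial Omega i v).
Proof.
move=> Hu Hv; apply: wpartial_ae; first exact: H1_lin.
have [Lu _] := Hu; have [Lv _] := Hv.
by apply: weak_partial_lin => //; exact: wpartialP.
Qed.

Lemma test_H1 phi : test phi -> H1 Omega phi.
Proof.
move=> tp; split; first exact: test_L2.
by move=> i; exists (partial i phi); exact: test_weak_partial.
Qed.

Lemma wpartial_test i phi : test phi -> ae_eq mu Omega (wpartial Omega i phi) (partial i phi).
Proof. by move=> tp; apply: wpartial_ae; [exact: test_H1|exact: test_weak_partial]. Qed.

Lemma H1_0 : H1 Omega 0.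
Proof. exact/test_H1/test0. Qed.

Lemma graddotE u v : H1 Omega u -> H1 Omega v ->
  graddot Omega u v = \sum_(i < n) l2dot Omega (wpartial Omega i u) (wpartial Omega i v).
Proof.
move=> Hu Hv; rewrite /graddot /Rintegral.
have E : ((\int[mu]_(x in Omega) (\sum_(i < n) wpartial Omega i u x * wpartial Omega i v x)%:E)
  = \sum_(i < n) \int[mu]_(x in Omega) (wpartial Omega i u x * wpartial Omega i v x)%:E)%E.
  under eq_integral do rewrite -sumEFin.
  apply: integral_sum => //= i.
  by apply: (L2_integrableM mO); exact: wpartial_L2.
rewrite E (eq_bigr (fun i => (l2dot Omega (wpartial Omega i u) (wpartial Omega i v))%:E)).
  by rewrite sumEFin.
by move=> i _; rewrite l2dotE//; exact: wpartial_L2.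
Qed.

Lemma l2norm_ge0 v : 0 <= l2norm Omega v. Proof. exact: sqrtr_ge0. Qed.

Lemma sqr_l2norm v : L2 Omega v -> l2norm Omega v ^+ 2 = l2dot Omega v v.
Proof. by move=> Lv; exact: (sqr_nB si2 Lv). Qed.

Lemma l2norm_ae_eq u v : L2 Omega u -> L2 Omega v -> ae_eq mu Omega u v ->
  l2norm Omega u = l2norm Omega v.
Proof.
move=> Lu Lv uv.
have E : l2dot Omega u u = l2dot Omega v v.
  rewrite (l2dot_ae_eq mO Lu Lv Lu uv) (si_sym si2 Lv Lu).
  exact: (l2dot_ae_eq mO Lu Lv Lv uv).
by rewrite /l2norm E.
Qed.

(** The equality is exact, not almost everywhere: both sides choose from the same set of weak
    partial derivatives. *)
Lemma wpartial_ae_eq i u v : L2 Omega u -> L2 Omega v -> ae_eq mu Omega u v ->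
  wpartial Omega i u = wpartial Omega i v.
Proof.
move=> Lu Lv uv; rewrite /wpartial; congr xget.
apply/seteqP; split => g [Lg gP]; split=> // phi tp; rewrite -gP//.
- apply: l2dot_ae_eq => //; first exact/test_L2/test_partial.
  exact: ae_eq_sym.
- by apply: l2dot_ae_eq => //; exact/test_L2/test_partial.
Qed.

Lemma graddot_ae_eq u v : L2 Omega u -> L2 Omega v -> ae_eq mu Omega u v ->
  graddot Omega u = graddot Omega v.
Proof.
move=> Lu Lv uv; apply/funext => w; rewrite /graddot; apply: eq_Rintegral => x _.
by apply: eq_bigr => i _; rewrite (wpartial_ae_eq i Lu Lv uv).
Qed.

Local Opaque Rintegral l2dot l2norm graddot.

Lemma grad_semi_inner : semi_inner (H1 Omega) (graddot Omega).
Proof.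
split.
- exact: H1_0.
- exact: H1_lin.
- move=> u v Hu Hv; rewrite (graddotE Hu Hv) (graddotE Hv Hu); apply: eq_bigr => i _.
  by apply: (si_sym si2); exact: wpartial_L2.
- move=> a u v w Hu Hv Hw.
  rewrite (graddotE (H1_lin a Hu Hv) Hw) (graddotE Hu Hw) (graddotE Hv Hw).
  rewrite mulr_sumr -big_split/=; apply: eq_bigr => i _.
  have Lu := wpartial_L2 i Hu; have Lv := wpartial_L2 i Hv; have Lw := wpartial_L2 i Hw.
  rewrite -(siPl si2 a Lu Lv Lw).
  apply: (l2dot_ae_eq mO _ _ Lw).
  + exact/wpartial_L2/H1_lin.
  + exact: (siP si2).
  + exact: wpartial_lin.
- move=> u Hu; rewrite (graddotE Hu Hu); apply: sumr_ge0 => i _.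
  by apply: (si_ge0 si2); exact: wpartial_L2.
Qed.

Definition h1dot u v := l2dot Omega u v + graddot Omega u v.

Lemma h1_semi_inner_H1 : semi_inner (H1 Omega) h1dot.
Proof.
apply: semi_innerD grad_semi_inner.
by apply: semi_inner_sub si2; [move=> v []|exact: H1_0|exact: H1_lin].
Qed.

Lemma h1normE v : H1 Omega v -> h1norm Omega v = seminorm_of h1dot v.
Proof. by move=> [Lv _]; rewrite /h1norm /seminorm_of /h1dot (sqr_l2norm Lv). Qed.

Lemma h1norm_ge0 v : 0 <= h1norm Omega v. Proof. exact: sqrtr_ge0. Qed.

Lemma sqr_h1norm v : H1 Omega v ->
  h1norm Omega v ^+ 2 = l2norm Omega v ^+ 2 + graddot Omega v v.
Proof.
move=> Hv; rewrite sqr_sqrtr// addr_ge0 ?sqr_ge0//.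
exact: (si_ge0 grad_semi_inner).
Qed.

Lemma H01_H1 v : H01 Omega v -> H1 Omega v. Proof. by case. Qed.

Lemma H01_L2 v : H01 Omega v -> L2 Omega v. Proof. by move=> [[]]. Qed.

Lemma test_H01 phi : test phi -> H01 Omega phi.
Proof.
move=> tp; split; first exact: test_H1.
exists (fun=> phi); split=> // .
rewrite subrr h1normE; last exact: H1_0.
by rewrite (nB0 h1_semi_inner_H1); exact: cvg_cst.
Qed.

(** The closure in epsilon form, with no sequence to carry along; conversely, choice with e = 1/(k +
    1) gives back a sequence. *)
Lemma H01P v : H01 Omega v <-> H1 Omega v /\
  forall e : R, 0 < e -> exists2 phi, test phi & h1norm Omega (phi - v) < e.
Proof.
split=> [[Hv [phi [tphi cphi]]]|[Hv H]]; split=> //.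
  move=> e e0; move/cvgrPdist_lt : cphi => /(_ e e0) [k _ /(_ k (leqnn k))].
  rewrite sub0r normrN ger0_norm ?h1norm_ge0// => phik.
  by exists (phi k).
have /choice[phi Pphi] : forall k : nat, exists phi,
    test phi /\ h1norm Omega (phi - v) < k.+1%:R^-1.
  by move=> k; have [|phi tp pv] := H k.+1%:R^-1; [rewrite invr_gt0|exists phi].
exists phi; split=> [k|]; first by have [] := Pphi k.
apply: (@squeeze_cvgr _ _ _ _ (cst 0) (fun k => k.+1%:R^-1)).
- by apply: nearW => k; rewrite h1norm_ge0/= ltW//; have [] := Pphi k.
- exact: cvg_cst.
- exact: cvg_harmonic.
Qed.

Lemma H01_lin a u v : H01 Omega u -> H01 Omega v -> H01 Omega (a *: u + v).
Proof.
move=> /H01P[Hu uP] /H01P[Hv vP]; apply/H01P; split; first exact: H1_lin.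
move=> e e0.
have [|phi tp pu] := uP (e / 2 / (`|a| + 1)).
  by rewrite !divr_gt0// ltr_wpDl.
have [|psi ts pv] := vP (e / 2); first by rewrite divr_gt0.
exists (a *: phi + psi); first exact: test_lin.
have Hp := test_H1 tp; have Hs := test_H1 ts.
have si1 := h1_semi_inner_H1.
have Hpu : H1 Omega (phi - u) by exact: (siB_ si1).
have Hpv : H1 Omega (psi - v) by exact: (siB_ si1).
have -> : a *: phi + psi - (a *: u + v) = a *: (phi - u) + (psi - v).
  by rewrite scalerBr opprD addrACA.
rewrite h1normE; last exact: (siP si1).
apply: le_lt_trans (nB_triangle si1 (siZ si1 a Hpu) Hpv) _.
rewrite (nBZ si1)// -!h1normE//.
move: pu; rewrite ltr_pdivlMr; last by rewrite ltr_wpDl.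
move: pv (h1norm_ge0 (phi - u)); move: (h1norm _ _) (h1norm _ _) `|a| => x y b; lra.
Qed.

Lemma h1_semi_inner : semi_inner (H01 Omega) h1dot.
Proof.
apply: semi_inner_sub h1_semi_inner_H1; first by move=> v [].
  exact/test_H01/test0.
exact: H01_lin.
Qed.

Lemma H01_closed v : H1 Omega v ->
  (forall e : R, 0 < e -> exists2 w, H01 Omega w & h1norm Omega (w - v) < e) ->
  H01 Omega v.
Proof.
move=> Hv H; apply/H01P; split=> // e e0.
have [|w Hw wv] := H (e / 2); first by rewrite divr_gt0.
have [_ /(_ (e / 2))[|phi tp pw]] := (H01P w).1 Hw; first by rewrite divr_gt0.
exists phi => //.
have Hp := test_H1 tp; have Hw1 := H01_H1 Hw.
have := nB_dist h1_semi_inner_H1 Hp Hw1 Hv.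
rewrite -(h1normE (siB_ h1_semi_inner_H1 Hp Hv)) -(h1normE (siB_ h1_semi_inner_H1 Hp Hw1)).
rewrite -(h1normE (siB_ h1_semi_inner_H1 Hw1 Hv)).
by move: pw wv; move: (h1norm _ _) (h1norm _ _) (h1norm _ _) => x y z; lra.
Qed.

Lemma l2norm_le_h1norm v : H1 Omega v -> l2norm Omega v <= h1norm Omega v.
Proof.
move=> Hv; rewrite -(@ler_pXn2r _ 2)// ?nnegrE ?l2norm_ge0 ?h1norm_ge0 ?nB_ge0//.
by rewrite sqr_h1norm// lerDl; exact: (si_ge0 grad_semi_inner).
Qed.

Lemma gradnorm_le_h1norm v : H1 Omega v ->
  seminorm_of (graddot Omega) v <= h1norm Omega v.
Proof.
move=> Hv; rewrite -(@ler_pXn2r _ 2)// ?nnegrE ?l2norm_ge0 ?h1norm_ge0 ?nB_ge0//.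
by rewrite sqr_h1norm// (sqr_nB grad_semi_inner Hv) lerDr sqr_ge0.
Qed.

Lemma wpartial_norm_le i v : H1 Omega v ->
  l2norm Omega (wpartial Omega i v) <= h1norm Omega v.
Proof.
move=> Hv; apply: le_trans (gradnorm_le_h1norm Hv).
rewrite -(@ler_pXn2r _ 2)// ?nnegrE ?l2norm_ge0 ?h1norm_ge0 ?nB_ge0//.
rewrite (sqr_nB grad_semi_inner Hv) (sqr_l2norm (wpartial_L2 i Hv)).
rewrite (graddotE Hv Hv) (bigD1 i)//= lerDl; apply: sumr_ge0 => j _.
by apply: (si_ge0 si2); exact: wpartial_L2.
Qed.

Lemma H1_ae_eq u v : H1 Omega u -> L2 Omega v -> ae_eq mu Omega u v -> H1 Omega v.
Proof.
move=> [Lu Hu] Lv uv; split=> // i; have [g [Lg gP]] := Hu i; exists g; split=> // phi tp.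
rewrite -gP//; apply: l2dot_ae_eq => //; first exact/test_L2/test_partial.
exact: ae_eq_sym.
Qed.

Lemma h1norm_ae_eq u v : H1 Omega u -> H1 Omega v -> ae_eq mu Omega u v ->
  h1norm Omega u = h1norm Omega v.
Proof.
move=> Hu Hv uv; have [Lu _] := Hu; have [Lv _] := Hv.
have E : graddot Omega u u = graddot Omega v v.
  rewrite (graddot_ae_eq Lu Lv uv) (si_sym grad_semi_inner Hv Hu).
  by rewrite (graddot_ae_eq Lu Lv uv).
by rewrite /h1norm E (l2norm_ae_eq Lu Lv uv).
Qed.

Local Opaque h1norm.

Lemma H01_ae_eq u v : H01 Omega u -> L2 Omega v -> ae_eq mu Omega u v -> H01 Omega v.
Proof.
move=> /H01P[Hu uP] Lv uv; apply/H01P; split; first exact: H1_ae_eq uv.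
move=> e e0; have [phi tp pu] := uP e e0; exists phi; first exact: tp.
have Hp := test_H1 tp; have Hv : H1 Omega v by exact: H1_ae_eq uv.
rewrite -(@h1norm_ae_eq (phi - u)); [exact: pu| | |].
- exact: (siB_ h1_semi_inner_H1).
- exact: (siB_ h1_semi_inner_H1).
- by apply: filterS uv => x /[apply]; rewrite !fct_subE => ->.
Qed.

(* If the L2 limits of a sequence and of its weak gradients exist then the
   latter form the weak gradient of the former. *)
Lemma H01_complete (v : nat -> 'rV[R]_n -> R) :
  (forall k, H01 Omega (v k)) ->
  (forall k, h1norm Omega (v k.+1 - v k) <= 2^-1 ^+ k) ->
  exists w, [/\ H01 Omega w, h1norm Omega (v k - w) @[k --> \oo] --> 0 &
    {ae mu, forall x, Omega x -> v k x @[k --> \oo] --> w x}].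
Proof.
move=> Hv dv.
have Hv1 k : H1 Omega (v k) by exact: H01_H1.
have Lv k : L2 Omega (v k) by exact: H01_L2.
have Hd k : H1 Omega (v k.+1 - v k) by exact: (siB_ h1_semi_inner_H1).
have fO := domain_lty oO bO.
have [||w [Lw vw aw]] := L2_complete mO (v := v) fO; first by [].
  by move=> k; apply: le_trans (dv k); exact: l2norm_le_h1norm.
have wB i u1 u2 : H1 Omega u1 -> H1 Omega u2 ->
    ae_eq mu Omega (wpartial Omega i (u1 - u2)) (wpartial Omega i u1 - wpartial Omega i u2).
  move=> H1u H2u.
  have := wpartial_lin i (-1) H2u H1u.
  by rewrite !scaleN1r addrC [X in ae_eq _ _ _ X]addrC.
have cg i : exists g, [/\ L2 Omega g, forall k, l2norm Omega (wpartial Omega i (v k) - g) <= 2 * 2^-1 ^+ k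
   & True].
  have [||g [Lg vg _]] := L2_complete mO (v := fun k => wpartial Omega i (v k)) fO.
  - by move=> k; exact: wpartial_L2.
  - move=> k; apply: le_trans (dv k); apply: le_trans (wpartial_norm_le i (Hd k)).
    rewrite le_eqVlt; apply/orP; left; apply/eqP.
    have La : L2 Omega (wpartial Omega i (v k.+1 - v k)) by exact: wpartial_L2.
    have Lb : L2 Omega (wpartial Omega i (v k.+1) - wpartial Omega i (v k)).
      by apply: (siB_ si2); exact: wpartial_L2.
    have ab := wB i _ _ (Hv1 k.+1) (Hv1 k).
    by rewrite (l2norm_ae_eq La Lb ab).
  by exists g; split.
have half0 : (2 * 2^-1 ^+ k : R) @[k --> \oo] --> 0.
  rewrite -(mulr0 2); apply: cvgMr; apply: cvg_expr.
  by rewrite ger0_norm; lra.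
have wg i g : L2 Omega g ->
   (forall k, l2norm Omega (wpartial Omega i (v k) - g) <= 2 * 2^-1 ^+ k) ->
   is_weak_partial Omega i w g.
  move=> Lg vg; split=> // phi tp.
  have Lp := test_L2 oO bO tp; have Lip := test_L2 oO bO (test_partial i tp).
  (* Norm convergence implies weak convergence by Cauchy-Schwarz. It is used on both sides of the
     identity that defines weak partial derivatives. *)
  have lim1 (z : nat -> 'rV[R]_n -> R) (y : 'rV[R]_n -> R) (psi : 'rV[R]_n -> R) :
     (forall k, L2 Omega (z k)) -> L2 Omega y -> L2 Omega psi ->
     (forall k, l2norm Omega (z k - y) <= 2 * 2^-1 ^+ k) ->
     l2dot Omega (z k) psi @[k --> \oo] --> l2dot Omega y psi.
    move=> Lz Ly Lpsi zy; apply/cvgrPdist_le => e e0.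
    have c0 : 0 < l2norm Omega psi + 1 by rewrite ltr_wpDl// l2norm_ge0.
    have := half0 => /cvgrPdist_le /(_ (e / (l2norm Omega psi + 1))).
    rewrite divr_gt0// => /(_ isT); apply: filterS => k.
    rewrite sub0r normrN ger0_norm ?mulr_ge0 ?exprn_ge0// ler_pdivlMr// => He.
    rewrite distrC -(siBl si2)//; apply: le_trans (si_CS si2 _ _) _ => //.
      exact: (siB_ si2).
    apply: le_trans He; apply: ler_pM => //; rewrite ?l2norm_ge0 ?h1norm_ge0 ?nB_ge0 ?zy//.
    by rewrite -[leLHS]addr0 lerD.
  have l1 := lim1 v w _ Lv Lw Lip vw.
  have l2 := lim1 (fun k => wpartial Omega i (v k)) g phi (fun k => wpartial_L2 i (Hv1 k)) Lg Lp vg.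
  have l3 : l2dot Omega (v k) (partial i phi) @[k --> \oo] --> - l2dot Omega g phi.
    under eq_fun do rewrite (wpartialP i (Hv1 _)).2//.
    exact: cvgN.
  exact: (cvg_unique (@Rhausdorff R) l1 l3).
have Hw : H1 Omega w.
  by split=> // i; have [g [Lg vg _]] := cg i; exists g; exact: wg.
(* The function and its n partial derivatives are each within 2 * 2^-k of their limits. *)
have dw k : h1norm Omega (v k - w) ^+ 2 <= (2 * 2^-1 ^+ k) ^+ 2 * (n%:R + 1).
  have Hvw : H1 Omega (v k - w) by exact: (siB_ h1_semi_inner_H1).
  rewrite sqr_h1norm// addrC mulrDr mulr1; apply: lerD; last first.
    by rewrite ler_pXn2r// ?nnegrE ?l2norm_ge0 ?h1norm_ge0 ?nB_ge0 ?mulr_ge0 ?exprn_ge0// vw.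
  rewrite (graddotE Hvw Hvw) mulr_natr -[in leRHS](card_ord n) -sumr_const.
  apply: ler_sum => i _; rewrite -(sqr_l2norm (wpartial_L2 i Hvw)).
  rewrite ler_pXn2r// ?nnegrE ?l2norm_ge0 ?h1norm_ge0 ?nB_ge0 ?mulr_ge0 ?exprn_ge0//.
  have [g [Lg vg _]] := cg i; apply: le_trans (vg k).
  rewrite le_eqVlt; apply/orP; left; apply/eqP.
  have La : L2 Omega (wpartial Omega i (v k - w)) by exact: wpartial_L2.
  have Lb : L2 Omega (wpartial Omega i (v k) - g).
    exact: (siB_ si2 (wpartial_L2 i (Hv1 k)) Lg).
  have ab : ae_eq mu Omega (wpartial Omega i (v k - w)) (wpartial Omega i (v k) - g).
    apply: ae_eq_trans (wB i _ _ (Hv1 k) Hw) _.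
    have := wpartial_ae Hw (wg i g Lg vg).
    by apply: filterS => x /[apply]; rewrite !fct_subE => ->.
  by rewrite (l2norm_ae_eq La Lb ab).
have cvw : h1norm Omega (v k - w) @[k --> \oo] --> 0.
  have dw' k : h1norm Omega (v k - w) <= (2 * 2^-1 ^+ k) * (n%:R + 1).
    rewrite -(@ler_pXn2r _ 2)// ?nnegrE ?h1norm_ge0 ?mulr_ge0 ?exprn_ge0//.
    apply: le_trans (dw k) _; rewrite [leRHS]exprMn ler_wpM2l ?sqr_ge0//.
    by rewrite expr2 ler_peMr// lerDr.
  apply: (@squeeze_cvgr _ _ _ _ (cst 0) (fun k => (2 * 2^-1 ^+ k) * (n%:R + 1))).
  - by apply: nearW => k; rewrite h1norm_ge0/= dw'.
  - exact: cvg_cst.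
  - by rewrite -(mul0r (n%:R + 1)); apply: cvgMl.
exists w; split=> //; apply: H01_closed => // e e0.
move/cvgrPdist_lt : cvw => /(_ e e0) [k _ /(_ k (leqnn k))].
rewrite sub0r normrN ger0_norm ?h1norm_ge0// => vk.
by exists (v k).
Qed.

End weak_partials.

(** * The Sobolev inequality *)

(** The bounds are extended-real integrals of nonnegative functions, so finiteness of the integral
    of [F] is a conclusion. Most integral estimates below are pointwise Young inequalities fed into
    this lemma. *)
Lemma integral_lincomb_le d (T : measurableType d) (R : realType)
    (mu : {measure set T -> \bar R}) (D : set T) (P Q F : T -> R) (p q M N : R) :
  measurable D -> measurable_fun D P -> measurable_fun D Q -> measurable_fun D F ->
  (forall x, D x -> 0 <= P x) -> (forall x, D x -> 0 <= Q x) ->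
  (forall x, D x -> 0 <= F x <= p * P x + q * Q x) ->
  0 <= p -> 0 <= q ->
  (\int[mu]_(x in D) (P x)%:E <= M%:E)%E -> (\int[mu]_(x in D) (Q x)%:E <= N%:E)%E ->
  (\int[mu]_(x in D) (F x)%:E <= (p * M + q * N)%:E)%E.
Proof.
move=> mD mP mQ mF P0 Q0 FPQ p0 q0 PM QN.
have mP' : measurable_fun D (EFin \o P) by exact/measurable_EFinP.
have mQ' : measurable_fun D (EFin \o Q) by exact/measurable_EFinP.
have P0' x : D x -> (0 <= (P x)%:E)%E by move=> Dx; rewrite lee_fin P0.
have Q0' x : D x -> (0 <= (Q x)%:E)%E by move=> Dx; rewrite lee_fin Q0.
have pE : (0 <= p%:E)%E by rewrite lee_fin.
have qE : (0 <= q%:E)%E by rewrite lee_fin.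
apply: (@le_trans _ _ (\int[mu]_(x in D) (p%:E * (P x)%:E + q%:E * (Q x)%:E))%E).
  apply: ge0_le_integral => //.
  - by move=> x Dx; rewrite lee_fin; have /andP[] := FPQ x Dx.
  - exact/measurable_EFinP.
  - by apply: emeasurable_funD; apply: measurable_funeM.
  - by move=> x Dx; rewrite -!EFinM -EFinD lee_fin; have /andP[] := FPQ x Dx.
rewrite ge0_integralD//.
- rewrite (ge0_integralZl mu mD mP' P0' pE) (ge0_integralZl mu mD mQ' Q0' qE).
  by rewrite EFinD !EFinM leeD// lee_wpmul2l.
- by move=> x Dx; rewrite mule_ge0// P0'.
- exact: measurable_funeM.
- by move=> x Dx; rewrite mule_ge0// Q0'.
- exact: measurable_funeM.
Qed.

(** * Gagliardo's inequality by slicing *)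

Section gagliardo.
Context (R : realType).
Local Notation mu1 := (@lebesgue_measure R).

(** Models the bound of a compactly supported function by the integral of its gradient along any
    axis-parallel line. One [d] serves all directions, so the property passes to slices. *)
Definition line_dominated n (g d : 'rV[R]_n -> R) : Prop :=
  forall i x, ((g x)%:E <= \int[mu1]_t (d (setc i t x))%:E)%E.

Lemma line_dominated_slice n (g d : 'rV[R]_n.+1 -> R) (a : measurableTypeR R) :
  line_dominated g d ->
  line_dominated (fun y => g (cons_rV (a, y))) (fun y => d (cons_rV (a, y))).
Proof.
move=> gd i y; apply: le_trans (gd (lift ord0 i) (cons_rV (a, y))) _.
rewrite le_eqVlt; apply/orP; left; apply/eqP; apply: eq_integral => t _.
by rewrite setc_consS.
Qed.

Lemma integral_rV1 (d : 'rV[R]_1 -> R) (y : 'rV[R]_1) :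
  measurable_fun setT d -> (forall x, 0 <= d x) ->
  (\int[lebesgue_rV R 1]_x (d x)%:E = \int[mu1]_t (d (setc ord0 t y))%:E)%E.
Proof.
move=> md d0; rewrite tonelli_rV; last 2 first.
- exact/measurable_EFinP.
- by move=> x; rewrite lee_fin.
apply: eq_integral => a _.
rewrite [LHS](@integral_dirac _ _ _ _ setT)//; last first.
  by apply/measurable_EFinP; exact: measurable_slice.
rewrite diracT mul1e; congr (EFin (d _)).
apply/rowP => j; rewrite mxE mxE; case: unliftP => [[[]//]|->].
by rewrite eqxx.
Qed.

Lemma powRVl (A t : R) : 0 <= A -> A^-1 `^ t = (A `^ t)^-1.
Proof. by move=> A0; rewrite -[A^-1]powR_inv1// powRAC powR_inv1// powR_ge0. Qed.

(** Young's inequality for (g/A)^t and g/b with exponents 1/t and 1/(1 - t). The weights are chosen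
    so that, when the integral of g is at most A and that of g^(1/(1-t)) at most b^(1/(1-t)), the
    bracket integrates to at most t + (1 - t) = 1; this gives the constant of Hoelder's
    inequality. *)
Lemma weighted_young (g A b t : R) : 0 <= g -> 0 < A -> 0 < b -> 0 < t < 1 ->
  g `^ (1 + t) <= A `^ t * b * (t * (g / A) + (1 - t) * (g / b) `^ (1 - t)^-1).
Proof.
move=> g0 A0 b0 /andP[t0 t1].
have At : 0 < A `^ t by exact: powR_gt0.
have -> : g `^ (1 + t) = A `^ t * b * ((g / A) `^ t * (g / b)).
  rewrite powRM ?invr_ge0 ?(ltW A0)// powRVl ?(ltW A0)//.
  rewrite -(mulr_powRB1 g0) ?addr_gt0// addrAC subrr add0r; field.
  by rewrite !gt_eqF.
rewrite ler_wpM2l ?mulr_ge0 ?powR_ge0 ?(ltW b0)//.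
have gA0 : 0 <= g / A by rewrite divr_ge0// ltW.
have t1' : 0 < 1 - t by lra.
have := @conjugate_powR R ((g / A) `^ t) (g / b) t^-1 (1 - t)^-1.
rewrite !invrK -powRrM mulfV ?gt_eqF// powRr1// => H.
apply: le_trans (H _ _ _ _ _) _; rewrite ?powR_ge0 ?divr_ge0 ?(ltW b0) ?invr_gt0//.
  by rewrite addrC subrK.
by rewrite [g / A * t]mulrC [_ * (1 - t)]mulrC.
Qed.

Section slices.
Context (n : nat) (g d : 'rV[R]_n.+1 -> R) (A : R).
Hypotheses (mg : measurable_fun setT g) (md : measurable_fun setT d).
Hypotheses (g0 : forall x, 0 <= g x) (d0 : forall x, 0 <= d x).
Hypotheses (gd : line_dominated g d).
Hypothesis dA : (\int[lebesgue_rV R n.+1]_x (d x)%:E <= A%:E)%E.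

Let g0' x : (0 <= (g x)%:E)%E. Proof. by rewrite lee_fin. Qed.
Let d0' x : (0 <= (d x)%:E)%E. Proof. by rewrite lee_fin. Qed.
Let mg' : measurable_fun setT (EFin \o g). Proof. exact/measurable_EFinP. Qed.
Let md' : measurable_fun setT (EFin \o d). Proof. exact/measurable_EFinP. Qed.

(** Domination along the first axis gives a bound that does not depend on [a]; integrating it over y
    yields the full integral of [d]. *)
Lemma slice_le (a : measurableTypeR R) :
  (\int[lebesgue_rV R n]_y (g (cons_rV (a, y)))%:E <= A%:E)%E.
Proof.
apply: le_trans dA; rewrite (tonelli_rV_swap md')//.
apply: ge0_le_integral => //.
- exact: (measurable_slice a mg').
- exact: (measurable_line_rV md').
- move=> y _; apply: le_trans (gd ord0 (cons_rV (a, y))) _.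
  rewrite le_eqVlt; apply/orP; left; apply/eqP; apply: eq_integral => t _.
  by rewrite setc_cons0.
Qed.

Lemma slice_measurable : measurable_fun setT
  (fun a => \int[lebesgue_rV R n]_y (d (cons_rV (a, y)))%:E)%E.
Proof. exact: (measurable_tonelli_rV md'). Qed.

Lemma integral_slices_le (F : R -> R) (c : R) :
  measurable_fun setT F -> (forall s, 0 <= F s) -> 0 <= c ->
  (forall a, \int[lebesgue_rV R n]_y (F (g (cons_rV (a, y))))%:E <=
     c%:E * \int[lebesgue_rV R n]_y (d (cons_rV (a, y)))%:E)%E ->
  (\int[lebesgue_rV R n.+1]_x (F (g x))%:E <= (c * A)%:E)%E.
Proof.
move=> mF F0 c0 H.
have mFg : measurable_fun setT (EFin \o (F \o g)).
  by apply/measurable_EFinP; exact: measurableT_comp.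
rewrite (tonelli_rV mFg); last by move=> x; rewrite lee_fin F0.
apply: (@le_trans _ _ (\int[mu1]_a (c%:E * \int[lebesgue_rV R n]_y (d (cons_rV (a, y)))%:E))%E).
  apply: ge0_le_integral => //.
  - by move=> a _; apply: integral_ge0 => y _; rewrite lee_fin F0.
  - by apply: (measurable_tonelli_rV mFg) => x; rewrite lee_fin F0.
  - by apply: measurable_funeM; exact: slice_measurable.
  - by move=> a _; exact: H.
rewrite (@ge0_integralZl _ _ _ mu1 setT measurableT _ slice_measurable)//.
  by rewrite EFinM lee_wpmul2l ?lee_fin// -(tonelli_rV md').
by move=> a _; exact: integral_ge0.
Qed.

End slices.

(** In dimension N = m + 2 the exponent is N/(N - 1). On a slice, [g] has integral at most A by
    [slice_le], and the induction hypothesis bounds a higher power by the slice integral b of [d].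
    Interpolation gives A^t b, and integrating b over the slices gives one more factor A. *)
Lemma gagliardo m (g d : 'rV[R]_m.+2 -> R) (A : R) :
  measurable_fun setT g -> measurable_fun setT d ->
  (forall x, 0 <= g x) -> (forall x, 0 <= d x) -> line_dominated g d -> 0 < A ->
  (\int[lebesgue_rV R m.+2]_x (d x)%:E <= A%:E)%E ->
  (\int[lebesgue_rV R m.+2]_x (g x `^ (1 + m.+1%:R^-1))%:E <= (A `^ (1 + m.+1%:R^-1))%:E)%E.
Proof.
elim: m g d A => [|m IH] g d A mg md g0 d0 gd A0 dA.
  have pow2 (s : R) : 0 <= s -> s `^ (1 + 1%:R^-1) = s * s.
    by move=> s0; rewrite invr1 -[1 + 1]/(2%:R) powR_mulrn.
  rewrite (pow2 A (ltW A0)).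
  apply: (@integral_slices_le 1 g d A mg md d0 dA (fun s => s `^ (1 + 1%:R^-1)) A).
  - exact: measurable_powR.
  - by move=> s; exact: powR_ge0.
  - exact: ltW.
  move=> a; set b := (\int[_]_y (d _)%:E)%E.
  (* In dimension two a slice is a single line, so its integral of [d] bounds [g] pointwise. *)
  have gb y : ((g (cons_rV (a, y)))%:E <= b)%E.
    rewrite /b (integral_rV1 y (measurable_slice a md))//.
    exact: (line_dominated_slice a gd ord0 y).
  apply: (@le_trans _ _ (\int[lebesgue_rV R 1]_y (b * (g (cons_rV (a, y)))%:E))%E).
    apply: ge0_le_integral => //.
    - by move=> y _; rewrite lee_fin powR_ge0.
    - apply/measurable_EFinP; apply: (measurableT_comp (measurable_powR _)).
      exact: measurable_slice.
    - by apply: measurable_funeM; apply/measurable_EFinP; exact: measurable_slice.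
    - move=> y _; rewrite pow2// EFinM.
      by rewrite lee_wpmul2r ?lee_fin.
  have b0 : (0 <= b)%E by apply: integral_ge0 => z _; rewrite lee_fin.
  have mgs : measurable_fun setT (fun y => (g (cons_rV (a, y)))%:E).
    by apply/measurable_EFinP; exact: measurable_slice.
  rewrite (@ge0_integralZl _ _ _ (lebesgue_rV R 1) setT measurableT _ mgs)//.
    by rewrite muleC lee_wpmul2r// (slice_le mg md g0 d0 gd dA).
  by move=> y _; rewrite lee_fin.
pose k : R := m.+2%:R; pose t := k^-1.
have k1 : 1 < k by rewrite /k ltr1n.
have t01 : 0 < t < 1 by rewrite /t invr_gt0 invf_lt1; lra.
have -> : A `^ (1 + t) = A `^ t * A.
  by rewrite -(mulr_powRB1 (ltW A0)) ?addr_gt0//; [rewrite addrAC subrr add0r mulrC|case/andP: t01].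
apply: (@integral_slices_le _ g d A mg md d0 dA (fun s => s `^ (1 + t)) (A `^ t)).
- exact: measurable_powR.
- by move=> s; exact: powR_ge0.
- exact: powR_ge0.
move=> a; set b := (\int[_]_y (d _)%:E)%E.
have b0 : (0 <= b)%E by apply: integral_ge0 => z _; rewrite lee_fin.
have At : 0 < A `^ t by exact: powR_gt0.
(* The slice integral may be infinite; the bound is then trivial because A^t > 0. *)
have [boo|] := ltP b +oo%E; last first.
  by rewrite leye_eq => /eqP ->; rewrite gt0_muley ?leey// lte_fin.
have [b' b'E] : exists b', b = b'%:E.
  by exists (fine b); rewrite fineK// ge0_fin_numE.
(* The slice integral may also be 0, where the weights of [weighted_young] degenerate. It is
   enlarged to a positive [c], at the cost of exactly e in the conclusion. *)
rewrite b'E -EFinM; apply/lee_addgt0Pr => e e0.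
pose c := b' + e / A `^ t.
have b'0 : 0 <= b' by rewrite -lee_fin -b'E.
have c0 : 0 < c by rewrite ltr_wpDl// divr_gt0.
have bc : (b <= c%:E)%E by rewrite b'E lee_fin lerDl divr_ge0// ltW.
have -> : ((A `^ t * b')%:E + e%:E = (A `^ t * c)%:E)%E.
  by rewrite -EFinD /c; congr EFin; field; rewrite gt_eqF.
have IHc := IH _ _ c (measurable_slice a mg) (measurable_slice a md)
  (fun y => g0 _) (fun y => d0 _) (line_dominated_slice a gd) c0 bc.
(* With t = 1/(m + 2), Young's second exponent is the exponent of the induction hypothesis. *)
have tE : (1 - t)^-1 = 1 + m.+1%:R^-1.
  have j0 : 0 < m.+1%:R :> R by rewrite ltr0n.
  rewrite /t /k -[m.+2]addn1 natrD; move: (m.+1%:R : R) j0 => j j0.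
  by field; rewrite !gt_eqF//; lra.
have [t0 t1] := andP t01.
have mgs : measurable_fun setT (fun y => g (cons_rV (a, y))) by exact: measurable_slice.
have -> : A `^ t * c = A `^ t * c * (t / A) * A +
    A `^ t * c * ((1 - t) / c `^ (1 - t)^-1) * c `^ (1 - t)^-1.
  by field; rewrite !gt_eqF// powR_gt0.
apply: (@integral_lincomb_le _ _ _ _ _ (fun y => g (cons_rV (a, y)))
  (fun y => g (cons_rV (a, y)) `^ (1 - t)^-1)) => //.
- exact: (measurableT_comp (measurable_powR _)).
- exact: (measurableT_comp (measurable_powR _)).
- by move=> y _; exact: powR_ge0.
- move=> y _; rewrite powR_ge0/=.
  apply: le_trans (weighted_young (g0 _) A0 c0 t01) _.
  rewrite le_eqVlt; apply/orP; left; apply/eqP.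
  rewrite powRM ?invr_ge0 ?(ltW c0)// powRVl ?(ltW c0)//.
  by field; rewrite !gt_eqF// powR_gt0.
- by rewrite mulr_ge0 ?mulr_ge0 ?invr_ge0 ?ltW.
- by rewrite mulr_ge0 ?mulr_ge0 ?invr_ge0 ?powR_ge0 ?ltW// subr_gt0.
- exact: (slice_le mg md g0 d0 gd dA).
- by rewrite tE.
Qed.

End gagliardo.

(** * Powers of the absolute value *)

Section abs_power.
Context (R : realType).
Implicit Types (s t : R).

Lemma powR_norm_cvg0 (t : R) : 0 < t -> `|s| `^ t @[s --> (0 : R)] --> (0 : R).
Proof.
move=> t0; apply/cvgrPdist_le => e e0.
have e'0 : 0 < e `^ t^-1 by exact: powR_gt0.
have : \forall s \near (0 : R), `|s| <= e `^ t^-1 by exact: nbhs0_le.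
apply: filterS => s se; rewrite sub0r normrN ger0_norm ?powR_ge0//.
have := @ge0_ler_powR R t (ltW t0) `|s| (e `^ t^-1).
rewrite -powRrM mulVf ?gt_eqF// powRr1 ?(ltW e0)//; apply => //.
by rewrite nnegrE powR_ge0.
Qed.

Lemma continuous_powR_norm (t : R) : 0 < t -> continuous (fun s : R => `|s| `^ t).
Proof.
move=> t0 s; have [->|s0] := eqVneq s 0.
  rewrite /continuous_at normr0 powR0 ?gt_eqF//; exact: powR_norm_cvg0.
apply: (@continuous_comp _ _ _ (fun s : R => `|s|) (fun a => a `^ t)).
  exact: norm_continuous.
apply/differentiable_continuous/derivable1_diffP/derivable_powR.
by rewrite in_itv/= andbT normr_gt0.
Qed.

(** Up to the factor t + 1, the derivative of |s|^(t+1). *)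
Definition signed_pow (t s : R) : R := Num.sg s * `|s| `^ t.

(** Splitting into positive and negative parts removes the sign function, so that continuity at 0
    follows by composition. *)
Lemma signed_powE t s : 0 < t ->
  signed_pow t s = `|Num.max s 0| `^ t - `|Num.max (- s) 0| `^ t.
Proof.
move=> t0; rewrite /signed_pow; have [s0|s0|->] := ltgtP s 0.
- rewrite max_l ?oppr_ge0 ?ltW// normr0 powR0 ?gt_eqF//.
  by rewrite ltr0_sg// normrN mulN1r sub0r.
- rewrite max_r ?oppr_le0 ?ltW// normr0 powR0 ?gt_eqF//.
  by rewrite gtr0_sg// mul1r subr0.
- by rewrite sgr0 mul0r oppr0 maxxx normr0 subrr.
Qed.

Lemma continuous_signed_pow t : 0 < t -> continuous (signed_pow t).
Proof.
move=> t0; rewrite (_ : signed_pow t =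
    fun s => `|Num.max s 0| `^ t - `|Num.max (- s) 0| `^ t); last first.
  by apply/funext => s; exact: signed_powE.
have c (f : R -> R) : continuous f -> continuous (fun s => `|Num.max (f s) 0| `^ t).
  move=> cf s; apply: (@continuous_comp _ _ _ (fun s => Num.max (f s) 0) (fun s => `|s| `^ t)).
    by apply: continuous_max; [exact: cf|exact: cst_continuous].
  exact: continuous_powR_norm.
move=> s; apply: cvgB; first by apply: (c id) => x; exact: cvg_id.
by apply: (c -%R) => x; exact: opp_continuous.
Qed.

Lemma is_derive_powR_norm (t s : R) : 1 < t ->
  is_derive s 1 (fun s : R => `|s| `^ t) (t * signed_pow (t - 1) s).
Proof.
move=> t1.
have pos (x : R) : 0 < x -> is_derive x 1 (fun s : R => `|s| `^ t) (t * x `^ (t - 1)).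
  move=> x0; apply: (@near_eq_is_derive _ _ _ (fun s => s `^ t)).
    near=> y; rewrite ger0_norm//; apply: ltW; near: y; exact: lt_nbhsr.
  have xi : x \in `]0, +oo[ by rewrite in_itv/= x0.
  apply: DeriveDef; first exact: derivable_powR.
  by rewrite -derive1E powR_derive1.
have [s0|s0|->] := ltgtP s 0.
- have := @is_derive1_comp _ (fun s : R => `|s| `^ t) (-%R) s _ _
    (pos (- s) _) (is_deriveN (is_derive_id s (1 : R))).
  rewrite oppr_gt0 s0 => /(_ isT) H.
  rewrite (_ : (fun s : R => `|s| `^ t) = (fun s : R => `|s| `^ t) \o -%R); last first.
    by apply/funext => x /=; rewrite normrN.
  apply: (is_derive_eq H); rewrite /signed_pow ltr0_sg// ltr0_norm//; ring.
- have := pos s s0; rewrite /signed_pow gtr0_sg// gtr0_norm// mul1r; exact.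
- rewrite /signed_pow sgr0 mul0r mulr0.
  have t10 : 0 < t - 1 by rewrite subr_gt0.
  suff H : (fun h : R => h^-1 *: (((fun s : R => `|s| `^ t) \o shift 0) (h *: 1) - `|0 : R| `^ t))
      @ 0^' --> (0 : R).
    by split; [apply: cvgP; exact: H|exact: cvg_lim H].
  (* At 0 the difference quotient of |s|^t is [signed_pow (t - 1)], which tends to 0 because t >
     1. *)
  have E : (fun h : R => h^-1 *: (((fun s : R => `|s| `^ t) \o shift 0) (h *: 1) - `|0 : R| `^ t)) =
      signed_pow (t - 1).
    apply/funext => h; rewrite /= addr0 /GRing.scale/= mulr1 normr0 powR0 ?gt_eqF ?subr0 ?(lt_trans ltr01)//.
    rewrite /signed_pow; have [->|h0] := eqVneq h 0; first by rewrite invr0 sgr0 !mul0r.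
    rewrite -(@mulr_powRB1 _ `|h|)// ?(lt_trans ltr01)// mulrA; congr (_ * _).
    by rewrite normrEsg mulrCA mulVf// mulr1.
  rewrite E; have := continuous_signed_pow t10 (x := 0).
  rewrite /continuous_at {2}/signed_pow sgr0 mul0r; exact: cvg_within_filter.
Unshelve. all: by end_near. Qed.

End abs_power.

Section subcritical.
Context (R : realType).
Local Notation mu1 := (@lebesgue_measure R).

(** On each line in the first direction [g] is at most the line integral of [d] and vanishes outside
    a segment of length 2L. *)
Lemma poincare_L1 n (g d : 'rV[R]_n.+1 -> R) (A L : R) :
  measurable_fun setT g -> measurable_fun setT d ->
  (forall x, 0 <= g x) -> (forall x, 0 <= d x) -> line_dominated g d -> 0 <= L ->
  (forall x, ~ cube L x -> g x = 0) ->
  (\int[lebesgue_rV R n.+1]_x (d x)%:E <= A%:E)%E ->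
  (\int[lebesgue_rV R n.+1]_x (g x)%:E <= (2 * L * A)%:E)%E.
Proof.
move=> mg md g0 d0 gd L0 gL dA.
have mg' : measurable_fun setT (EFin \o g) by exact/measurable_EFinP.
have md' : measurable_fun setT (EFin \o d) by exact/measurable_EFinP.
have g0' x : (0 <= (g x)%:E)%E by rewrite lee_fin.
have d0' x : (0 <= (d x)%:E)%E by rewrite lee_fin.
have L20 : (0 <= (2 * L)%:E)%E by rewrite lee_fin mulr_ge0.
rewrite (tonelli_rV_swap mg')// EFinM.
apply: (@le_trans _ _ (\int[lebesgue_rV R n]_y
   ((2 * L)%:E * \int[mu1]_t (d (cons_rV (t : measurableTypeR R, y)))%:E))%E); last first.
  have mdl := measurable_line_rV md' d0'.
  rewrite (ge0_integralZl (lebesgue_rV R n) measurableT mdl)//.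
    by rewrite lee_wpmul2l// -(tonelli_rV_swap md').
  by move=> y _; apply: integral_ge0 => a _; exact: d0'.
apply: ge0_le_integral => //.
- by move=> y _; apply: integral_ge0 => a _; exact: g0'.
- exact: (measurable_line_rV mg').
- by apply: measurable_funeM; exact: (measurable_line_rV md').
move=> y _; set D := (\int[mu1]_t (d _)%:E)%E.
have D0 : (0 <= D)%E by exact: integral_ge0.
have mgy : measurable_fun [set: measurableTypeR R] (fun a : measurableTypeR R => (g (cons_rV (a, y)))%:E).
  apply: (measurableT_comp mg'); apply: (measurableT_comp (@measurable_cons_rV R n)).
  exact: measurable_pair2.
apply: (@le_trans _ _ (\int[mu1]_(a in `[(- L)%R, L]) D)%E); last first.
  have mE : mu1 `[(- L)%R, L]%classic = (2 * L)%:E.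
    rewrite lebesgue_measure_itv/= lte_fin; case: ifPn => [_|].
      by rewrite -EFinB opprK -mulr2n mulr_natl.
    by rewrite -leNgt => LL; rewrite (_ : 2 * L = 0)//; lra.
  by rewrite muleC -mE -(integral_cst mu1 (measurable_itv _) D).
rewrite [leRHS]integral_mkcond; apply: ge0_le_integral => //.
- by move=> a _; exact: g0'.
- by apply/(measurable_restrictT _ _).1.
- move=> a _; rewrite patchE; case: ifPn => [_|aL].
    apply: le_trans (gd ord0 (cons_rV (a, y))) _; rewrite le_eqVlt; apply/orP; left; apply/eqP.
    by apply: eq_integral => t _; rewrite setc_cons0.
  rewrite /= gL//.
  move=> /cube_cons[aL' _]; move: aL; rewrite notin_setE/= in_itv/=.
  by rewrite -ler_norml aL'.
Qed.

Lemma powR_le_sum (X t s : R) : 0 <= X -> 0 <= t -> t <= s ->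
  X `^ (1 + t) <= X + X `^ (1 + s).
Proof.
rewrite le_eqVlt => /predU1P[<- t0 ts|X0 t0 ts].
  by rewrite !powR0 ?addr0// gt_eqF//; lra.
have [X1|X1] := leP X 1.
  by rewrite (le_trans (@ge1r_powR _ _ _ _ _))// ?X0// ?lerDl ?powR_ge0//; lra.
by rewrite (le_trans (@ler_powR _ _ (ltW X1) (1 + t) (1 + s) _)) ?lerD2l// lerDr ltW.
Qed.

(** Interpolates between the L1 bound of [poincare_L1] and the endpoint exponent n/(n - 1) of
    [gagliardo]. Both are applied at the scale g/A, so that the result is homogeneous in A. *)
Lemma subcritical_gagliardo n (g d : 'rV[R]_n -> R) (A L t : R) : (0 < n)%N ->
  measurable_fun setT g -> measurable_fun setT d ->
  (forall x, 0 <= g x) -> (forall x, 0 <= d x) -> line_dominated g d -> 0 <= L ->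
  (forall x, ~ cube L x -> g x = 0) -> 0 < A -> 0 < t < 1 ->
  ((2 < n)%N -> t <= n.-1%:R^-1) ->
  (\int[lebesgue_rV R n]_x (d x)%:E <= A%:E)%E ->
  (\int[lebesgue_rV R n]_x (g x `^ (1 + t))%:E <= ((2 * L + 1) * A `^ (1 + t))%:E)%E.
Proof.
case: n g d => [//|n] g d _ mg md g0 d0 gd L0 gL A0 /andP[t0 t1] tn dA.
have Pg := poincare_L1 mg md g0 d0 gd L0 gL dA.
have mgt : measurable_fun setT (fun x => g x `^ (1 + t)).
  exact: (measurableT_comp (measurable_powR _)).
have powA s : 0 < s -> A `^ (1 + s) = A * A `^ s.
  by move=> s0; rewrite -(mulr_powRB1 (ltW A0)) ?addr_gt0// addrAC subrr add0r.
have Atpos := powR_gt0 t A0.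
case: n g d mg md g0 d0 gd gL dA mgt Pg tn => [|m] g d mg md g0 d0 gd gL dA mgt Pg tn.
  (* Dimension one: the whole space is one line, so g <= A everywhere and g^(1+t) <= A^t g. *)
  apply: (@le_trans _ _ (A `^ t * (2 * L * A) + 0 * 0)%:E).
    apply: (@integral_lincomb_le _ _ _ _ _ g (cst 0)) => //.
    - move=> x _; rewrite powR_ge0/= mul0r addr0.
      rewrite -(mulr_powRB1 (g0 x)) ?addr_gt0// addrAC subrr add0r mulrC ler_wpM2r//.
      apply: ge0_ler_powR; rewrite ?nnegrE ?(ltW t0) ?(ltW A0)//.
      rewrite -lee_fin; apply: le_trans dA; rewrite (integral_rV1 x md d0).
      exact: gd.
    - exact: ltW.
    - by rewrite integral0.
  rewrite lee_fin powA//.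
  by have := mulr_gt0 A0 Atpos; move: (A `^ t) => z; lra.
pose s : R := m.+1%:R^-1.
have s0 : 0 < s by rewrite invr_gt0.
have ts : t <= s.
  (* In dimension two the endpoint is s = 1, and t < 1 is enough. *)
  case: m @s s0 tn {g d mg md g0 d0 gd gL dA mgt Pg} => [|m] s s0 tn; last exact: tn.
  by rewrite /s invr1 ltW.
have Gg := gagliardo mg md g0 d0 gd A0 dA.
have Aspos := powR_gt0 s A0.
apply: (@le_trans _ _ (A `^ t * (2 * L * A) + A `^ t / A `^ s * A `^ (1 + s))%:E).
  apply: (@integral_lincomb_le _ _ _ _ _ g (fun x => g x `^ (1 + s))) => //.
  - exact: (measurableT_comp (measurable_powR _)).
  - by move=> x _; exact: powR_ge0.
  - move=> x _; rewrite powR_ge0/=.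
    (* The intermediate power is at most the sum of the two extreme ones. Dividing by A first gives
       both terms the weight A^(1+t) after integration. *)
    have := @powR_le_sum (g x / A) t s (divr_ge0 (g0 x) (ltW A0)) (ltW t0) ts.
    rewrite !powRM ?invr_ge0 ?(ltW A0)// !powRVl ?(ltW A0)// ler_pdivrMr ?powR_gt0//.
    move=> /le_trans; apply; rewrite le_eqVlt; apply/orP; left; apply/eqP.
    by rewrite !powA//; field; rewrite !gt_eqF.
  - exact: ltW.
  - by rewrite divr_ge0// ltW.
rewrite lee_fin !powA// le_eqVlt; apply/orP; left; apply/eqP.
by field; rewrite gt_eqF.
Qed.

End subcritical.

Lemma sqr_sum_norm_le (R : realType) n (a : 'I_n -> R) :
  (\sum_(i < n) `|a i|) ^+ 2 <= n%:R * \sum_(i < n) a i ^+ 2.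
Proof.
rewrite expr2 mulr_suml.
apply: (@le_trans _ _ (\sum_(i < n) \sum_(j < n) (a i ^+ 2 / 2 + a j ^+ 2 / 2))).
  apply: ler_sum => i _; rewrite mulr_sumr; apply: ler_sum => j _.
  rewrite -[a i ^+ 2]real_normK ?num_real// -[a j ^+ 2]real_normK ?num_real//.
  by have := sqr_ge0 (`|a i| - `|a j|); lra.
rewrite le_eqVlt; apply/orP; left; apply/eqP.
under eq_bigr do rewrite big_split/= sumr_const card_ord.
rewrite big_split/= sumr_const card_ord sumrMnl -mulr_suml.
rewrite -[X in X + _]mulr_natl -[X in _ + X]mulr_natl; by field.
Qed.

Lemma continuous_compose (R : realType) (g f : R -> R) :
  continuous g -> continuous f -> continuous (fun x => f (g x)).
Proof.
by move=> cg cf t; apply: (@continuous_comp _ _ _ g f); [exact: cg|exact: cf].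
Qed.

(** With c = 1 + r/2, raising to the power c gives x^(2 + r) <= C^c B^r x^r, and x^r cancels. Here
    x^2 stands for the integral of |phi|^r, which occurs on both sides of the estimate. *)
Lemma sobolev_bootstrap (R : realType) (r C B x : R) : 2 < r -> 0 < C -> 0 < B -> 0 < x ->
  x ^+ 2 <= C * (B * x) `^ (r / (1 + r / 2)) ->
  x ^+ 2 <= (C `^ ((1 + r / 2) / r) * B) `^ r.
Proof.
move=> r2 C0 B0 x0.
have g0 : 0 < 1 + r / 2 by lra.
have r0 : r != 0 by rewrite gt_eqF//; lra.
move=> /(ge0_ler_powR (ltW g0)) H; have {}H := H _ _.
have : (x ^+ 2) `^ (1 + r / 2) <= (C * (B * x) `^ (r / (1 + r / 2))) `^ (1 + r / 2).
  by apply: H; rewrite nnegrE ?sqr_ge0// mulr_ge0 ?powR_ge0// ltW.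
rewrite [leRHS]powRM ?powR_ge0 ?(ltW C0)// -[X in _ <= _ * X]powRrM divfK ?gt_eqF//.
rewrite powRM ?(ltW B0) ?(ltW x0)// -powR_mulrn ?(ltW x0)// -[leLHS]powRrM.
have -> : 2%:R * (1 + r / 2) = 2%:R + r by field.
rewrite powRD; last by apply/implyP => _; rewrite gt_eqF.
rewrite !mulrA ler_pM2r ?powR_gt0// => /le_trans; apply.
rewrite powRM ?powR_ge0 ?(ltW B0)// -[X in _ <= X * _]powRrM divfK//.
Qed.

(** * The Sobolev inequality for test functions *)

Section sobolev_test.
Context (R : realType) (n : nat) (Omega : set 'rV[R]_n).
Hypotheses (oO : open Omega) (bO : bounded_set Omega).
Local Notation mu := (lebesgue_rV R n).
Local Notation mu1 := (@lebesgue_measure R).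
Local Notation test := (test_function Omega).
Implicit Types (phi : 'rV[R]_n -> R).

Let mO : measurable Omega. Proof. exact: domain_measurable. Qed.
Let si2 := l2_semi_inner mO.

(** A sum of absolute values bounds each partial derivative at once; Cauchy-Schwarz compares it with
    the Euclidean norm at the cost of a factor n in the square. *)
Definition grad_norm1 phi x : R := \sum_(i < n) `|partial i phi x|.

Lemma measurable_grad_norm1 phi : test phi -> measurable_fun setT (grad_norm1 phi).
Proof.
move=> tp; apply: measurable_sum => i; apply: measurableT_comp => //.
exact: (test_measurable (test_partial i tp)).
Qed.

Lemma grad_norm1_ge0 phi x : 0 <= grad_norm1 phi x.
Proof. by apply: sumr_ge0. Qed.

Lemma grad_norm1_out phi x : test phi -> ~ Omega x -> grad_norm1 phi x = 0.
Proof.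
move=> tp Ox; rewrite /grad_norm1 big1// => i _.
by rewrite (test_out (test_partial i tp) Ox) normr0.
Qed.

Lemma graddot_test phi : test phi ->
  graddot Omega phi phi = \sum_(i < n) l2dot Omega (partial i phi) (partial i phi).
Proof.
move=> tp; rewrite (graddotE oO (test_H1 oO bO tp) (test_H1 oO bO tp)); apply: eq_bigr => i _.
have La : L2 Omega (partial i phi) by exact/test_L2/test_partial.
have Lb : L2 Omega (wpartial Omega i phi) by exact: (wpartial_L2 i (test_H1 oO bO tp)).
have ab := wpartial_test oO bO i tp.
rewrite (l2dot_ae_eq mO Lb La Lb ab) (si_sym si2 La Lb).
exact: (l2dot_ae_eq mO Lb La La ab).
Qed.

Lemma grad_norm1_L2 phi : test phi -> L2 Omega (grad_norm1 phi) /\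
  l2dot Omega (grad_norm1 phi) (grad_norm1 phi) <= n%:R * graddot Omega phi phi.
Proof.
move=> tp.
have tpi i := test_partial i tp.
have Lg : L2 Omega (grad_norm1 phi).
  have /choice[M PM] : forall i : 'I_n, exists M, forall x, `|partial i phi x| <= M.
    by move=> i; have [M _ HM] := test_bounded (tpi i); exists M.
  apply: (@L2_bounded _ _ _ oO bO _ (\sum_(i < n) M i)).
    by apply: measurable_funS (measurable_grad_norm1 tp).
  move=> x _; rewrite ger0_norm ?grad_norm1_ge0//.
  by apply: ler_sum => i _; exact: PM.
split => //.
rewrite graddot_test//.
set N := \sum_(i < n) _.
have mp2 i : measurable_fun Omega (fun x => partial i phi x ^+ 2).
  by apply: measurable_funX; apply: measurable_funS (test_measurable (tpi i)).
have QN : (\int[mu]_(x in Omega) (\sum_(i < n) partial i phi x ^+ 2)%R%:E <= N%:E)%E.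
  under eq_integral do rewrite -sumEFin.
  rewrite (@ge0_integral_sum _ _ _ mu _ mO _ (fun i x => (partial i phi x ^+ 2)%:E)).
  - rewrite /N -sumEFin le_eqVlt; apply/orP; left; apply/eqP; apply: eq_bigr => i _.
    have Li : L2 Omega (partial i phi) by exact: test_L2.
    by rewrite (l2dotE mO Li Li).
  - by move=> i; exact/measurable_EFinP.
  - by move=> i x _; rewrite lee_fin sqr_ge0.
rewrite -lee_fin (l2dotE mO Lg Lg).
have -> : n%:R * N = n%:R * N + 0 * 0 by rewrite mul0r addr0.
apply: (@integral_lincomb_le _ _ _ _ _ (fun x => \sum_(i < n) partial i phi x ^+ 2) (cst 0)) => //.
- exact: measurable_sum.
- by apply: measurable_funM; have [] := Lg.
- by move=> x _; apply: sumr_ge0 => i _; rewrite sqr_ge0.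
- by move=> x _; rewrite mul0r addr0 -expr2 sqr_ge0 sqr_sum_norm_le.
- by rewrite integral0.
Qed.

(** On the line through x, |phi|^c is the integral of its derivative from a point outside the
    support. The assumption c > 1 makes |s|^c differentiable at 0. *)
Lemma line_dominated_power phi (c : R) : test phi -> 1 < c ->
  line_dominated (fun x => `|phi x| `^ c)
    (fun x => c * `|phi x| `^ (c - 1) * grad_norm1 phi x).
Proof.
move=> tp c1 i x; have [L L0 OL] := domain_cube bO.
have c0 : 0 < c by exact: lt_trans c1.
have tip := test_partial i tp.
pose l (t : R) := t *: delta_mx ord0 i + setc i 0 x.
pose H t := phi (l t).
pose h t := partial i phi (l t).
have out (t : R) : L < `|t| -> H t = 0.
  move=> Lt; apply: (test_out tp) => /OL /cubeP /(_ i).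
  by rewrite /l -setcE setc_eq leNgt Lt.
have cl : continuous l.
  by move=> t; apply: cvgD; [apply: cvgZl; exact: cvg_id|exact: cvg_cst].
have cH : continuous H by move=> t; apply: continuous_comp; [exact: cl|exact: (test_continuous tp)].
have ch : continuous h by move=> t; apply: continuous_comp; [exact: cl|exact: (test_continuous tip)].
have dH (t : R) : is_derive t 1 H (h t).
  by apply: is_derive_line; apply: smooth_is_derive; exact: (test_smooth tp).
pose p t := c * signed_pow (c - 1) (H t) * h t.
have dp (t : R) : is_derive t 1 (fun t => `|H t| `^ c) (p t).
  exact: (@is_derive1_comp _ (fun s : R => `|s| `^ c) H _ _ _
    (is_derive_powR_norm (H t) c1) (dH t)).
have cp : continuous p.
  apply: continuous_mulf => //; apply: continuous_mulf; first exact: cst_continuous.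
  have c10 : 0 < c - 1 by rewrite subr_gt0.
  exact: (continuous_compose cH (continuous_signed_pow c10)).
have xE : x = l (x ord0 i) by rewrite /l -setcE setc_id.
have [xL|xL] := ltP L `|x ord0 i|.
  rewrite {1}xE -/(H _) out// normr0 powR0 ?gt_eqF//.
  by apply: integral_ge0 => t _; rewrite lee_fin !mulr_ge0 ?powR_ge0 ?grad_norm1_ge0// ltW.
have ax : - (L + 1) <= x ord0 i by move: xL; rewrite ler_norml => /andP[]; lra.
have := FTC_segment ax dp cp.
rewrite (out (- (L + 1))); last by rewrite normrN ger0_norm; lra.
rewrite normr0 powR0 ?gt_eqF// subr0 /H -xE => <-.
apply: le_trans (lee_abs _) _.
have mp D : measurable D -> measurable_fun D (EFin \o p).
  by move=> mD; apply/measurable_EFinP; apply: measurable_funTS; exact: continuous_measurable_fun.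
apply: le_trans (le_abse_integral _ _ _) _ => //; first exact: mp.
have md : measurable_fun setT (fun t : R => (c * `|H t| `^ (c - 1) * grad_norm1 phi (l t))%:E).
  apply/measurable_EFinP; apply: measurable_funM; first apply: measurable_funM => //.
    apply: (measurableT_comp (measurable_powR _)); apply: measurableT_comp => //.
    exact: continuous_measurable_fun.
  apply: measurable_sum => j; apply: measurableT_comp => //.
  apply: continuous_measurable_fun => t; apply: continuous_comp; first exact: cl.
  exact: (test_continuous (test_partial j tp)).
have -> : (fun t : R => (c * `|phi (setc i t x)| `^ (c - 1) * grad_norm1 phi (setc i t x))%:E)
  = (fun t : R => (c * `|H t| `^ (c - 1) * grad_norm1 phi (l t))%:E).
  by apply/funext => t; rewrite setcE.
have d0 (t : R) : (0 <= (c * `|H t| `^ (c - 1) * grad_norm1 phi (l t))%:E)%E.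
  by rewrite lee_fin !mulr_ge0 ?powR_ge0 ?grad_norm1_ge0// ltW.
apply: (@le_trans _ _ (\int[mu1]_(t in `[(- (L + 1))%R, x ord0 i])
   (c * `|H t| `^ (c - 1) * grad_norm1 phi (l t))%:E)%E); last first.
  by apply: ge0_subset_integral.
apply: ge0_le_integral => //.
- by apply: measurableT_comp => //; exact: mp.
- exact: measurable_funTS.
move=> t _; rewrite /= lee_fin /p normrM; apply: ler_pM => //.
  rewrite normrM (gtr0_norm c0) ler_wpM2l ?(ltW c0)//.
  rewrite /signed_pow normrM [X in _ * X]ger0_norm ?powR_ge0// ler_piMl ?powR_ge0//.
  by rewrite normr_sg; case: (_ != 0).
rewrite /grad_norm1 (bigD1 i)//= lerDl; exact: sumr_ge0.
Qed.

(** The gradient enters through a positive upper bound [delta], so that a vanishing gradient needs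
    no separate case. Gagliardo's inequality is applied to |phi|^c rather than [phi]; Cauchy-Schwarz
    bounds the integral of [d] by the gradient times x, and [sobolev_bootstrap] removes x from the
    right side. *)
Lemma sobolev_test (r : R) : (0 < n)%N -> 2 < r ->
  ((2 < n)%N -> r * (n%:R - 2) <= 2 * n%:R) ->
  exists2 K, 0 < K & forall phi (delta : R), test phi -> 0 < delta ->
    graddot Omega phi phi <= delta ^+ 2 ->
    (\int[mu]_(x in Omega) (`|phi x| `^ r)%:E <= ((K * delta) `^ r)%:E)%E.
Proof.
move=> n0 r2 nr; have [L L0 OL] := domain_cube bO.
(* With this c the power c - 1 in the derivative is r/2, so its square integrates to the integral of
   |phi|^r that is being estimated. *)
pose c : R := 1 + r / 2; pose C := 2 * L + 1.
have c1 : 1 < c by rewrite /c; lra.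
have C0 : 0 < C by rewrite /C; lra.
have sn0 : 0 < Num.sqrt n%:R :> R by rewrite sqrtr_gt0 ltr0n.
exists (C `^ (c / r) * (c * Num.sqrt n%:R)).
  by rewrite !mulr_gt0 ?powR_gt0//; lra.
move=> phi delta tp d0 gd.
pose h x := `|phi x| `^ (r / 2).
have mh : measurable_fun setT h.
  apply: (measurableT_comp (measurable_powR _)); apply: measurableT_comp => //.
  exact: (test_measurable tp).
have Lh : L2 Omega h.
  have [M M0 HM] := test_bounded tp.
  apply: (@L2_bounded _ _ _ oO bO _ (M `^ (r / 2))); first exact: measurable_funS mh.
  move=> x _; rewrite ger0_norm ?powR_ge0// ge0_ler_powR ?nnegrE//; lra.
have [LG G2] := grad_norm1_L2 tp.
pose x := l2norm Omega h.
have xE : (\int[mu]_(x in Omega) (`|phi x| `^ r)%:E = (x ^+ 2)%:E)%E.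
  rewrite (l2normE mO Lh); apply: eq_integral => y _; congr EFin.
  rewrite -powR_mulrn ?powR_ge0// -powRrM; congr (_ `^ _); by field.
rewrite xE lee_fin -mulrA.
have x0 : 0 <= x by exact: l2norm_ge0.
have [x00|xn0] := eqVneq x 0; first by rewrite x00 expr0n powR_ge0.
have xgt0 : 0 < x by rewrite lt_def xn0.
have B0 : 0 < c * Num.sqrt n%:R * delta by rewrite !mulr_gt0//; lra.
apply: sobolev_bootstrap => //.
pose g y := `|phi y| `^ c.
pose d y := c * `|phi y| `^ (c - 1) * grad_norm1 phi y.
have hE y : h y = `|phi y| `^ (c - 1) by rewrite /h /c addrC addKr.
have mg : measurable_fun setT g.
  apply: (measurableT_comp (measurable_powR _)); apply: measurableT_comp => //.
  exact: (test_measurable tp).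
have md : measurable_fun setT d.
  apply: measurable_funM; last exact: measurable_grad_norm1.
  apply: measurable_funM => //.
  by rewrite (_ : (fun y => _) = h)//; apply/funext => y; rewrite hE.
have d_ge0 y : 0 <= d y by rewrite !mulr_ge0 ?powR_ge0 ?grad_norm1_ge0//; lra.
have cr : r / c = 1 + (r / c - 1) by rewrite addrC subrK.
have cn0 : c != 0 by rewrite gt_eqF//; lra.
rewrite [X in _ `^ X]cr -lee_fin -xE.
have -> : (\int[mu]_(y in Omega) (`|phi y| `^ r)%:E =
   \int[mu]_y (g y `^ (1 + (r / c - 1)))%:E)%E.
  rewrite integral_mkcond; apply: eq_integral => y _; rewrite /patch.
  case: ifPn => [_|]; first by rewrite -cr /g -powRrM mulrC divfK.
  by rewrite notin_setE => Oy; rewrite /g (test_out tp Oy) normr0 powR0 ?powR0 -?cr ?mulf_neq0 ?invr_neq0// gt_eqF//; lra.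
apply: (@subcritical_gagliardo _ n g d) => //.
- by move=> y; exact: powR_ge0.
- exact: line_dominated_power.
- exact: ltW.
- move=> y Ly; rewrite /g (test_out tp) ?normr0 ?powR0// => /OL; exact: Ly.
- exact: mulr_gt0.
- have -> : r / c - 1 = (r - 2) / (r + 2).
    by rewrite /c; field; rewrite !gt_eqF//; lra.
  by rewrite ltr_pdivrMr ?divr_gt0//; lra.
(* The exponent is 1 + t = r/c, that is t = (r - 2)/(r + 2); then t <= 1/(n - 1) is equivalent to r
   (n - 2) <= 2n. *)
- move=> n2.
  have n1 : (2 : R) < n%:R by rewrite ltr_nat.
  have -> : r / c - 1 = (r - 2) / (r + 2).
    by rewrite /c; field; rewrite !gt_eqF//; lra.
  have np : (n.-1)%:R = n%:R - 1 :> R by rewrite -[in RHS](prednK n0) -natr1 addrK.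
  rewrite np ler_pdivrMr; last lra.
  rewrite ler_pdivlMl; last lra.
  by have := nr n2; lra.
have -> : (\int[mu]_y (d y)%:E = (c * l2dot Omega h (grad_norm1 phi))%:E)%E.
  rewrite EFinM (l2dotE mO Lh LG) -ge0_integralZl//; last 3 first.
  - by apply/measurable_EFinP; apply: measurable_funM; [exact: measurable_funS mh|case: LG].
  - by move=> y _; rewrite lee_fin mulr_ge0 ?powR_ge0 ?grad_norm1_ge0.
  - by rewrite lee_fin; lra.
  rewrite [RHS]integral_mkcond; apply: eq_integral => y _; rewrite /patch.
  case: ifPn => [_|]; first by rewrite -EFinM mulrA hE.
  by rewrite notin_setE => Oy; rewrite /d (grad_norm1_out tp Oy) mulr0.
rewrite lee_fin -!mulrA ler_pM2l; last by lra.
have := si_CS si2 Lh LG.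
have NG : l2norm Omega (grad_norm1 phi) <= Num.sqrt n%:R * delta.
  rewrite -(@ler_pXn2r _ 2)// ?nnegrE ?l2norm_ge0 ?mulr_ge0 ?(ltW sn0) ?(ltW d0)//.
  rewrite exprMn [Num.sqrt n%:R ^+ 2]sqr_sqrtr ?ler0n// (sqr_l2norm oO LG).
  by apply: le_trans G2 _; rewrite ler_wpM2l ?ler0n.
rewrite -!l2norm_seminorm => CS; apply: le_trans (ler_norm _) _; apply: le_trans CS _.
by rewrite mulrC mulrA ler_wpM2r.
Qed.

End sobolev_test.

Lemma cvg_powR_norm (R : realType) (u : nat -> R) (l r : R) : 0 < r ->
  u @ \oo --> l -> `|u k| `^ r @[k --> \oo] --> `|l| `^ r.
Proof.
move=> r0 ul; apply: (@cvg_comp _ _ _ u (fun y => `|y| `^ r) _ _ _ ul).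
exact: (continuous_powR_norm r0).
Qed.
Lemma sqr_le_1powR (R : realType) (y r : R) : 2 < r -> y ^+ 2 <= 1 + `|y| `^ r.
Proof.
move=> r2; rewrite -[y ^+ 2]real_normK ?num_real//.
have := normr_ge0 y; move: `|y| => x x0; have p0 := powR_ge0 x r.
have [x1|x1] := leP x 1.
  by apply: (@le_trans _ _ 1); [rewrite exprn_ile1|rewrite lerDl].
rewrite -powR_mulrn//; apply: (@le_trans _ _ (x `^ r)); last by rewrite lerDr.
by rewrite ler_powR ?(ltW r2)// ltW.
Qed.

Lemma subcritical_exponent (R : realType) n :
  exists2 r : R, 2 < r & (2 < n)%N -> r * (n%:R - 2) <= 2 * n%:R.
Proof.
have [n2|n2] := ltnP 2 n; last by exists 3 => //; lra.
have n2' : (2 : R) < n%:R by rewrite ltr_nat.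
exists (2 * n%:R / (n%:R - 2)); first by rewrite ltr_pdivlMr; lra.
by move=> _; rewrite divfK// gt_eqF// subr_gt0.
Qed.

(** * The Sobolev and Poincare inequalities on H01 *)

Section sobolev_H01.
Context (R : realType) (n : nat) (Omega : set 'rV[R]_n).
Hypotheses (oO : open Omega) (bO : bounded_set Omega).
Local Notation mu := (lebesgue_rV R n).
Local Notation test := (test_function Omega).
Implicit Types (phi v : 'rV[R]_n -> R).

Let mO : measurable Omega. Proof. exact: domain_measurable. Qed.
Let si2 := l2_semi_inner mO.
Let si1 := h1_semi_inner oO bO.
Local Opaque Rintegral l2dot l2norm graddot h1norm.

Lemma grad_semi_inner_H01 : semi_inner (H01 Omega) (graddot Omega).
Proof.
apply: (semi_inner_sub _ (si0 si1) _ (grad_semi_inner oO bO)); first by move=> v [].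
by move=> a u v; exact: (siP si1).
Qed.

Lemma h1norm_seminorm v : H01 Omega v -> h1norm Omega v = seminorm_of (h1dot Omega) v.
Proof. by move=> Hv; rewrite (h1normE oO (H01_H1 Hv)). Qed.

Lemma h1norm_dist u v w : H01 Omega u -> H01 Omega v -> H01 Omega w ->
  h1norm Omega (u - w) <= h1norm Omega (u - v) + h1norm Omega (v - w).
Proof.
move=> Hu Hv Hw.
rewrite (h1norm_seminorm (siB_ si1 Hu Hw)) (h1norm_seminorm (siB_ si1 Hu Hv)).
rewrite (h1norm_seminorm (siB_ si1 Hv Hw)); exact: (nB_dist si1 Hu Hv Hw).
Qed.

Lemma h1normC u v : H01 Omega u -> H01 Omega v ->
  h1norm Omega (u - v) = h1norm Omega (v - u).
Proof.
move=> Hu Hv.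
rewrite (h1norm_seminorm (siB_ si1 Hu Hv)) (h1norm_seminorm (siB_ si1 Hv Hu)).
exact: (nBC si1 Hu Hv).
Qed.

(** An approximation fast enough to have summable increments also converges almost everywhere, which
    is what [fatou_bound] needs. *)
Lemma H01_fast_approx v (delta : R) : H01 Omega v -> 0 < delta ->
  exists phi : nat -> 'rV[R]_n -> R,
    [/\ forall k, test (phi k), forall k, h1norm Omega (phi k - v) < delta &
      {ae mu, forall x, Omega x -> phi k x @[k --> \oo] --> v x}].
Proof.
move=> Hv d0; have [Hv1 vP] := (H01P Omega v).1 Hv.
have e0 k : 0 < Num.min delta (2^-1 ^+ k / 2) :> R.
  by rewrite lt_min d0 divr_gt0// exprn_gt0.
have /choice[phi Pphi] k : exists phi, test phi /\ h1norm Omega (phi - v) < Num.min delta (2^-1 ^+ k / 2).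
  by have [phi tp pv] := vP _ (e0 k); exists phi.
have tphi k : test (phi k) by case: (Pphi k).
have Hphi k : H01 Omega (phi k) by exact: test_H01.
have pd k : h1norm Omega (phi k - v) < delta.
  by have [_] := Pphi k; rewrite lt_min => /andP[].
have pk k : h1norm Omega (phi k - v) < 2^-1 ^+ k / 2.
  by have [_] := Pphi k; rewrite lt_min => /andP[].
(* Consecutive errors 2^-k/2 and 2^-(k+1)/2 add up to less than 2^-k. The limit [w] then agrees with
   [v] almost everywhere. *)
have [|w [Hw cw aw]] := @H01_complete _ _ _ oO bO phi Hphi.
  move=> k; have := h1norm_dist (Hphi k.+1) Hv (Hphi k); rewrite (h1normC Hv (Hphi k)).
  have := pk k; have := pk k.+1; rewrite exprS.
  have : 0 < 2^-1 ^+ k :> R by rewrite exprn_gt0.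
  move: (h1norm _ _) (h1norm _ _) (h1norm _ _) (_ ^+ k) => x y z w; lra.
exists phi; split=> //.
have Hw1 := H01_H1 Hw.
have wv0 : l2norm Omega (w - v) = 0.
  apply/eqP; rewrite eq_le l2norm_ge0 andbT.
  apply: (le_trans (l2norm_le_h1norm oO bO (H01_H1 (siB_ si1 Hw Hv)))).
  have lim0 : h1norm Omega (phi k - w) + 2^-1 ^+ k @[k --> \oo] --> (0 + 0 : R).
    apply: cvgD cw _; apply: cvg_expr; rewrite ger0_norm; lra.
  rewrite -[leRHS]addr0; apply: (ler_cvg_to (cvg_cst _) lim0).
  apply: nearW => k.
  have := h1norm_dist Hw (Hphi k) Hv; rewrite (h1normC Hw (Hphi k)); have := pk k.
  have : 0 < 2^-1 ^+ k :> R by rewrite exprn_gt0.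
  move: (h1norm _ _) (h1norm _ _) (h1norm _ _) (_ ^+ k) => x y z t; lra.
have := l2norm_eq0_ae mO (H01_L2 (siB_ si1 Hw Hv)) wv0.
apply: filterS2 aw => x pw wv Ox; have := wv Ox; rewrite fct_subE => /eqP.
by rewrite subr_eq0 => /eqP <-; exact: pw.
Qed.

(** Approximants within [delta] of [v] have gradient norm at most 2 [delta], hence the doubled
    constant; Fatou's lemma passes to the limit. *)
Lemma sobolev (r : R) : (0 < n)%N -> 2 < r ->
  ((2 < n)%N -> r * (n%:R - 2) <= 2 * n%:R) ->
  exists2 K, 0 < K & forall v (delta : R), H01 Omega v -> 0 < delta ->
    graddot Omega v v <= delta ^+ 2 ->
    (\int[mu]_(x in Omega) (`|v x| `^ r)%:E <= ((K * delta) `^ r)%:E)%E.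
Proof.
move=> n0 r2 nr; have [K K0 KP] := sobolev_test oO bO n0 r2 nr.
exists (K * 2); first by rewrite mulr_gt0.
move=> v delta Hv d0 gv.
have [phi [tphi pd pv]] := H01_fast_approx Hv d0.
have mpow (w : 'rV[R]_n -> R) : measurable_fun Omega w -> measurable_fun Omega (fun x => `|w x| `^ r).
  by move=> mw; apply: (measurableT_comp (measurable_powR _)); apply: measurableT_comp.
apply: (@fatou_bound _ _ _ mu _ mO (fun k x => `|phi k x| `^ r)).
- by move=> k; apply: mpow; have [] := test_L2 oO bO (tphi k).
- by apply: mpow; have [] := H01_L2 Hv.
- by move=> k x; exact: powR_ge0.
- by move=> x; exact: powR_ge0.
- apply: filterS pv => x pv Ox.
  have r1 : 1 < r by lra.
  have r0 : 0 < r by lra.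
  exact: (cvg_powR_norm r0 (pv Ox)).
move=> k; rewrite -mulrA; apply: KP => //; first by rewrite mulr_gt0.
have Hp := test_H01 oO bO (tphi k).
have gs := grad_semi_inner_H01.
rewrite -(sqr_nB gs Hp) ler_pXn2r ?nnegrE ?nB_ge0 ?mulr_ge0 ?(ltW d0)//.
have gvd : seminorm_of (graddot Omega) v <= delta.
  by rewrite -(@ler_pXn2r _ 2)// ?nnegrE ?nB_ge0 ?(ltW d0)// (sqr_nB gs Hv).
have := nB_le_dist gs Hp Hv.
have := gradnorm_le_h1norm oO bO (H01_H1 (siB_ si1 Hp Hv)).
have := pd k; move: gvd.
move: (h1norm _ _) (seminorm_of _ _) (seminorm_of _ _) (seminorm_of _ _) => a b c d; lra.
Qed.

(** For gradient norm at most 1, the bound v^2 <= 1 + |v|^r reduces to the Sobolev inequality on a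
    domain of finite measure. The general case follows by scaling. *)
Lemma poincare : (0 < n)%N ->
  exists2 K, 0 < K & forall v, H01 Omega v ->
    l2norm Omega v <= K * seminorm_of (graddot Omega) v.
Proof.
move=> n0; have [r r2 nr] := subcritical_exponent R n.
have [K K0 HK] := sobolev n0 r2 nr.
have gs := grad_semi_inner_H01.
have mfin : (mu Omega)%E \is a fin_num by rewrite ge0_fin_numE//; exact: domain_lty.
pose P := Num.sqrt (fine (mu Omega) + K `^ r).
have m0 : 0 <= fine (mu Omega) by rewrite fine_ge0.
have P0 : 0 < P by rewrite sqrtr_gt0 ltr_wpDl// powR_gt0.
have unit v : H01 Omega v -> graddot Omega v v <= 1 -> l2norm Omega v <= P.
  move=> Hv gv; have Lv := H01_L2 Hv; have [mv _] := Lv.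
  rewrite -(@ler_pXn2r _ 2)// ?nnegrE ?l2norm_ge0 ?(ltW P0)//.
  rewrite [P ^+ 2]sqr_sqrtr; last by rewrite addr_ge0// powR_ge0.
  rewrite -lee_fin (l2normE mO Lv).
  have mp : measurable_fun Omega (fun x => `|v x| `^ r).
    by apply: (measurableT_comp (measurable_powR _)); apply: measurableT_comp.
  apply: (@le_trans _ _ (\int[mu]_(x in Omega) (1 + (`|v x| `^ r)%:E))%E).
    apply: ge0_le_integral => //.
    - by move=> x _; rewrite lee_fin sqr_ge0.
    - by apply/measurable_EFinP; exact: measurable_funX.
    - by apply: emeasurable_funD => //; exact/measurable_EFinP.
    - by move=> x _; rewrite -EFinD lee_fin; exact: sqr_le_1powR.
  rewrite ge0_integralD//; last exact/measurable_EFinP.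
  rewrite integral_cst// mul1e EFinD fineK// leeD2l//.
  have := HK v 1 Hv ltr01; rewrite expr1n mulr1; exact.
exists P => // v Hv.
(* Dividing by any d larger than the gradient norm, instead of by the norm, includes the case of
   zero gradient. *)
have key (d : R) : 0 < d -> seminorm_of (graddot Omega) v < d -> l2norm Omega v <= P * d.
  move=> d0 vd; have Hdv := siZ gs d^-1 Hv.
  have := unit _ Hdv; rewrite !l2norm_seminorm (nBZ si2 _ (H01_L2 Hv)).
  rewrite (gtr0_norm (_ : 0 < d^-1)) ?invr_gt0// ler_pdivrMl// mulrC; apply.
  rewrite -(sqr_nB gs Hdv) (nBZ gs _ Hv) (gtr0_norm (_ : 0 < d^-1)) ?invr_gt0//.
  rewrite exprn_ile1 ?mulr_ge0 ?invr_ge0 ?nB_ge0 ?(ltW d0)//.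
  by rewrite ler_pdivrMl// mulr1 ltW.
have g0 := nB_ge0 (graddot Omega) v.
rewrite -ler_pdivrMl//; apply/ler_addgt0Pr => e e0; rewrite ler_pdivrMl//.
apply: key; first by rewrite ltr_wpDl.
by rewrite ltrDl.
Qed.

End sobolev_H01.

(** * Minimizers of the Rayleigh quotient *)

(** Along an ultrafilter all bounded real sequences converge at once, which replaces a diagonal
    extraction of subsequences. *)
Lemma ultra_bounded_cvg (R : realType) (U : set_system nat) (a : nat -> R) (M : R) :
  UltraFilter U -> (forall k, `|a k| <= M) -> exists c : R, a @ U --> c.
Proof.
move=> UU aM.
have [|c [_ ac]] := @segment_compact R (- M) M (a @ U) _.
  apply: (@filterS _ U _ setT); last exact: filterT.
  by move=> k _ /=; rewrite in_itv/= -ler_norml.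
exists c => B Bc; have [//|nB] := in_ultra_setVsetC (a @^-1` B) UU.
by have [x [nBx Bx]] := ac (~` B) B nB Bc.
Qed.

Section rayleigh.
Context (R : realType) (V : lmodType R) (Y : V -> Prop) (l g : V -> V -> R).
Hypotheses (sil : semi_inner Y l) (sig : semi_inner Y g).
Local Notation h := (fun u v => l u v + g u v).
Local Notation nl := (seminorm_of l).
Local Notation nh := (seminorm_of h).
Implicit Types u v w : V.

Hypothesis Ycomplete : forall v : nat -> V, (forall k, Y (v k)) ->
  (forall k, nh (v k.+1 - v k) <= 2^-1 ^+ k) ->
  exists2 w, Y w & nh (v k - w) @[k --> \oo] --> 0.

(** Compactness of the embedding in quantitative form: up to finitely many [l]-bounded functionals,
    [l] is controlled by an arbitrarily small multiple of [g]. *)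
Hypothesis Ycompact : forall e : R, 0 < e ->
  exists (J : finType) (F : J -> V -> R) (C : R),
  [/\ forall j u v, Y u -> Y v -> F j (u - v) = F j u - F j v,
      forall j v, Y v -> `|F j v| <= C * nl v &
      forall v, Y v -> l v v <= \sum_j F j v ^+ 2 + e * g v v].


Lemma parallelogram (B : V -> V -> R) u v : semi_inner Y B -> Y u -> Y v ->
  B (u + v) (u + v) + B (u - v) (u - v) = 2 * B u u + 2 * B v v.
Proof. by move=> siB Xu Xv; rewrite (siDD siB)// (siBB siB)//; ring. Qed.

(** The parallelogram law makes a minimizing sequence Cauchy in the full norm once compactness makes
    it Cauchy for [l]. The eigenvalue equation needs no differentiation: it is Cauchy-Schwarz for
    the form [g - Lam l]. *)
Lemma rayleigh_attained : (exists2 v, Y v & 0 < l v v) ->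
  exists Lam w, [/\ Y w, 0 < l w w, forall v, Y v -> g w v = Lam * l w v &
    forall v, Y v -> Lam * l v v <= g v v].
Proof.
move=> [v0 Yv0 lv0].
pose S := [set g v v | v in [set v | Y v /\ l v v = 1]].
have norm1 v : Y v -> 0 < l v v -> S (g v v / l v v).
  move=> Yv lv; exists ((nl v)^-1 *: v).
    split; first exact: (siZ sil).
    rewrite (siZl sil)//; last exact: (siZ sil).
    rewrite (siZr sil)// mulrA -expr2 exprVn (sqr_nB sil Yv) mulVf// gt_eqF//.
  rewrite (siZl sig)//; last exact: (siZ sil).
  by rewrite (siZr sig)// mulrA -expr2 exprVn (sqr_nB sil Yv) mulrC.
have S0 : has_inf S.
  split; first by eexists; exact: norm1 Yv0 lv0.
  by exists 0 => _ [v [Yv _] <-]; exact: (si_ge0 sig).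
pose Lam := inf S.
have Lam0 : 0 <= Lam.
  by apply: lb_le_inf; [case: S0|move=> _ [v [Yv _] <-]; exact: (si_ge0 sig)].
have ray v : Y v -> Lam * l v v <= g v v.
  move=> Yv; have := si_ge0 sil Yv; rewrite le_eqVlt => /predU1P[<-|lv].
    by rewrite mulr0; exact: (si_ge0 sig).
  by rewrite -ler_pdivlMr//; apply: inf_lbound; [case: S0|exact: norm1].
have /choice[v Pv] k : exists v, [/\ Y v, l v v = 1 & g v v < Lam + k.+1%:R^-1].
  have [|x [v [Yv lv] <-] gv] := @inf_adherent _ S (k.+1%:R^-1) _ S0.
    by rewrite invr_gt0 ltr0n.
  by exists v.
have Yv k : Y (v k) by case: (Pv k).
have lv k : l (v k) (v k) = 1 by case: (Pv k).
have gv k : g (v k) (v k) < Lam + k.+1%:R^-1 by case: (Pv k).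
have nlv k : nl (v k) = 1 by rewrite /seminorm_of lv sqrtr1.
have [U [UU oU]] := ultraFilterLemma (eventually_filter : ProperFilter \oo).
have UF : Filter U by exact: _.
have tail (eta : R) : 0 < eta -> \forall k \near U, g (v k) (v k) <= Lam + eta.
  move=> e0; apply: oU; have := near_infty_natSinv_lt (PosNum e0).
  by apply: filterS => k /= ke; rewrite (le_trans (ltW (gv k)))// lerD2l ltW.
have close (eta : R) : 0 < eta -> exists2 A, U A &
    forall k m, A k -> A m -> g (v k) (v k) <= Lam + eta /\
      h (v k - v m) (v k - v m) <= eta.
  move=> eta0; pose L1 := Lam + 1.
  have L10 : 0 < L1 by rewrite ltr_wpDl.
  (* Let [lm] and [gmm] be the values of [l] and [g] at the difference [v k - v m]. Then gmm <= 4
     L1, so the compactness term and the functionals each contribute at most eta/(3 L1) to [lm], and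
     L1 lm <= 2 eta/3. The parallelogram law gives gmm <= eta/3 + Lam lm, hence gmm + lm <= eta. *)
  have e0 : 0 < eta / (12 * L1 ^+ 2) by rewrite divr_gt0// mulr_gt0// exprn_gt0.
  have [J [F [C [FB FC FP]]]] := Ycompact e0.
  have Fcvg j : exists c : R, F j (v k) @[k --> U] --> c.
    by apply: (@ultra_bounded_cvg _ _ _ C) => k; rewrite -[C]mulr1 -(nlv k); exact: FC.
  have /choice[c cP] := Fcvg.
  pose d := eta / (3 * L1 * (#|J|.+1)%:R).
  have d0 : 0 < d by rewrite divr_gt0// !mulr_gt0.
  pose s := Num.min 1 (eta / 12).
  have s0 : 0 < s by rewrite lt_min ltr01 divr_gt0.
  exists [set k | (forall j, `|c j - F j (v k)| < Num.sqrt d / 2) /\ g (v k) (v k) <= Lam + s].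
    apply: filterI; last exact: tail.
    apply: filter_forall => j; move/cvgrPdist_lt : (cP j); apply.
    by rewrite divr_gt0 ?sqrtr_gt0.
  move=> k m [cFk gk] [cFm gm].
  have s1 : s <= 1 by rewrite ge_min lexx.
  have seta : s <= eta / 12 by rewrite ge_min lexx orbT.
  split; first by lra.
  have Ykm : Y (v k - v m) by exact: (siB_ sil).
  have pg := parallelogram sig (Yv k) (Yv m).
  have pl := parallelogram sil (Yv k) (Yv m).
  have rk := ray _ (siD sil (Yv k) (Yv m)).
  have gp0 := si_ge0 sig (siD sil (Yv k) (Yv m)).
  have lk := FP _ Ykm.
  have sF : \sum_j F j (v k - v m) ^+ 2 <= eta / (3 * L1).
    apply: (@le_trans _ _ (\sum_(j : J) d)).
      apply: ler_sum => j _; rewrite FB// -[leLHS]real_normK ?num_real//.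
      rewrite -[leRHS](sqr_sqrtr (ltW d0)) ler_pXn2r ?nnegrE ?sqrtr_ge0//.
      have := cFk j; have := cFm j; have := ler_distD (c j) (F j (v k)) (F j (v m)).
      by rewrite (distrC (F j (v k)) (c j)); lra.
    rewrite sumr_const -[leLHS]mulr_natr /d invfM mulrA -mulrA ler_piMr//.
      by rewrite divr_ge0 ?(ltW eta0)// ltW// mulr_gt0.
    by rewrite ler_pdivrMl// mulr1 ler_nat.
  move: lk sF pg pl rk gp0 gk gm; rewrite !lv.
  move: (l (v k + v m) _) (l (v k - v m) _) (g (v k + v m) _) (g (v k - v m) _).
  move: (\sum_j _) (g (v k) (v k)) (g (v m) (v m)) => S' gk gm lp lm gp gmm lk sF pg pl rk gp0 Gk Gm.
  have G4 : gmm <= 4 * L1 by rewrite /L1; lra.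
  have lm2 : lm <= eta / (3 * L1) * 2.
    have -> : eta / (3 * L1) * 2 = eta / (3 * L1) + eta / (12 * L1 ^+ 2) * (4 * L1).
      by field; rewrite gt_eqF.
    by apply: (le_trans lk); apply: lerD => //; rewrite ler_wpM2l// ltW.
  have : L1 * lm <= eta * 2 / 3.
    have -> : eta * 2 / 3 = L1 * (eta / (3 * L1) * 2) by field; rewrite gt_eqF.
    by rewrite ler_wpM2l// ltW.
  have : Lam * lp = 4 * Lam - L1 * lm + lm.
    have -> : lp = 4 - lm by move: pl; lra.
    by rewrite /L1; ring.
  by lra.
have [A AU PA] : exists2 A : nat -> set nat, (forall i, U (A i)) &
    forall i k m, A i k -> A i m -> g (v k) (v k) <= Lam + (2^-1 ^+ i) ^+ 2 /\
      h (v k - v m) (v k - v m) <= (2^-1 ^+ i) ^+ 2.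
  have /choice[A PA] i : exists A, U A /\ forall k m, A k -> A m ->
      g (v k) (v k) <= Lam + (2^-1 ^+ i) ^+ 2 /\
      h (v k - v m) (v k - v m) <= (2^-1 ^+ i) ^+ 2.
    have [|A UA AP] := close ((2^-1 ^+ i) ^+ 2); first by rewrite !exprn_gt0.
    by exists A.
  by exists A => i; have [] := PA i.
(* A finite intersection of members of the ultrafilter is nonempty. Since [f i] lies in the first i
   + 1 sets, [f i] and [f i.+1] both lie in [A i], and the increments are at most 2^-i. *)
have /choice[f Pf] i : exists k, forall j : 'I_i.+1, A j k.
  have Ui : U [set k | forall j : 'I_i.+1, A j k].
    by apply: (@filter_forall _ _ (fun j : 'I_i.+1 => A j)) => j; exact: AU.
  by have [k] := filter_ex Ui; exists k.
have Af i j : (j <= i)%N -> A j (f i) by move=> ji; exact: (Pf i (Ordinal (ji : (j < i.+1)%N))).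
have [||w Yw cw] := Ycomplete (v := fun i => v (f i)) => //.
  move=> i; have [_ hi] := PA i _ _ (Af i.+1 i (leqnSn i)) (Af i i (leqnn i)).
  by rewrite /nh -[leRHS]ger0_norm ?exprn_ge0// -sqrtr_sqr ler_wsqrtr.
have Bw B : semi_inner Y B -> (forall u, Y u -> seminorm_of B u <= nh u) ->
    seminorm_of B (v (f i)) @[i --> \oo] --> seminorm_of B w.
  move=> siB Bh; apply/cvgrPdist_lt => e e0; move/cvgrPdist_lt : cw => /(_ e e0).
  apply: filterS => i; rewrite sub0r normrN ger0_norm ?nB_ge0// => wi.
  have Yi := Yv (f i).
  have b1 := nB_le_dist siB Yw Yi; have b2 := nB_le_dist siB Yi Yw.
  have b3 := Bh _ (siB_ siB Yi Yw); rewrite (nBC siB Yw Yi) in b1.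
  by rewrite ltr_norml; apply/andP; split; lra.
have lw1 : nl w = 1.
  have lh u : Y u -> nl u <= nh u.
    by move=> Yu; rewrite ler_wsqrtr// lerDl; exact: (si_ge0 sig).
  have := cvg_lim (@Rhausdorff R) (Bw l sil lh) => /(_ _) <-.
  rewrite (_ : (fun i => nl (v (f i))) = cst 1); last by apply/funext => i /=.
  by rewrite lim_cst.
have gw : g w w <= Lam.
  rewrite -(sqr_nB sig Yw) -(sqr_sqrtr Lam0) ler_pXn2r ?nnegrE ?nB_ge0 ?sqrtr_ge0//.
  have lim : Num.sqrt Lam + 2^-1 ^+ i @[i --> \oo] --> Num.sqrt Lam + 0.
    by apply: cvgD; [exact: cvg_cst|apply: cvg_expr; rewrite ger0_norm; lra].
  rewrite -[leRHS]addr0; apply: (ler_cvg_to (Bw g sig _) lim).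
    by move=> u Yu; rewrite ler_wsqrtr// lerDr; exact: (si_ge0 sil).
  apply: nearW => i; have [gi _] := PA i _ _ (Af i i (leqnn i)) (Af i i (leqnn i)).
  have p0 : 0 <= 2^-1 ^+ i :> R by rewrite exprn_ge0.
  rewrite -(@ler_pXn2r _ 2)// ?nnegrE ?nB_ge0 ?addr_ge0 ?sqrtr_ge0//.
  rewrite (sqr_nB sig (Yv _)) sqrrD sqr_sqrtr//; apply: (le_trans gi).
  by rewrite -addrA lerD2l lerDr mulrn_wge0// mulr_ge0 ?sqrtr_ge0.
have lww : l w w = 1 by rewrite -(sqr_nB sil Yw) lw1 expr1n.
exists Lam, w; split=> //; first by rewrite lww.
move=> u Yu.
(* Minimality makes [B] positive semi-definite, and it vanishes at (w, w), so Cauchy-Schwarz forces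
   [B w u = 0] for all u. *)
pose B u v := g u v - Lam * l u v.
have siB : semi_inner Y B.
  split=> [||a b Ya Yb|a b c d Yb Yc Yd|a Ya]; rewrite /B.
  - exact: (si0 sil).
  - by move=> a b c; exact: (siP sil).
  - by rewrite (si_sym sig Ya Yb) (si_sym sil Ya Yb).
  - by rewrite (siPl sig)// (siPl sil)//; ring.
  - by rewrite subr_ge0; exact: ray.
have Bww : seminorm_of B w = 0.
  apply/eqP; rewrite /seminorm_of sqrtr_eq0 /B lww mulr1 subr_le0//.
have := si_CS siB Yw Yu; rewrite Bww mul0r normr_le0 /B subr_eq0 => /eqP.
by [].
Qed.

End rayleigh.

(** * Compactness *)

Section averaging.
Context d (T : measurableType d) (R : realType) (mu : {measure set T -> \bar R}).

Lemma Rintegral_sum (D : set T) (J : finType) (f : J -> T -> R) :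
  measurable D -> (forall j, mu.-integrable D (EFin \o f j)) ->
  \int[mu]_(x in D) \sum_j f j x = \sum_j \int[mu]_(x in D) f j x.
Proof.
move=> mD fi.
pose F (s : seq J) := \int[mu]_(x in D) \sum_(j <- s) f j x = \sum_(j <- s) \int[mu]_(x in D) f j x.
suff [] : F (index_enum J) /\ mu.-integrable D (EFin \o (fun x => \sum_(j <- index_enum J) f j x)) by [].
elim: (index_enum J) => [|j s [IH iI]]; rewrite /F.
  split; first by rewrite big_nil -[RHS](Rintegral_set0 mu (cst 0)) /Rintegral integral_set0; under eq_integral do rewrite big_nil; rewrite integral0.
  by under [X in integrable _ _ X]eq_fun do rewrite /= big_nil; exact: integrable0.
split.
  by under eq_Rintegral do rewrite big_cons; rewrite RintegralD// IH big_cons.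
rewrite (_ : _ \o _ = (EFin \o f j) \+ (EFin \o (fun x => \sum_(j <- s) f j x))).
  exact: integrableD.
by apply/funext => x; rewrite /= big_cons.
Qed.

(** Jensen's inequality for the square: integrate (w - c)^2 >= 0 with c the mean of [w]. *)
Lemma sqr_Rintegral_le (I : set T) (h : R) (w : T -> R) : measurable I -> 0 < h ->
  mu I = h%:E -> mu.-integrable I (EFin \o w) ->
  mu.-integrable I (EFin \o (fun x => w x ^+ 2)) ->
  (\int[mu]_(x in I) w x) ^+ 2 <= h * \int[mu]_(x in I) (w x ^+ 2).
Proof.
move=> mI h0 muI iw iw2; set W := \int[mu]_(x in I) w x; pose c := W / h.
have fI : (mu I < +oo)%E by rewrite muI ltry.
have ic (r : R) : mu.-integrable I (EFin \o cst r).
  by apply: measurable_bounded_integrable => //; exists `|r|; split => // M rM x _; exact: ltW.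
have i2 : mu.-integrable I (EFin \o (fun x => 2 * c * w x)) by exact: (@integrableZl _ _ _ _ _ mI (2 * c) (EFin \o w) iw).
have : \int[mu]_(x in I) (2 * c * w x - c ^+ 2) <= \int[mu]_(x in I) (w x ^+ 2).
  apply: le_Rintegral => //.
    exact: (integrableB mI i2 (ic (c ^+ 2))).
  by move=> x _; rewrite -subr_ge0; have := sqr_ge0 (w x - c); lra.
rewrite (RintegralB mI i2 (ic (c ^+ 2))) (RintegralZl (2 * c) mI iw) Rintegral_cst// muI/= -/W => H.
rewrite -ler_pdivrMl//; apply: le_trans H; rewrite le_eqVlt; apply/orP; left.
by apply/eqP; rewrite /c; field; rewrite gt_eqF.
Qed.

(** A Poincare inequality on one cell: [w] differs from its mean by at most the oscillation, and the
    square of the mean gives the first term. *)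
Lemma osc_Rintegral_le (I : set T) (h E : R) (w : T -> R) : measurable I -> 0 < h ->
  mu I = h%:E -> 0 <= E -> mu.-integrable I (EFin \o w) ->
  mu.-integrable I (EFin \o (fun x => w x ^+ 2)) ->
  (forall x x', I x -> I x' -> (w x - w x') ^+ 2 <= h * E) ->
  \int[mu]_(x in I) (w x ^+ 2) <= h^-1 * (\int[mu]_(x in I) w x) ^+ 2 + h ^+ 2 * E.
Proof.
move=> mI h0 muI E0 iw iw2 osc; set W := \int[mu]_(x in I) w x; pose c := W / h.
have fI : (mu I < +oo)%E by rewrite muI ltry.
have ic (r : R) : mu.-integrable I (EFin \o cst r).
  by apply: measurable_bounded_integrable => //; exists `|r|; split => // M rM x _; exact: ltW.
have i2 : mu.-integrable I (EFin \o (fun x => 2 * c * w x)) by exact: (@integrableZl _ _ _ _ _ mI (2 * c) (EFin \o w) iw).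
pose s := Num.sqrt (h * E).
have hE : 0 <= h * E by rewrite mulr_ge0// ltW.
have close x : I x -> (w x - c) ^+ 2 <= h * E.
  move=> Ix; have wx x' : I x' -> `|w x - w x'| <= s.
    by move=> Ix'; rewrite -sqrtr_sqr ler_wsqrtr// osc.
  have lo : \int[mu]_(x' in I) (w x - s) <= W.
    apply: (le_Rintegral mI (ic (w x - s)) iw) => x' Ix'.
    by have := wx x' Ix'; rewrite ler_norml => /andP[]; rewrite /=; lra.
  have hi : W <= \int[mu]_(x' in I) (w x + s).
    apply: (le_Rintegral mI iw (ic (w x + s))) => x' Ix'.
    by have := wx x' Ix'; rewrite ler_norml => /andP[]; rewrite /=; lra.
  rewrite -real_normK ?num_real// -(sqr_sqrtr hE) ler_pXn2r ?nnegrE ?sqrtr_ge0//.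
  move: lo hi; rewrite !Rintegral_cst// muI/= => lo hi.
  have Wc : W = c * h by rewrite /c divfK// gt_eqF.
  move: lo hi; rewrite Wc !ler_pM2r// -/s ler_norml => lo hi.
  by apply/andP; split; lra.
have : \int[mu]_(x in I) (w x ^+ 2) <= \int[mu]_(x in I) (2 * c * w x + (h * E - c ^+ 2)).
  apply: le_Rintegral => //.
    exact: (integrableD mI i2 (ic (h * E - c ^+ 2))).
  by move=> x /close; lra.
rewrite (RintegralD mI i2 (ic (h * E - c ^+ 2))) (RintegralZl (2 * c) mI iw) Rintegral_cst// muI/= -/W => /le_trans; apply.
rewrite le_eqVlt; apply/orP; left.
by apply/eqP; rewrite /c; field; rewrite gt_eqF.
Qed.

End averaging.

(** * A Poincare inequality on small cubes *)

Section cells.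
Context (R : realType) (L h : R) (N : nat).
Hypotheses (L0 : 0 <= L) (h0 : 0 < h) (Nh : N%:R * h = 2 * L + 1).
Local Notation mu1 := (@lebesgue_measure R).

(** Half-open, so that the first N cells partition [-L, L + 1[; the extra unit of length beyond L
    captures the endpoint L. *)
Definition cell (k : nat) : set (measurableTypeR R) :=
  `[- L + k%:R * h, - L + k.+1%:R * h[%classic.

Lemma measurable_cell k : measurable (cell k). Proof. exact: measurable_itv. Qed.

Lemma lebesgue_cell k : mu1 (cell k) = h%:E.
Proof.
rewrite /cell lebesgue_measure_itv/= lte_fin ltrD2l ltr_pM2r// ltr_nat leqnn.
by rewrite -EFinD; congr EFin; rewrite -natr1; ring.
Qed.

Lemma sum_indic_cell (a : R) : `|a| <= L -> \sum_(k < N) \1_(cell k) a = 1 :> R.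
Proof.
move=> aL.
have -> m : \sum_(k < m) \1_(cell k) a = ((- L <= a) && (a < - L + m%:R * h))%:R :> R.
  elim: m => [|m IH]; first by rewrite big_ord0 mul0r addr0 ltNge andbN.
  rewrite big_ord_recr/= IH indicE /cell mem_setE in_itv/=.
  have : - L <= - L + m%:R * h by rewrite lerDl mulr_ge0// ltW.
  have : - L + m%:R * h < - L + m.+1%:R * h by rewrite ltrD2l ltr_pM2r// ltr_nat.
  have [] := ltP a (- L + m%:R * h); have [] := ltP a (- L + m.+1%:R * h);
  have [] := leP (- L) a => /=; rewrite ?addr0 ?add0r//; lra.
by move: aL; rewrite Nh ler_norml => /andP[-> aL]/=; rewrite (_ : a < _)//; lra.
Qed.

(** A class stable under sums, products with bounded functions and integration over the first
    coordinate, so that the induction on the dimension never leaves it. *)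
Definition bddc n (g : 'rV[R]_n -> R) : Prop :=
  [/\ measurable_fun setT g, exists M, forall x, `|g x| <= M &
    forall x, ~ cube L x -> g x = 0].

Lemma bddc_integrable n (g : 'rV[R]_n -> R) : bddc g ->
  (lebesgue_rV R n).-integrable setT (EFin \o g).
Proof. by move=> [mg [M gM] g0]; exact: bounded_integrable gM g0. Qed.

Lemma bddc_mul n (c g : 'rV[R]_n -> R) (C : R) : measurable_fun setT c ->
  (forall x, `|c x| <= C) -> bddc g -> bddc (fun x => c x * g x).
Proof.
move=> mc cC [mg [M gM] g0]; split; first exact: measurable_funM.
  by exists (C * M) => x; rewrite normrM ler_pM.
by move=> x Lx; rewrite g0// mulr0.
Qed.

Lemma bddcZ n (c : R) (g : 'rV[R]_n -> R) : bddc g -> bddc (fun x => c * g x).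
Proof. by apply: (@bddc_mul _ (cst c) _ `|c|). Qed.

Lemma bddcD n (f g : 'rV[R]_n -> R) : bddc f -> bddc g -> bddc (fun x => f x + g x).
Proof.
move=> [mf [M fM] f0] [mg [M' gM] g0]; split; first exact: measurable_funD.
  by exists (M + M') => x; rewrite (le_trans (ler_normD _ _))// lerD.
by move=> x Lx; rewrite f0// g0// addr0.
Qed.

Lemma bddc_sum n (J : finType) (f : J -> 'rV[R]_n -> R) :
  (forall j, bddc (f j)) -> bddc (fun x => \sum_j f j x).
Proof.
move=> bf; suff : bddc (fun x => \sum_(j <- index_enum J) f j x) by [].
elim: (index_enum J) => [|j s IH].
  under eq_fun do rewrite big_nil.
  by split=> //; exists 0 => x; rewrite normr0.
by under eq_fun do rewrite big_cons; exact: bddcD.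
Qed.

Lemma bddc_sqr n (g : 'rV[R]_n -> R) : bddc g -> bddc (fun x => g x ^+ 2).
Proof.
move=> bg; have [mg [M gM] _] := bg.
by under eq_fun do rewrite expr2; exact: bddc_mul gM bg.
Qed.

Section line.
Context (n : nat).
Local Notation mu := (lebesgue_rV R n).
Local Notation muS := (lebesgue_rV R n.+1).
Local Notation cons a y := (@cons_rV R n ((a : measurableTypeR R), y)).
Implicit Types g : 'rV[R]_n.+1 -> R.

Lemma measurable_cons_line (y : 'rV[R]_n) : measurable_fun setT (fun a : measurableTypeR R => cons a y).
Proof.
apply: (measurableT_comp (@measurable_cons_rV R n)).
exact: measurable_pair2.
Qed.

Lemma cons_hd (a : R) (y : 'rV[R]_n) : cons a y ord0 ord0 = a.
Proof. by rewrite mxE unlift_none. Qed.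

Lemma bddc_line_integrable g (y : 'rV[R]_n) (D : set (measurableTypeR R)) :
  measurable D -> bddc g -> mu1.-integrable D (EFin \o (fun a : measurableTypeR R => g (cons a y))).
Proof.
move=> mD [mg [M gM] g0]; apply: (@integrableS _ _ _ mu1 setT) => //.
pose B : set (measurableTypeR R) := `[- L, L]%classic.
have mB : measurable B by exact: measurable_itv.
have muB : (mu1 B < +oo)%E.
  by rewrite /B lebesgue_measure_itv/=; case: ifP => _; rewrite -?EFinD ltry.
apply: (@le_integrable _ (measurableTypeR R) R mu1 setT _ _ (fun a => (M * \1_B a)%:E)) => //.
- by apply/measurable_EFinP; exact: (measurableT_comp mg (measurable_cons_line y)).
- move=> a _ /=; rewrite lee_fin indicE.
  have [|] := boolP (a \in _); first by rewrite mulr1 => _; apply: le_trans (gM _) (ler_norm _).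
  rewrite mem_setE in_itv/= -ler_norml => aL; rewrite g0 ?normr0//.
  by move=> /cubeP/(_ ord0); rewrite cons_hd (negbTE aL).
- apply: (@integrableZl _ _ _ _ _ _ M (fun x => (\1_B x)%:E)) => //.
  apply/integrableP; split; first exact/measurable_EFinP/measurable_indic.
  rewrite (eq_integral (fun x => (\1_B x)%:E)).
    by rewrite integral_indic// setIT.
  by move=> x _; rewrite gee0_abs// lee_fin.
Qed.

Definition lineint g (y : 'rV[R]_n) : R := \int[mu1]_a g (cons a y).

Lemma lineintE g y : bddc g ->
  (lineint g y)%:E = (\int[mu1]_a (g (cons a y))%:E)%E.
Proof.
move=> bg; rewrite /lineint /Rintegral fineK//.
by apply: integrable_fin_num => //; exact: bddc_line_integrable.
Qed.

Lemma bddc_lineint g : bddc g -> bddc (lineint g).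
Proof.
move=> bg; have [mg [M gM] g0] := bg; split.
- have me : measurable_fun setT (EFin \o g) by exact/measurable_EFinP.
  apply: measurableT_comp => //.
  under eq_fun do rewrite integralE.
  apply: emeasurable_funB.
    apply: (eq_measurable_fun (fun y => \int[mu1]_a ((EFin \o g)^\+ (cons a y)))%E); first by move=> y _; apply: eq_integral => a _; rewrite ?funeposE ?funenegE.
    by apply: measurable_line_rV => //; exact: measurable_funepos.
  apply: (eq_measurable_fun (fun y => \int[mu1]_a ((EFin \o g)^\- (cons a y)))%E); first by move=> y _; apply: eq_integral => a _; rewrite ?funeposE ?funenegE.
  by apply: measurable_line_rV => //; exact: measurable_funeneg.
- exists (M * (2 * L)) => y.
  pose B : set (measurableTypeR R) := `[- L, L]%classic.
  have mB : measurable B by exact: measurable_itv.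
  have muB : mu1 B = (2 * L)%:E.
    rewrite /B lebesgue_measure_itv/= lte_fin; case: ifPn => [_|].
      by rewrite -EFinD; congr EFin; ring.
    by rewrite -leNgt => LL; congr EFin; move: LL L0; lra.
  have iB : mu1.-integrable B (EFin \o (fun a : measurableTypeR R => g (cons a y))).
    exact: bddc_line_integrable.
  have -> : lineint g y = \int[mu1]_(a in B) g (cons a y).
    rewrite Rintegral_mkcond; apply: eq_Rintegral => a _; rewrite /patch.
    case: ifPn => //; rewrite /B mem_setE in_itv/= -ler_norml => aL.
    by rewrite g0// => /cubeP/(_ ord0); rewrite cons_hd (negbTE aL).
  apply: (le_trans (le_normr_Rintegral mB iB)).
  have <- : \int[mu1]_(a in B) (cst M a) = M * (2 * L).
    by rewrite (Rintegral_cst mu1 mB); congr (_ * _); exact: (congr1 fine muB).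
  apply: le_Rintegral => //.
    by have := integrable_abse iB; apply: eq_integrable.
  by apply: measurable_bounded_integrable => //; [apply: (@le_lt_trans _ _ (2 * L)%:E); [rewrite le_eqVlt (introT eqP muB)|exact: ltry]|exists `|M|; split => // K MK x _; exact: ltW].
- move=> y Ly; rewrite /lineint /Rintegral integral0_eq// => a _.
  by rewrite g0// => /cube_cons[].
Qed.

Lemma Rfubini g : bddc g -> \int[muS]_x g x = \int[mu]_y lineint g y.
Proof.
move=> bg; rewrite /Rintegral fubini_rV_swap; last exact: bddc_integrable.
by congr fine; apply: eq_integral => y _; rewrite lineintE.
Qed.

Definition cut k g (x : 'rV[R]_n.+1) : R := \1_(cell k) (x ord0 ord0) * g x.

Lemma bddc_cut k g : bddc g -> bddc (cut k g).
Proof.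
apply: (@bddc_mul _ _ _ 1).
  apply: (measurableT_comp (measurable_indic (measurable_cell k))).
  exact: measurable_coord.
by move=> x; rewrite ger0_norm// indicE; case: (_ \in _).
Qed.

Lemma lineint_cut k g y :
  lineint (cut k g) y = \int[mu1]_(a in cell k) g (cons a y).
Proof.
rewrite Rintegral_mkcond /lineint; apply: eq_Rintegral => a _.
rewrite /cut cons_hd indicE /patch; case: ifPn => _; by rewrite ?mul1r ?mul0r.
Qed.

Lemma sum_cut g x : bddc g -> \sum_(k < N) cut k g x = g x.
Proof.
move=> [_ _ g0]; rewrite -mulr_suml.
have [Lx|/g0 ->] := pselect (cube L x); last by rewrite mulr0.
by rewrite sum_indic_cell ?mul1r//; move/cubeP : Lx; exact.
Qed.

Lemma sum_lineint_cut g y : bddc g -> \sum_(k < N) lineint (cut k g) y = lineint g y.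
Proof.
move=> bg; rewrite -Rintegral_sum//.
  by apply: eq_Rintegral => a _; rewrite sum_cut.
by move=> k; apply: bddc_line_integrable => //; exact: bddc_cut.
Qed.

End line.

Lemma Rintegral_swap (I J : set (measurableTypeR R))
    (G : measurableTypeR R * measurableTypeR R -> R) (M : R) :
  measurable I -> measurable J -> (mu1 I < +oo)%E -> (mu1 J < +oo)%E ->
  measurable_fun setT G -> (forall z, 0 <= G z <= M) ->
  \int[mu1]_(a in I) \int[mu1]_(t in J) G (a, t) =
  \int[mu1]_(t in J) \int[mu1]_(a in I) G (a, t).
Proof.
move=> mI mJ fI fJ mG GM.
have G0 z : 0 <= G z by have /andP[] := GM z.
have bint (K : set (measurableTypeR R)) (g : measurableTypeR R -> R) :
    measurable K -> (mu1 K < +oo)%E -> measurable_fun setT g -> (forall a, 0 <= g a <= M) ->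
    (\int[mu1]_(a in K) g a)%:E = (\int[mu1]_(a in K) (g a)%:E)%E.
  move=> mK fK mg gM; rewrite /Rintegral fineK//; apply: integrable_fin_num => //.
  apply: measurable_bounded_integrable => //; first exact: measurable_funTS.
  exists M; split; first exact: num_real. move=> K' MK x _ /=; have /andP[g0 gM'] := gM x.
  by rewrite ger0_norm// (le_trans gM')// ltW.
rewrite /Rintegral; congr fine.
rewrite (eq_integral (fun a => \int[mu1]_(t in J) (G (a, t))%:E))%E; last first.
  move=> a _; apply: (bint J (fun t => G (a, t))) => //.
  exact: (measurableT_comp mG (measurable_pair1 a)).
rewrite [RHS](eq_integral (fun t => \int[mu1]_(a in I) (G (a, t))%:E))%E; last first.
  move=> t _; apply: (bint I (fun a => G (a, t))) => //.
  exact: (measurableT_comp mG (measurable_pair2 t)).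
pose H (z : measurableTypeR R * measurableTypeR R) : \bar R := (\1_I z.1 * \1_J z.2 * G z)%:E.
have mH : measurable_fun setT H.
  apply/measurable_EFinP; apply: measurable_funM => //; apply: measurable_funM.
    exact: (measurableT_comp (measurable_indic mI) measurable_fst).
  exact: (measurableT_comp (measurable_indic mJ) measurable_snd).
have H0 z : (0 <= H z)%E by rewrite lee_fin !mulr_ge0.
transitivity (\int[mu1]_a \int[mu1]_t H (a, t))%E.
  rewrite integral_mkcond; apply: eq_integral => a _; rewrite /H/= /patch.
  rewrite indicE; case: ifPn => aI.
    rewrite integral_mkcond; apply: eq_integral => t _; rewrite /patch indicE.
    by case: ifPn => _; rewrite ?mul1r ?mul0r.
  by apply/esym/integral0_eq => t _; rewrite !mul0r.
rewrite (@fubini_tonelli _ _ _ _ _ mu1 mu1 H mH H0).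
rewrite [RHS]integral_mkcond; apply: eq_integral => t _; rewrite /H/= /patch.
rewrite indicE; case: ifPn => aI.
  rewrite [RHS]integral_mkcond; apply: eq_integral => a _; rewrite /patch indicE.
  by case: ifPn => _; rewrite ?mulr1 ?mul1r ?mul0r.
by apply: integral0_eq => a _; rewrite mulr0 mul0r.
Qed.

Lemma integrable_Rintegral (I J : set (measurableTypeR R))
    (G : measurableTypeR R * measurableTypeR R -> R) (M : R) :
  measurable I -> measurable J -> (mu1 I < +oo)%E -> (mu1 J < +oo)%E ->
  measurable_fun setT G -> (forall z, 0 <= G z <= M) ->
  mu1.-integrable I (EFin \o (fun a => \int[mu1]_(t in J) G (a, t))).
Proof.
move=> mI mJ fI fJ mG GM.
have G0 z : 0 <= G z by have /andP[] := GM z.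
pose H (z : measurableTypeR R * measurableTypeR R) : \bar R := (\1_J z.2 * G z)%:E.
have mH : measurable_fun setT H.
  apply/measurable_EFinP; apply: measurable_funM => //.
  exact: (measurableT_comp (measurable_indic mJ) measurable_snd).
have H0 z : (0 <= H z)%E by rewrite lee_fin !mulr_ge0.
have HE a : (\int[mu1]_t H (a, t) = \int[mu1]_(t in J) (G (a, t))%:E)%E.
  rewrite [RHS]integral_mkcond; apply: eq_integral => t _; rewrite /H/= /patch indicE.
  by case: ifPn => _; rewrite ?mul1r ?mul0r.
have GJ a : (0 <= \int[mu1]_(t in J) (G (a, t))%:E <= M%:E * mu1 J)%E.
  rewrite integral_ge0/=; last by move=> t _; rewrite lee_fin.
  rewrite -integral_cst//; apply: ge0_le_integral => //.
  - by move=> t _; rewrite lee_fin.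
  - apply/measurable_EFinP/measurable_funTS.
    exact: (measurableT_comp mG (measurable_pair1 a)).
  - by move=> t _; rewrite lee_fin; have /andP[] := GM (a, t).
have M0 : 0 <= M by have /andP[? ?] := GM (0, 0); exact: le_trans (G0 (0, 0)) _.
have MJ : (M%:E * mu1 J)%E \is a fin_num.
  by rewrite fin_numM// ge0_fin_numE.
have ME a : (0 <= \int[mu1]_(t in J) G (a, t) <= fine (M%:E * mu1 J)).
  have /andP[h1 h2] := GJ a; rewrite /Rintegral fine_ge0//= fine_le//.
  by rewrite ge0_fin_numE// (le_lt_trans h2)// ltey_eq MJ.
apply: measurable_bounded_integrable => //; last first.
  exists (fine (M%:E * mu1 J)); split; first exact: num_real.
  move=> K MK a _ /=; have /andP[h1 h2] := ME a.
  by rewrite ger0_norm// (le_trans h2)// ltW.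
apply: measurable_funTS; apply: measurableT_comp => //.
have -> : (fun a => \int[mu1]_(t in J) (G (a, t))%:E)%E = (fun a => \int[mu1]_t H (a, t))%E.
  by apply/funext => a; rewrite HE.
exact: (@measurable_fun_fubini_tonelli_F _ _ _ _ _ mu1 H).
Qed.

(** For a smooth [v] and [D i] the square of its i-th partial derivative, this is Cauchy-Schwarz on
    a segment. As a property of a pair it also holds for partial integrals of [v], which need not be
    treated as smooth. *)
Definition cell_osc n (v : 'rV[R]_n -> R) (D : 'I_n -> 'rV[R]_n -> R) : Prop :=
  forall (i : 'I_n) k x s s', cell k s -> cell k s' ->
    (v (setc i s x) - v (setc i s' x)) ^+ 2 <=
      h * \int[mu1]_(t in cell k) D i (setc i t x).

(** The functions [chi j] are indicators of the small cubes, so the first sum involves only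
    integrals of [v] over cubes. Induction: [osc_Rintegral_le] on each cell of the first axis
    reduces [v] to its integrals over the cell, which are functions of the remaining coordinates. *)
Lemma cell_inequality n : exists (J : finType) (chi : J -> 'rV[R]_n -> R),
  (forall j, measurable_fun setT (chi j) /\ forall x, `|chi j x| <= 1) /\
  forall v D, bddc v -> (forall i, bddc (D i)) -> (forall i x, 0 <= D i x) ->
    cell_osc v D ->
    \int[lebesgue_rV R n]_x (v x ^+ 2) <=
      h ^- n * \sum_j (\int[lebesgue_rV R n]_x (chi j x * v x)) ^+ 2
      + h ^+ 2 * \sum_(i < n) \int[lebesgue_rV R n]_x D i x.
Proof.
elim: n => [|n [J [chi [Pchi IH]]]].
  (* In dimension 0 the space is one point, and both sides are the square of the value there. *)
  exists unit, (fun _ => cst 1); split.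
    by move=> _; split => [|x]; [exact: measurable_cst|rewrite /= normr1].
  move=> v D _ _ _ _.
  have int0 (g : 'rV[R]_0 -> R) : \int[lebesgue_rV R 0]_x g x = g 0.
    have {1}-> : g = cst (g 0) by apply/funext => x; rewrite (thinmx0 x).
    rewrite Rintegral_cst// -[RHS]mulr1; congr (_ * _).
    have d1 : lebesgue_rV R 0 setT = 1%E by exact: diracT.
    exact: (congr1 fine d1).
  rewrite !int0 big_ord0 mulr0 addr0 expr0 invr1 mul1r.
  rewrite (bigD1 tt)//= big1 ?addr0; last by case.
  by rewrite mul1r.
pose chi' (kj : 'I_N * J) (x : 'rV[R]_n.+1) : R :=
  \1_(cell kj.1) (x ord0 ord0) * chi kj.2 (uncons_rV x).2.
have Pchi' kj : measurable_fun setT (chi' kj) /\ forall x, `|chi' kj x| <= 1.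
  case: kj => k j; split.
    apply: measurable_funM.
      exact: (measurableT_comp (measurable_indic (measurable_cell k)) (measurable_coord ord0)).
    apply: (measurableT_comp (Pchi j).1).
    exact: (measurableT_comp measurable_snd (@measurable_uncons_rV R n)).
  move=> x; rewrite normrM mulr_ile1 ?(Pchi j).2//.
  by rewrite ger0_norm// indicE; case: (_ \in _).
exists ('I_N * J)%type, chi'; split=> //.
move=> v D bv bD D0 osc.
pose mu := lebesgue_rV R n.
pose V k := lineint (cut k v).
(* Integrating over a cell brings one factor h from Jensen and one from the oscillation of [v];
   [cell_osc] already has one of them, and [E] takes the other. *)
pose E (k : nat) (i : 'I_n) y := h * lineint (cut k (D (lift ord0 i))) y.
have bV k : bddc (V k) by exact/bddc_lineint/bddc_cut.
have bL k i : bddc (lineint (cut k (D i))) by exact/bddc_lineint/bddc_cut.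
have bE k i : bddc (E k i).
  by apply: (@bddc_mul _ (cst h) _ `|h|) => //.
have L_ge0 k i y : 0 <= lineint (cut k (D i)) y.
  by apply: Rintegral_ge0 => a _; rewrite mulr_ge0.
have E_ge0 k i y : 0 <= E k i y by rewrite mulr_ge0 ?(ltW h0).
have oscV k : cell_osc (V k) (E k).
  move=> i m y s s' ms ms'.
  have mk := measurable_cell k; have mm := measurable_cell m.
  have fk : (mu1 (cell k) < +oo)%E by rewrite lebesgue_cell ltry.
  have fm : (mu1 (cell m) < +oo)%E by rewrite lebesgue_cell ltry.
  pose G (z : measurableTypeR R * measurableTypeR R) :=
    D (lift ord0 i) (cons_rV (z.1, setc i z.2 y)).
  have [mD [M DM] _] := bD (lift ord0 i).
  have mG : measurable_fun setT G.
    apply: (measurableT_comp mD); apply: measurable_fun_rV => j.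
    have [j' ->|->] := unliftP ord0 j.
      have -> : (fun t : measurableTypeR R * measurableTypeR R =>
          cons_rV (t.1, setc i t.2 y) ord0 (lift ord0 j')) =
        (fun t => if j' == i then t.2 else y ord0 j').
        by apply/funext => t; rewrite mxE liftK /= mxE.
      by case: (j' == i); [exact: measurable_snd|exact: measurable_cst].
    have -> : (fun t : measurableTypeR R * measurableTypeR R =>
        cons_rV (t.1, setc i t.2 y) ord0 ord0) = fst.
      by apply/funext => t; rewrite mxE unlift_none.
    exact: measurable_fst.
  have GM z : 0 <= G z <= M by rewrite D0 (le_trans (ler_norm _) (DM _)).
  have iv z : mu1.-integrable (cell k) (EFin \o (fun a : measurableTypeR R => v (cons_rV (a, z)))).
    exact: bddc_line_integrable.
  rewrite /V !lineint_cut -(RintegralB mk (iv _) (iv _)).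
  have iw := integrableB mk (iv (setc i s y)) (iv (setc i s' y)).
  have iw2 : mu1.-integrable (cell k) (EFin \o (fun a : measurableTypeR R =>
      (v (cons_rV (a, setc i s y)) - v (cons_rV (a, setc i s' y))) ^+ 2)).
    have [mv [Mv vM] _] := bv.
    apply: measurable_bounded_integrable => //.
      by apply: measurable_funX; apply: measurable_funB; apply: measurable_funTS;
        exact: (measurableT_comp mv (measurable_cons_line _)).
    exists ((Mv + Mv) ^+ 2); split; first exact: num_real.
    move=> K MK a _ /=; rewrite ger0_norm ?sqr_ge0// (le_trans _ (ltW MK))//.
    rewrite -real_normK ?num_real// ler_pXn2r ?nnegrE// ?(le_trans (ler_normB _ _)) ?lerD//.
    by rewrite addr_ge0// (le_trans _ (vM 0)).
  apply: (le_trans (sqr_Rintegral_le mk h0 (lebesgue_cell k) iw iw2)).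
  rewrite ler_pM2l//.
  have iG := integrable_Rintegral mk mm fk fm mG GM.
  apply: (@le_trans _ _ (\int[mu1]_(a in cell k) (h * \int[mu1]_(t in cell m) G (a, t)))).
    apply: le_Rintegral => //.
      exact: (@integrableZl _ _ _ _ _ mk h _ iG).
    move=> a _; rewrite -!setc_consS; apply: (le_trans (osc _ _ _ _ _ ms ms')).
    rewrite ler_pM2l// le_eqVlt; apply/orP; left; apply/eqP; apply: eq_Rintegral => t _.
    by rewrite setc_consS.
  rewrite (RintegralZl h mk iG) (Rintegral_swap mk mm fk fm mG GM).
  rewrite -(RintegralZl h mm); last first.
    apply: (@integrable_Rintegral (cell m) (cell k) (fun z => G (z.2, z.1)) M) => //.
    by apply: (measurableT_comp mG); apply: measurable_fun_pair;
      [exact: measurable_snd|exact: measurable_fst].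
  rewrite le_eqVlt; apply/orP; left; apply/eqP; apply: eq_Rintegral => t _.
  by rewrite /E lineint_cut.
have bv2 := bddc_sqr bv.
have step1 y : lineint (fun x => v x ^+ 2) y <=
    \sum_(k < N) (h^-1 * V k y ^+ 2 + h ^+ 2 * lineint (cut k (D ord0)) y).
  rewrite -(sum_lineint_cut y bv2); apply: ler_sum => k _.
  rewrite /V !lineint_cut; have mk := measurable_cell k.
  apply: (osc_Rintegral_le mk h0 (lebesgue_cell k)).
  - by apply: Rintegral_ge0 => t _; exact: D0.
  - exact: bddc_line_integrable.
  - exact: (@bddc_line_integrable _ (fun x => v x ^+ 2)).
  move=> s s' ks ks'; have := osc ord0 k (cons_rV ((0 : measurableTypeR R), y)) s s' ks ks'.
  rewrite !setc_cons0 => /le_trans; apply.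
  rewrite ler_pM2l// le_eqVlt; apply/orP; left; apply/eqP; apply: eq_Rintegral => t _.
  by rewrite setc_cons0.
have sumD i : \sum_(k < N) \int[lebesgue_rV R n.+1]_x cut k (D i) x =
    \int[lebesgue_rV R n.+1]_x D i x.
  rewrite -Rintegral_sum//; first by apply: eq_Rintegral => x _; rewrite sum_cut.
  by move=> k; apply/bddc_integrable/bddc_cut.
have step2 : \int[lebesgue_rV R n.+1]_x (v x ^+ 2) <=
    \sum_(k < N) (h^-1 * \int[mu]_y (V k y ^+ 2)) + h ^+ 2 * \int[lebesgue_rV R n.+1]_x D ord0 x.
  rewrite (Rfubini bv2).
  have bT (k : 'I_N) : bddc (fun y => h^-1 * V k y ^+ 2 + h ^+ 2 * lineint (cut k (D ord0)) y).
    by apply: bddcD; apply: bddcZ => //; exact: bddc_sqr.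
  apply: (@le_trans _ _ (\int[mu]_y
     \sum_(k < N) (h^-1 * V k y ^+ 2 + h ^+ 2 * lineint (cut k (D ord0)) y))).
    apply: le_Rintegral => //; first exact/bddc_integrable/bddc_lineint.
    exact/bddc_integrable/bddc_sum.
  rewrite Rintegral_sum//; last by move=> k; exact: bddc_integrable.
  rewrite -(sumD ord0) mulr_sumr -big_split/= le_eqVlt; apply/orP; left; apply/eqP.
  apply: eq_bigr => k _; rewrite RintegralD//; last 2 first.
  - by apply: bddc_integrable; apply: bddcZ; exact: bddc_sqr.
  - by apply: bddc_integrable; exact: bddcZ.
  rewrite (RintegralZl h^-1 measurableT (bddc_integrable (bddc_sqr (bV k)))).
  rewrite (RintegralZl (h ^+ 2) measurableT (bddc_integrable (bL k ord0))).
  by rewrite -(Rfubini (bddc_cut _ _)).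
(* The factor h inside the last sum cancels against the h^-1 of [step2], so every direction ends
   with the same weight h^2. *)
have step3 (k : 'I_N) : \int[mu]_y (V k y ^+ 2) <=
    h ^- n * (\sum_j (\int[lebesgue_rV R n.+1]_x (chi' (k, j) x * v x)) ^+ 2) +
    h ^+ 2 * \sum_(i < n) h * \int[lebesgue_rV R n.+1]_x cut k (D (lift ord0 i)) x.
  apply: (le_trans (IH (V k) (E k) (bV k) (bE k) (E_ge0 k) (oscV k))).
  rewrite le_eqVlt; apply/orP; left; apply/eqP; congr (_ * _ + _ * _).
    apply: eq_bigr => j _; congr (_ ^+ 2).
    rewrite Rfubini; last first.
      by have [mc c1] := Pchi' (k, j); exact: bddc_mul mc c1 bv.
    apply: eq_Rintegral => y _.
    rewrite /V lineint_cut.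
    rewrite -(RintegralZl (chi j y) (measurable_cell k) (bddc_line_integrable y (measurable_cell k) bv)).
    rewrite Rintegral_mkcond; apply: eq_Rintegral => a _; rewrite /patch /chi' cons_rVK cons_hd /=.
    by rewrite indicE; case: ifPn => _; rewrite ?mul1r ?mul0r.
  apply: eq_bigr => i _.
  rewrite (RintegralZl h measurableT (bddc_integrable (bL k (lift ord0 i)))).
  by rewrite -(Rfubini (bddc_cut _ _)).
apply: (le_trans step2).
rewrite big_ord_recl mulrDr [X in _ <= _ + X]addrC addrA lerD2r.
apply: (@le_trans _ _ (\sum_(k < N) h^-1 * (h ^- n * (\sum_j (\int[lebesgue_rV R n.+1]_x (chi' (k, j) x * v x)) ^+ 2) +
    h ^+ 2 * \sum_(i < n) h * \int[lebesgue_rV R n.+1]_x cut k (D (lift ord0 i)) x))).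
  by apply: ler_sum => k _; rewrite ler_pM2l ?invr_gt0.
rewrite le_eqVlt; apply/orP; left; apply/eqP.
under eq_bigr do rewrite mulrDr.
rewrite big_split/=; congr (_ + _).
  rewrite -mulr_sumr -mulr_sumr mulrA -invfM -exprS; congr (_ * _).
  by rewrite pair_big/=; apply: eq_bigr => -[].
under [in RHS]eq_bigr do rewrite -sumD.
rewrite exchange_big/= mulr_sumr; apply: eq_bigr => k _.
rewrite -mulr_sumr mulrCA; congr (_ * _).
by rewrite mulrA mulVf ?mul1r// gt_eqF.
Qed.

End cells.

(** * Compactness of the embedding and the first eigenvalue *)

Section rellich.
Context (R : realType) (n : nat) (Omega : set 'rV[R]_n).
Hypotheses (oO : open Omega) (bO : bounded_set Omega).
Local Notation mu := (lebesgue_rV R n).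
Local Notation mu1 := (@lebesgue_measure R).
Local Notation test := (test_function Omega).
Implicit Types (phi v : 'rV[R]_n -> R).

Let mO : measurable Omega. Proof. exact: domain_measurable. Qed.
Let si2 := l2_semi_inner mO.

(** The increment is an integral over [s', s], squared by Jensen; the domain of integration is then
    enlarged to a whole cell. *)
Lemma sqr_increment_le (H h : R -> R) (s s' e : R) (D : set (measurableTypeR R)) :
  (forall t : R, is_derive t 1 H (h t)) -> continuous h -> (exists M, forall t, `|h t| <= M) ->
  measurable D -> (mu1 D < +oo)%E -> s' <= s -> s - s' <= e -> `[s', s]%classic `<=` D ->
  (H s - H s') ^+ 2 <= e * \int[mu1]_(t in D) (h t ^+ 2).
Proof.
move=> dH ch [M hM] mD fD s's se sD.
have mh : measurable_fun setT h by exact: continuous_measurable_fun.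
have I0 : 0 <= \int[mu1]_(t in D) (h t ^+ 2) by apply: Rintegral_ge0 => t _; exact: sqr_ge0.
move: s's; rewrite le_eqVlt => /predU1P[s's|s's].
  by rewrite s's subrr expr0n mulr_ge0//; move: se; rewrite s's subrr.
have bint (K : set (measurableTypeR R)) (g : measurableTypeR R -> R) C :
    measurable K -> (mu1 K < +oo)%E -> measurable_fun setT g -> (forall a, `|g a| <= C) ->
    mu1.-integrable K (EFin \o g).
  move=> mK fK mg gC; apply: measurable_bounded_integrable => //; first exact: measurable_funTS.
  exists C; split; first exact: num_real.
  by move=> C' CC' x _ /=; rewrite (le_trans (gC x))// ltW.
have h2M t : `|h t ^+ 2| <= M ^+ 2.
  rewrite ger0_norm ?sqr_ge0// -real_normK ?num_real// ler_pXn2r ?nnegrE//.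
  exact: le_trans (hM t).
have mh2 : measurable_fun setT (fun t => h t ^+ 2) by exact: measurable_funX.
pose K : set (measurableTypeR R) := `[s', s]%classic.
have mK : measurable K by exact: measurable_itv.
have muK : mu1 K = (s - s')%:E by rewrite /K lebesgue_measure_itv/= lte_fin s's -EFinD.
have fK : (mu1 K < +oo)%E by rewrite muK ltry.
have ih := bint K h M mK fK mh hM.
have ih2 := bint K (fun t => h t ^+ 2) _ mK fK mh2 h2M.
have ihD := bint D (fun t => h t ^+ 2) _ mD fD mh2 h2M.
have FT : \int[mu1]_(t in K) h t = H s - H s'.
  by rewrite /Rintegral (FTC_segment (ltW s's) dH ch).
rewrite -FT; apply: (le_trans (sqr_Rintegral_le mK _ muK ih ih2)); first by rewrite subr_gt0.
have KD : \int[mu1]_(t in K) (h t ^+ 2) <= \int[mu1]_(t in D) (h t ^+ 2).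
  rewrite /Rintegral fine_le ?(integrable_fin_num mK ih2) ?(integrable_fin_num mD ihD)//.
  apply: ge0_subset_integral => //.
    by apply/measurable_EFinP; exact: measurable_funTS.
  by move=> t _; rewrite lee_fin sqr_ge0.
apply: ler_pM => //; first by rewrite subr_ge0 ltW.
by apply: Rintegral_ge0 => t _; exact: sqr_ge0.
Qed.

Lemma Rintegral_out (g : 'rV[R]_n -> R) : (forall x, ~ Omega x -> g x = 0) ->
  \int[mu]_x g x = \int[mu]_(x in Omega) g x.
Proof.
move=> g0; rewrite [RHS]Rintegral_mkcond; apply: eq_Rintegral => x _; rewrite /patch.
by case: ifPn => //; rewrite notin_setE => /g0.
Qed.

Lemma cell_inequality_test (e : R) : 0 < e -> exists (J : finType) (chi : J -> 'rV[R]_n -> R) (A : R),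
  [/\ 0 <= A, forall j, L2 Omega (chi j) &
  forall phi, test phi -> l2dot Omega phi phi <=
    A * \sum_j (l2dot Omega phi (chi j)) ^+ 2 + e * graddot Omega phi phi].
Proof.
move=> e0; have [L L0 OL] := domain_cube bO.
(* The number of cells exceeds (2L + 1)/sqrt(e), so the side h is below sqrt(e) and the gradient
   term has weight at most e. *)
pose N := (Num.truncn ((2 * L + 1) / Num.sqrt e)).+1.
pose h := (2 * L + 1) / N%:R.
have h0 : 0 < h by rewrite divr_gt0//; lra.
have Nh : N%:R * h = 2 * L + 1 by rewrite /h mulrCA divff ?mulr1// pnatr_eq0.
have he : h ^+ 2 <= e.
  have se : 0 < Num.sqrt e by rewrite sqrtr_gt0.
  rewrite -[leRHS](sqr_sqrtr (ltW e0)) ler_pXn2r ?nnegrE ?(ltW h0) ?(ltW se)//.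
  rewrite /h ler_pdivrMr// [leRHS]mulrC -ler_pdivrMr//; apply: ltW.
  exact: (archimedean.Num.Theory.truncnS_gt).
have [J [chi [Pchi H]]] := cell_inequality (ltW L0) h0 Nh n.
exists J, chi, (h ^- n); split.
- by rewrite invr_ge0 exprn_ge0// ltW.
- move=> j; apply: (@L2_bounded _ _ _ oO bO _ 1); first exact: measurable_funS (Pchi j).1.
  by move=> x _; exact: (Pchi j).2.
move=> phi tp.
have btest psi : test psi -> bddc L psi.
  move=> ts; split; first exact: (test_measurable ts).
    by have [M _ HM] := test_bounded ts; exists M.
  by move=> x Lx; apply: (test_out ts) => /OL.
have := H phi (fun i x => partial i phi x ^+ 2) (btest _ tp) _ _ _.
rewrite Rintegral_out; last by move=> x Ox; rewrite (test_out tp Ox) expr0n.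
move=> H1; apply: (le_trans (H1 _ _ _)).
- by move=> i; apply: bddc_sqr; exact/btest/test_partial.
- by move=> i x; exact: sqr_ge0.
- move=> i k x s s' ks ks'.
  have tip := test_partial i tp.
  have dH (t : R) : is_derive t 1 (fun t => phi (setc i t x)) (partial i phi (setc i t x)).
    rewrite (_ : (fun t => _) = fun t => phi (t *: delta_mx ord0 i + setc i 0 x)).
      rewrite (setcE i t); apply: is_derive_line; apply: smooth_is_derive; exact: (test_smooth tp).
    by apply/funext => u; rewrite -setcE.
  have cH : continuous (fun t : R => partial i phi (setc i t x)).
    rewrite (_ : (fun t => _) = fun t => partial i phi (t *: delta_mx ord0 i + setc i 0 x)).
      move=> t; apply: continuous_comp; last exact: (test_continuous tip).
      by apply: cvgD; [apply: cvgZl; exact: cvg_id|exact: cvg_cst].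
    by apply/funext => u; rewrite -setcE.
  have bH : exists M, forall t, `|partial i phi (setc i t x)| <= M.
    by have [M _ HM] := test_bounded tip; exists M => t.
  have mk := measurable_cell L h k.
  have fk : (mu1 (cell L h k) < +oo)%E by rewrite lebesgue_cell// ltry.
  have inc (a b : R) : cell L h k a -> cell L h k b -> b <= a ->
      (phi (setc i a x) - phi (setc i b x)) ^+ 2 <=
      h * \int[mu1]_(t in cell L h k) (partial i phi (setc i t x) ^+ 2).
    rewrite /cell /= !in_itv/= => /andP[ka ka'] /andP[kb kb'] ba.
    apply: (@sqr_increment_le (fun t => phi (setc i t x)) (fun t => partial i phi (setc i t x)) a b h _ dH cH bH mk fk ba).
      by move: ka' kb; rewrite -natr1; lra.
    move=> t; rewrite /= !in_itv/= => /andP[bt ta].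
    by apply/andP; split; [exact: le_trans kb bt|exact: le_lt_trans ta ka'].
  have [ss'|/ltW ss'] := leP s' s; first exact: inc.
  by rewrite -sqrrN opprB; exact: inc.
apply: lerD.
  rewrite le_eqVlt; apply/orP; left; apply/eqP; congr (_ * _); apply: eq_bigr => j _.
  rewrite Rintegral_out; last by move=> x Ox; rewrite (test_out tp Ox) mulr0.
  by congr (_ ^+ 2); apply: eq_Rintegral => x _; rewrite mulrC.
rewrite graddot_test//; apply: ler_pM => //; first by rewrite sqr_ge0.
  by apply: sumr_ge0 => i _; apply: Rintegral_ge0 => x _; exact: sqr_ge0.
apply: ler_sum => i _; rewrite Rintegral_out; last first.
  by move=> x Ox; rewrite (test_out (test_partial i tp) Ox) expr0n.
by rewrite le_eqVlt; apply/orP; left; apply/eqP; apply: eq_Rintegral => x _; rewrite expr2.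
Qed.
Local Opaque Rintegral l2dot l2norm graddot h1norm.

Let si1 := h1_semi_inner oO bO.
Let sig := grad_semi_inner_H01 oO bO.

Lemma si_le2 (V : lmodType R) (X : V -> Prop) (B : V -> V -> R) u w : semi_inner X B ->
  X u -> X w -> B u u <= 2 * B w w + 2 * B (w - u) (w - u).
Proof.
move=> siB Xu Xw.
have p := parallelogram siB Xw (siB_ siB Xw Xu).
have := si_ge0 siB (siD siB Xw (siB_ siB Xw Xu)).
by move: p; rewrite (_ : w - (w - u) = u) ?opprB 1?addrC ?subrK//; lra.
Qed.

Lemma si_CS_sqr (V : lmodType R) (X : V -> Prop) (B : V -> V -> R) (u v : V) :
  semi_inner X B -> X u -> X v -> B u v ^+ 2 <= B v v * B u u.
Proof.
move=> siB Xu Xv; rewrite -(sqr_nB siB Xu) -(sqr_nB siB Xv) -exprMn -real_normK ?num_real//.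
by rewrite ler_pXn2r ?nnegrE ?mulr_ge0 ?nB_ge0// mulrC; exact: (si_CS siB Xu Xv).
Qed.

Lemma sqrD_le (a b c : R) : b ^+ 2 <= c -> (a + b) ^+ 2 <= 2 * a ^+ 2 + 2 * c.
Proof. by move=> bc; have := sqr_ge0 (a - b); lra. Qed.

Lemma compact_bound (A e q S1 S2 S3 x1 x2 x3 y1 y2 y3 : R) :
  x1 <= 2 * x2 + 2 * x3 -> x2 <= A * S2 + e / 4 * y2 ->
  A * S2 <= A * (2 * S1 + 2 * S3 * q) -> e / 4 * y2 <= e / 4 * (2 * y1 + 2 * y3) ->
  e / 4 * y3 <= e / 4 * q -> x3 <= q -> x1 <= 4 * A * S1 + e * y1 + (4 * A * S3 + e + 2) * q.
Proof. lra. Qed.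

(** The inequality for test functions passes to [H01] by approximation. The functionals are
    continuous for the [L2] norm, so no subsequence is involved. *)
Lemma h1_compact (e : R) : 0 < e ->
  exists (J : finType) (F : J -> ('rV[R]_n -> R) -> R) (C : R),
  [/\ forall j u v, H01 Omega u -> H01 Omega v -> F j (u - v) = F j u - F j v,
      forall j v, H01 Omega v -> `|F j v| <= C * seminorm_of (l2dot Omega) v &
      forall v, H01 Omega v -> l2dot Omega v v <= \sum_j F j v ^+ 2 + e * graddot Omega v v].
Proof.
move=> e0; have [|J [chi [A [A0 Lchi HA]]]] := @cell_inequality_test (e / 4); first by lra.
(* Replacing [v] by an approximant and back costs a factor 2 each way. Hence 4A here, absorbed into
   the functionals, and the choice of e/4 in the test-function inequality. *)
pose s := Num.sqrt (4 * A).
have s0 : 0 <= s by exact: sqrtr_ge0.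
have s2 : s ^+ 2 = 4 * A by rewrite sqr_sqrtr// mulr_ge0.
pose nchi j := l2norm Omega (chi j).
exists J, (fun j v => s * l2dot Omega v (chi j)), (s * \sum_j nchi j); split.
- move=> j u v Hu Hv.
  by rewrite (siBl si2 (H01_L2 Hu) (H01_L2 Hv) (Lchi j)) mulrBr.
- move=> j v Hv; rewrite normrM (ger0_norm s0) -mulrA ler_wpM2l//.
  apply: (le_trans (si_CS si2 (H01_L2 Hv) (Lchi j))).
  rewrite mulrC ler_wpM2r ?nB_ge0// (bigD1 j)//= lerDl.
  by apply: sumr_ge0 => i _; exact: l2norm_ge0.
move=> v Hv; have [Hv1 vP] := (H01P Omega v).1 Hv.
pose C := 4 * A * (\sum_j nchi j ^+ 2) + e + 2.
have C0 : 0 < C.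
  have : 0 <= \sum_j nchi j ^+ 2 by apply: sumr_ge0 => j _; exact: sqr_ge0.
  by move=> /(mulr_ge0 A0); rewrite /C; move: e0; lra.
apply/ler_addgt0Pr => d d0.
have eta0 : 0 < Num.sqrt (d / C) by rewrite sqrtr_gt0 divr_gt0.
have [phi tp pv] := vP _ eta0; set eta := Num.sqrt _ in eta0 pv.
have Hp := test_H01 oO bO tp.
have Hd : H01 Omega (phi - v) by exact: (siB_ si1 Hp Hv).
have e2 : C * eta ^+ 2 = d.
  by rewrite sqr_sqrtr ?divr_ge0 ?ltW// mulrC divfK// gt_eqF.
have sq (x : R) : 0 <= x -> x <= h1norm Omega (phi - v) -> x ^+ 2 <= eta ^+ 2.
  by move=> x0 xh; rewrite ler_pXn2r ?nnegrE ?(ltW eta0)// (le_trans xh)// ltW.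
have l2d : l2dot Omega (phi - v) (phi - v) <= eta ^+ 2.
  rewrite -(sqr_nB si2 (H01_L2 Hd)); apply: sq; first exact: nB_ge0.
  exact: (l2norm_le_h1norm oO bO (H01_H1 Hd)).
have gd : graddot Omega (phi - v) (phi - v) <= eta ^+ 2.
  rewrite -(sqr_nB sig Hd); apply: sq; first exact: nB_ge0.
  exact: (gradnorm_le_h1norm oO bO (H01_H1 Hd)).
have h1 := si_le2 si2 (H01_L2 Hv) (H01_L2 Hp).
have h2 := si_le2 sig Hp Hv.
have gdC : graddot Omega (v - phi) (v - phi) = graddot Omega (phi - v) (phi - v).
  have Hd' := siB_ si1 Hv Hp.
  by rewrite -(sqr_nB sig Hd) -(sqr_nB sig Hd') (nBC sig Hv Hp).
have h3 := HA phi tp.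
have h4 : \sum_j l2dot Omega phi (chi j) ^+ 2 <=
    2 * (\sum_j l2dot Omega v (chi j) ^+ 2) + 2 * (\sum_j nchi j ^+ 2) * eta ^+ 2.
  rewrite -mulrA mulr_suml !mulr_sumr -big_split/=; apply: ler_sum => j _.
  have -> : l2dot Omega phi (chi j) = l2dot Omega v (chi j) + l2dot Omega (phi - v) (chi j).
    by rewrite (siBl si2 (H01_L2 Hp) (H01_L2 Hv) (Lchi j)) addrC subrK.
  have CS : l2dot Omega (phi - v) (chi j) ^+ 2 <= nchi j ^+ 2 * eta ^+ 2.
    apply: (le_trans (si_CS_sqr si2 (H01_L2 Hd) (Lchi j))).
    rewrite /nchi (sqr_l2norm oO (Lchi j)); apply: (ler_wpM2l _ l2d).
    exact: (si_ge0 si2 (Lchi j)).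
  exact: (sqrD_le _ CS).
have -> : \sum_j (s * l2dot Omega v (chi j)) ^+ 2 = 4 * A * \sum_j l2dot Omega v (chi j) ^+ 2.
  by rewrite mulr_sumr; apply: eq_bigr => j _; rewrite exprMn s2.
rewrite gdC in h2; rewrite -e2 /C.
have h5 := ler_wpM2l A0 h4.
have e4 : 0 <= e / 4 by rewrite divr_ge0 ?(ltW e0).
have h6 := ler_wpM2l e4 h2.
have h7 := ler_wpM2l e4 gd.
exact: (compact_bound h1 h3 h5 h6 h7 l2d).
Qed.

(** The minimum of the Rayleigh quotient is attained and is itself an eigenvalue, hence not below
    the least one. Positivity is the Poincare inequality. *)
Lemma first_eigenvalue_le (lambda : R) : (0 < n)%N -> first_dirichlet_eigenvalue Omega lambda ->
  0 < lambda /\ forall v, H01 Omega v -> lambda * l2dot Omega v v <= graddot Omega v v.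
Proof.
move=> n0 [[w [Hw wn0 wE]] lmin].
have Lw := H01_L2 Hw.
have nw0 : 0 < l2norm Omega w.
  rewrite lt_neqAle l2norm_ge0 andbT; apply/eqP => /esym w0.
  by apply: wn0; exact: (l2norm_eq0_ae mO Lw w0).
have lw0 : 0 < l2dot Omega w w by rewrite -(sqr_nB si2 Lw) exprn_gt0.
split.
  have [K K0 KP] := poincare oO bO n0.
  have gw : 0 < graddot Omega w w.
    rewrite -(sqr_nB sig Hw) exprn_gt0// -(pmulr_rgt0 _ K0).
    exact: lt_le_trans (KP _ Hw).
  by move: gw; rewrite (wE _ Hw) pmulr_lgt0.
have sil : semi_inner (H01 Omega) (l2dot Omega).
  apply: (semi_inner_sub _ (si0 si1) _ si2); first by move=> v /H01_L2.
  by move=> a u v; exact: (siP si1).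
have [||Lam [v [Hv lv vE Lmin]]] := rayleigh_attained sil sig _ h1_compact.
- move=> v Hv dv.
  have [||z [Hz cz _]] := @H01_complete _ _ _ oO bO v => //.
    by move=> k; rewrite (h1norm_seminorm oO (siB_ si1 (Hv _) (Hv _))); exact: dv.
  exists z => //; rewrite (_ : (fun k => _) = fun k => h1norm Omega (v k - z)) //.
  by apply/funext => k; rewrite (h1norm_seminorm oO (siB_ si1 (Hv _) Hz)).
- by exists w.
move=> u Hu; apply: le_trans (Lmin u Hu); rewrite ler_wpM2r ?(si_ge0 sil Hu)//.
apply: lmin; exists v; split=> // v0.
have Lv := H01_L2 Hv; have [mv _] := Lv.
have := l2norm_ae0 mO mv v0 => nv0; move: lv.
by rewrite -(sqr_nB si2 Lv) -l2norm_seminorm nv0 expr0n ltxx.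
Qed.

End rellich.

(** * The nonlinear terms *)

Section primitive.
Context (R : realType) (f : R -> R).
Local Notation mu1 := (@lebesgue_measure R).
Hypothesis cf : continuous f.

Lemma continuous_itv_integrable (a b : R) : mu1.-integrable `[a, b] (EFin \o f).
Proof.
apply: continuous_compact_integrable; first exact: segment_compact.
exact: continuous_subspaceT.
Qed.

Lemma Rintegral_segmentB (a x y : R) : a <= x -> x <= y ->
  \int[mu1]_(t in `[a, y]) f t - \int[mu1]_(t in `[a, x]) f t = \int[mu1]_(t in `[x, y]) f t.
Proof.
move=> ax xy; rewrite Rintegral_itvB ?bnd_simp//; last exact: continuous_itv_integrable.
rewrite Rintegral_itv_obnd_cbnd//.
apply: (integrableS _ _ _ (continuous_itv_integrable x y)) => //.
exact: subset_itv_oc_cc.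
Qed.

(** A fixed base point to the left of 0 and y merges the two signs of the oriented integral, so that
    one application of the fundamental theorem covers every s. *)
Lemma primitive_itv (a y : R) : a <= 0 -> a <= y ->
  primitive f y = \int[mu1]_(t in `[a, y]) f t - \int[mu1]_(t in `[a, 0]) f t.
Proof.
move=> a0 ay; rewrite /primitive; case: ifPn => [y0|].
  by rewrite Rintegral_segmentB.
by rewrite -ltNge => /ltW y0; rewrite -opprB Rintegral_segmentB.
Qed.

Lemma is_derive_primitive (s : R) : is_derive s 1 (primitive f) (f s).
Proof.
pose a := Num.min 0 s - 1.
have a0 : a < 0 by rewrite /a; case: (leP 0 s) => ?; lra.
have as_ : a < s by rewrite /a; case: (leP 0 s) => ?; lra.
pose G x := \int[mu1]_(t in `[a, x]) f t.
have ss1 : s < s + 1 by rewrite ltrDl.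
have [dG GE] := continuous_FTC1_closed ss1 (continuous_itv_integrable a (s + 1)) as_ (cf (x := s)).
have dG' : is_derive s 1 G (f s) by move: dG GE; rewrite derive1E => ? <-; exact: derivableP.
have dH : is_derive s 1 (fun y => G y - G 0) (f s).
  by apply: is_derive_eq; rewrite subr0.
apply: near_eq_is_derive dH.
near=> y; rewrite (@primitive_itv a)//; first exact: ltW.
by apply: ltW; near: y; exact: lt_nbhsr.
Unshelve. all: by end_near. Qed.

End primitive.

Lemma mean_value (R : realType) (f df : R -> R) (a b : R) :
  (forall x : R, is_derive x 1 f (df x)) ->
  exists2 c, Num.min a b <= c <= Num.max a b & f b - f a = df c * (b - a).
Proof.
move=> fd.
have cf (x : R) : {for x, continuous f}.
  by apply/differentiable_continuous/derivable1_diffP; have [] := fd x.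
have cfw a' b' : {within `[a', b'], continuous f} by apply: continuous_subspaceT => x; exact: cf.
have [ab|ba] := leP a b.
  have [c] := MVT_segment ab (fun x _ => fd x) (cfw _ _).
  by rewrite in_itv/= => cab E; exists c.
have [c] := MVT_segment (ltW ba) (fun x _ => fd x) (cfw _ _).
rewrite in_itv/= => cab E; exists c => //.
by rewrite -opprB E -mulrN opprB.
Qed.

Section growth.
Context (R : realType) (f : R -> R).
Hypothesis C1f : C1_fun f.
Context (k0 k1 l1 : R).
Hypotheses (hk0 : 0 < k0) (hk1 : 0 < k1) (hl1 : 0 < l1).
Hypothesis df_le : forall s : R, `|derive1 f s| <= k0 + k1 * `|s| `^ l1.

(** A bound for the derivative of [f] at every point between a and b, hence a local Lipschitz
    constant. *)
Definition growth (a b : R) : R := k0 + k1 * (`|a| `^ l1 + `|b| `^ l1).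

Lemma C1_is_derive (s : R) : is_derive s 1 f (derive1 f s).
Proof. by rewrite derive1E; apply: derivableP; have [+ _] := C1f; exact. Qed.

Lemma C1_continuous : continuous f.
Proof.
move=> s; apply/differentiable_continuous/derivable1_diffP.
by have [+ _] := C1f; exact.
Qed.

Lemma powR_between (a b c : R) : Num.min a b <= c <= Num.max a b ->
  `|c| `^ l1 <= `|a| `^ l1 + `|b| `^ l1.
Proof.
have pl (x y : R) : `|x| <= `|y| -> `|x| `^ l1 <= `|y| `^ l1.
  by move=> xy; rewrite ge0_ler_powR ?nnegrE// ltW.
move=> /andP[ac cb].
have [cE|cE] : `|c| <= `|a| \/ `|c| <= `|b|.
  have [] := leP 0 c => c0; move: ac cb; rewrite ?(ger0_norm c0) ?(ltr0_norm c0);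
    case: (leP a b) => ab ac cb; have := ler_norm a; have := ler_norm b;
    have := ler_norm (- a); have := ler_norm (- b); rewrite !normrN => *;
    [right|left|left|right]; lra.
- by rewrite (le_trans (pl _ _ cE))// lerDl powR_ge0.
- by rewrite (le_trans (pl _ _ cE))// lerDr powR_ge0.
Qed.

Lemma growth_lipschitz a b : `|f a - f b| <= growth a b * `|a - b|.
Proof.
have [c cab ->] := mean_value b a C1_is_derive.
rewrite normrM ler_wpM2r//; apply: (le_trans (df_le c)).
by rewrite lerD2l ler_wpM2l ?(ltW hk1)// addrC powR_between.
Qed.

Lemma growth_ge0 a b : 0 <= growth a b.
Proof. by rewrite addr_ge0 ?(ltW hk0)// mulr_ge0 ?(ltW hk1)// addr_ge0 ?powR_ge0. Qed.

(** The mean value theorem gives f(c) (a - b) for the increment of the primitive, and f(c) - f(b) is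
    again controlled by the Lipschitz bound. The 2 accounts for |c| being bounded through both |a|
    and |b|. *)
Lemma primitive_taylor a b :
  `|primitive f a - primitive f b - f b * (a - b)| <= 2 * growth a b * (a - b) ^+ 2.
Proof.
have [c cab ->] := mean_value b a (is_derive_primitive C1_continuous).
rewrite -mulrBl normrM -[(a - b) ^+ 2]real_normK ?num_real// expr2 mulrA ler_wpM2r//.
apply: (le_trans (growth_lipschitz c b)); apply: ler_pM => //; first exact: growth_ge0.
  have pc := powR_between cab; have h0 := hk0.
  rewrite /growth [2 * _]mulrDr [2 * (k1 * _)]mulrCA; apply: lerD; first lra.
  rewrite ler_wpM2l ?(ltW hk1)//; have := powR_ge0 `|a| l1; have := powR_ge0 `|b| l1.
  by move: pc; lra.
move: cab; rewrite ler_norml; case: (leP b a) => ba /andP[bc ca].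
  by rewrite ger0_norm; [apply/andP; split; lra|lra].
by rewrite ltr0_norm; [apply/andP; split; lra|lra].
Qed.

End growth.

(** Each factor is at most the maximum of the three, whose power l + 2 is one of the summands. It
    stands in for Hoelder's inequality with three factors. *)
Lemma young3 (R : realType) (l s t u : R) : 0 < l -> 0 <= s -> 0 <= t -> 0 <= u ->
  s `^ l * t * u <= s `^ (l + 2) + (t `^ (l + 2) + u `^ (l + 2)).
Proof.
move=> l0 s0 t0 u0; pose m := Num.max s (Num.max t u).
have [sm tm um] : [/\ s <= m, t <= m & u <= m] by rewrite !le_max !lexx ?orbT.
have m0 : 0 <= m by exact: le_trans sm.
apply: (@le_trans _ _ (m `^ (l + 2))).
  rewrite powRD; last by rewrite (_ : (l + 2 == 0) = false)//; apply: gt_eqF; lra.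
  rewrite powR_mulrn// expr2 mulrA; apply: ler_pM => //; first by rewrite mulr_ge0 ?powR_ge0.
  by apply: ler_pM => //; [exact: powR_ge0|rewrite ge0_ler_powR ?nnegrE// ltW].
have p x : 0 <= x `^ (l + 2) by exact: powR_ge0.
have [-> | [->| ->]] : m = s \/ m = t \/ m = u.
  rewrite /m; case: (leP s (Num.max t u)) => _; last by left.
  by case: (leP t u) => _; right; [right|left].
- by rewrite lerDl addr_ge0.
- by have := p s; have := p u; lra.
- by have := p s; have := p t; lra.
Qed.

Lemma mul_norm_le_sqr (R : realType) (a b : R) : `|a| * `|b| <= a ^+ 2 + b ^+ 2.
Proof.
rewrite -[a ^+ 2]real_normK ?num_real// -[b ^+ 2]real_normK ?num_real//.
by have := sqr_ge0 (`|a| - `|b|); have := sqr_ge0 (`|a| + `|b|); lra.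
Qed.

Lemma le_sum4 (R : realType) (a b c d : R) : 0 <= a -> 0 <= b -> 0 <= c -> 0 <= d ->
  a <= a + b + (c + d) /\ b <= a + b + (c + d).
Proof. by move=> *; split; lra. Qed.

Lemma norm_le_sum4 (R : realType) (x y N b a1 a2 a3 C : R) : `|x - y| <= b ->
  b <= a3 * N -> `|y| <= C * N -> 0 <= (a1 + a2) * N ->
  `|x| <= (a1 + a2 + (a3 + C)) * N.
Proof.
move=> xy bN yN aN; have := ler_normD (x - y) y.
by rewrite subrK; move: xy bN yN aN; lra.
Qed.

(** The integral bounds are normalised by positive upper bounds of the seminorms; letting the excess
    tend to 0 recovers the seminorms, which may vanish. *)
Lemma le_mul_limit (R : realType) (I c x y : R) : 0 <= c -> 0 <= x -> 0 <= y ->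
  (forall e, 0 < e -> I <= c * (x + e) * (y + e)) -> I <= c * x * y.
Proof.
move=> c0 x0 y0 H; apply/ler_addgt0Pr => d d0.
pose D := c * (x + y + 1) + 1.
have D0 : 0 < D by rewrite ltr_wpDl// mulr_ge0 ?addr_ge0.
pose e := Num.min 1 (d / D).
have e0 : 0 < e by rewrite lt_min ltr01 divr_gt0.
have e1 : e <= 1 by rewrite ge_min lexx.
have eD : e * D <= d by rewrite -ler_pdivlMr// ge_min lexx orbT.
apply: (le_trans (H e e0)).
have -> : c * (x + e) * (y + e) = c * x * y + e * (c * (x + y + e)) by ring.
rewrite lerD2l (le_trans _ eD)// ler_pM2l// /D.
have : c * (x + y + e) <= c * (x + y + 1) by rewrite ler_wpM2l// lerD2l.
lra.
Qed.

(** * Estimates of the nonlinear terms *)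

Section nemytskii.
Context (R : realType) (n : nat) (Omega : set 'rV[R]_n).
Hypotheses (n0 : (0 < n)%N) (oO : open Omega) (bO : bounded_set Omega).
Context (f : R -> R) (k0 k1 l1 : R).
Hypotheses (C1f : C1_fun f) (hk0 : 0 < k0) (hk1 : 0 < k1) (hl1 : 0 < l1).
Hypothesis df_le : forall s : R, `|derive1 f s| <= k0 + k1 * `|s| `^ l1.
Hypothesis subcritical : (2 < n)%N -> (l1 + 2) * (n%:R - 2) <= 2 * n%:R.
Local Notation mu := (lebesgue_rV R n).
Implicit Types (phi v w : 'rV[R]_n -> R).
Local Notation ng := (seminorm_of (graddot Omega)).

Let mO : measurable Omega. Proof. exact: domain_measurable. Qed.
Let si2 := l2_semi_inner mO.
Let si1 := h1_semi_inner oO bO.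
Let sig := grad_semi_inner_H01 oO bO.
Local Opaque Rintegral l2dot l2norm graddot h1norm.

Let mH v : H01 Omega v -> measurable_fun Omega v.
Proof. by move=> /H01_L2[]. Qed.

Let mpow v r : H01 Omega v -> measurable_fun Omega (fun x => `|v x| `^ r).
Proof.
by move=> /mH mv; apply: (measurableT_comp (measurable_powR _)); apply: measurableT_comp.
Qed.

Let mgrowth v w : H01 Omega v -> H01 Omega w ->
  measurable_fun Omega (fun x => growth k0 k1 l1 (v x) (w x)).
Proof.
move=> Hv Hw; apply: measurable_funD => //; apply: measurable_funM => //.
by apply: measurable_funD; exact: mpow.
Qed.

Let unit_scale v (Z : R) : H01 Omega v -> 0 < Z -> ng v <= Z ->
  exists v', [/\ H01 Omega v', graddot Omega v' v' <= 1 & forall x, v x = Z * v' x].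
Proof.
move=> Hv Z0 vZ; have Hv' := siZ sig Z^-1 Hv; exists (Z^-1 *: v); split=> //.
  rewrite -(sqr_nB sig Hv') (nBZ sig _ Hv) gtr0_norm ?invr_gt0// exprn_ile1//.
    by rewrite mulr_ge0 ?invr_ge0 ?nB_ge0 ?(ltW Z0).
  by rewrite ler_pdivrMl// mulr1.
by move=> x; rewrite fct_scaleE mulrA divff ?mul1r// gt_eqF.
Qed.

(** By homogeneity all three gradients may be taken of norm at most 1. Then [young3] and the Sobolev
    inequality with exponent l1 + 2 bound the integral by three copies of K^(l1+2). *)
Lemma integral_trilinear_le : exists2 T, 0 <= T & forall v x y (Z X Y : R),
  H01 Omega v -> H01 Omega x -> H01 Omega y -> 0 < Z -> 0 < X -> 0 < Y ->
  ng v <= Z -> ng x <= X -> ng y <= Y ->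
  (\int[mu]_(p in Omega) (`|v p| `^ l1 * `|x p| * `|y p|)%:E <= (T * Z `^ l1 * X * Y)%:E)%E.
Proof.
have r2 : 2 < l1 + 2 by rewrite ltrDr.
have [K K0 KP] := sobolev oO bO n0 r2 subcritical.
exists (3 * K `^ (l1 + 2)); first by rewrite mulr_ge0 ?powR_ge0.
move=> v x y Z X Y Hv Hx Hy Z0 X0 Y0 vZ xX yY.
have [v' [Hv' gv' vE]] := unit_scale Hv Z0 vZ.
have [x' [Hx' gx' xE]] := unit_scale Hx X0 xX.
have [y' [Hy' gy' yE]] := unit_scale Hy Y0 yY.
have bnd w : H01 Omega w -> graddot Omega w w <= 1 ->
    (\int[mu]_(p in Omega) (`|w p| `^ (l1 + 2))%:E <= (K `^ (l1 + 2))%:E)%E.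
  by move=> Hw gw; have := KP w 1 Hw ltr01; rewrite expr1n mulr1; apply.
have Q : (\int[mu]_(p in Omega) (`|x' p| `^ (l1 + 2) + `|y' p| `^ (l1 + 2))%:E <=
    (1 * K `^ (l1 + 2) + 1 * K `^ (l1 + 2))%:E)%E.
  apply: (integral_lincomb_le mO (mpow (l1 + 2) Hx') (mpow (l1 + 2) Hy')) => //.
  - by apply: measurable_funD; exact: mpow.
  - by move=> p _; rewrite !mul1r lexx addr_ge0 ?powR_ge0.
  - exact: bnd.
  - exact: bnd.
pose C := Z `^ l1 * X * Y.
have C0 : 0 <= C by rewrite !mulr_ge0 ?powR_ge0 ?(ltW X0) ?(ltW Y0).
have -> : 3 * K `^ (l1 + 2) * Z `^ l1 * X * Y =
    C * K `^ (l1 + 2) + C * (1 * K `^ (l1 + 2) + 1 * K `^ (l1 + 2)).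
  by rewrite /C; ring.
apply: (integral_lincomb_le mO (mpow (l1 + 2) Hv') _ _ _ _ _ C0 C0 (bnd _ Hv' gv') Q).
- by apply: measurable_funD; exact: mpow.
- by apply: measurable_funM; [apply: measurable_funM; [exact: mpow|]|];
    apply: measurableT_comp => //; exact: mH.
- by move=> p _; exact: powR_ge0.
- by move=> p _; rewrite addr_ge0 ?powR_ge0.
move=> p _; apply/andP; split; first by rewrite !mulr_ge0 ?powR_ge0.
rewrite vE xE yE !normrM (gtr0_norm Z0) (gtr0_norm X0) (gtr0_norm Y0) powRM ?(ltW Z0)//.
have := young3 hl1 (normr_ge0 (v' p)) (normr_ge0 (x' p)) (normr_ge0 (y' p)).
move=> /(ler_wpM2l C0); rewrite mulrDr; apply: le_trans.
by rewrite le_eqVlt /C; apply/orP; left; apply/eqP; ring.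
Qed.

Lemma integral_bilinear_le : exists2 T, 0 <= T & forall x y (X Y : R),
  H01 Omega x -> H01 Omega y -> 0 < X -> 0 < Y -> ng x <= X -> ng y <= Y ->
  (\int[mu]_(p in Omega) (`|x p| * `|y p|)%:E <= (T * X * Y)%:E)%E.
Proof.
have [K K0 KP] := poincare oO bO n0.
exists (2 * K ^+ 2); first by rewrite mulr_ge0 ?sqr_ge0.
move=> x y X Y Hx Hy X0 Y0 xX yY.
have [x' [Hx' gx' xE]] := unit_scale Hx X0 xX.
have [y' [Hy' gy' yE]] := unit_scale Hy Y0 yY.
have bnd w : H01 Omega w -> graddot Omega w w <= 1 ->
    (\int[mu]_(p in Omega) (w p ^+ 2)%:E <= (K ^+ 2)%:E)%E.
  move=> Hw gw; rewrite -(l2normE mO (H01_L2 Hw)) lee_fin.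
  rewrite ler_pXn2r ?nnegrE ?l2norm_ge0 ?(ltW K0)//; apply: (le_trans (KP _ Hw)).
  rewrite ler_piMr ?(ltW K0)// -(@ler_pXn2r _ 2)// ?nnegrE ?nB_ge0//.
  by rewrite (sqr_nB sig Hw) expr1n.
pose C := X * Y.
have C0 : 0 <= C by rewrite !mulr_ge0 ?(ltW X0) ?(ltW Y0).
have -> : 2 * K ^+ 2 * X * Y = C * K ^+ 2 + C * K ^+ 2 by rewrite /C; ring.
apply: (integral_lincomb_le mO _ _ _ _ _ _ C0 C0 (bnd _ Hx' gx') (bnd _ Hy' gy')).
- by apply: measurable_funX; exact: mH.
- by apply: measurable_funX; exact: mH.
- by apply: measurable_funM; apply: measurableT_comp => //; exact: mH.
- by move=> p _; exact: sqr_ge0.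
- by move=> p _; exact: sqr_ge0.
move=> p _; rewrite mulr_ge0//= xE yE !normrM (gtr0_norm X0) (gtr0_norm Y0).
have -> : X * `|x' p| * (Y * `|y' p|) = C * (`|x' p| * `|y' p|) by rewrite /C; ring.
rewrite -mulrDr; exact: (ler_wpM2l C0 (mul_norm_le_sqr _ _)).
Qed.

Lemma integral_growth_le : exists2 c : R -> R, (forall M, 0 <= c M) &
  forall v w x y (M X Y : R),
  H01 Omega v -> H01 Omega w -> H01 Omega x -> H01 Omega y -> 0 < M -> 0 < X -> 0 < Y ->
  ng v <= M -> ng w <= M -> ng x <= X -> ng y <= Y ->
  (\int[mu]_(p in Omega) (growth k0 k1 l1 (v p) (w p) * `|x p| * `|y p|)%:E <=
    (c M * X * Y)%:E)%E.
Proof.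
have [T T0 TP] := integral_trilinear_le.
have [S S0 SP] := integral_bilinear_le.
exists (fun M => k0 * S + k1 * (2 * T * M `^ l1)).
  by move=> M; rewrite addr_ge0// !mulr_ge0 ?powR_ge0 ?(ltW hk0) ?(ltW hk1).
move=> v w x y M X Y Hv Hw Hx Hy M0 X0 Y0 vM wM xX yY.
have -> : (k0 * S + k1 * (2 * T * M `^ l1)) * X * Y =
  k0 * (S * X * Y) + k1 * (1 * (T * M `^ l1 * X * Y) + 1 * (T * M `^ l1 * X * Y)) by ring.
have mx := measurableT_comp (@normr_measurable R setT) (mH Hx).
have my := measurableT_comp (@normr_measurable R setT) (mH Hy).
have mt z : H01 Omega z -> measurable_fun Omega (fun p => `|z p| `^ l1 * `|x p| * `|y p|).
  by move=> Hz; apply: measurable_funM => //; apply: measurable_funM => //; exact: mpow.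
have t0 z p : 0 <= `|z p| `^ l1 * `|x p| * `|y p| by rewrite !mulr_ge0 ?powR_ge0.
apply: (integral_lincomb_le (P := fun p => `|x p| * `|y p|)
  (Q := fun p => `|v p| `^ l1 * `|x p| * `|y p| + `|w p| `^ l1 * `|x p| * `|y p|) mO).
- exact: measurable_funM.
- by apply: measurable_funD; exact: mt.
- by apply: measurable_funM => //; apply: measurable_funM => //; exact: mgrowth.
- by move=> p _; rewrite mulr_ge0.
- by move=> p _; rewrite addr_ge0.
- move=> p _; rewrite !mulr_ge0 ?growth_ge0//= le_eqVlt; apply/orP; left; apply/eqP.
  by rewrite /growth; ring.
- exact: ltW.
- exact: ltW.
- exact: SP.
apply: (integral_lincomb_le mO (mt _ Hv) (mt _ Hw)) => //.
- by apply: measurable_funD; exact: mt.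
- by move=> p _; rewrite !mul1r lexx addr_ge0.
- exact: TP.
- exact: TP.
Qed.

Lemma integral_bound (g h : 'rV[R]_n -> R) (C : R) :
  measurable_fun Omega g -> measurable_fun Omega h -> (forall p, `|g p| <= h p) ->
  (\int[mu]_(p in Omega) (h p)%:E <= C%:E)%E ->
  mu.-integrable Omega (EFin \o g) /\ `|\int[mu]_(p in Omega) g p| <= C.
Proof.
move=> mg mh gh hC.
have gC : (\int[mu]_(p in Omega) `|(g p)%:E| <= C%:E)%E.
  apply: le_trans hC; apply: ge0_le_integral => //.
  - by apply: measurableT_comp => //; exact/measurable_EFinP.
  - exact/measurable_EFinP.
  - by move=> p _; rewrite /= lee_fin.
have ig : mu.-integrable Omega (EFin \o g).
  apply/integrableP; split; first exact/measurable_EFinP.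
  exact: le_lt_trans gC (ltry _).
split=> //; have := le_abse_integral mu mO (measurable_int mu ig).
by move=> /le_trans/(_ gC); rewrite -lee_fin (EFin_normr_Rintegral mO ig).
Qed.

Let m0 : measurable_fun setT f.
Proof. by apply: continuous_measurable_fun; exact: (C1_continuous C1f). Qed.

Let mf v : H01 Omega v -> measurable_fun Omega (fun p => f (v p)).
Proof. by move=> /mH mv; exact: measurableT_comp. Qed.

Let mF v : H01 Omega v -> measurable_fun Omega (fun p => primitive f (v p)).
Proof.
move=> /mH mv; apply: (@measurableT_comp _ _ _ _ _ _ (primitive f)) => //.
apply: continuous_measurable_fun => s.
apply/differentiable_continuous/derivable1_diffP.
by have [] := is_derive_primitive (C1_continuous C1f) s.
Qed.

Let msub v w : H01 Omega v -> H01 Omega w -> measurable_fun Omega (fun p => v p - w p).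
Proof. by move=> Hv Hw; apply: measurable_funB; exact: mH. Qed.

Lemma nemytskii_diff : exists2 c : R -> R, (forall M, 0 <= c M) &
  forall v w phi (M : R), H01 Omega v -> H01 Omega w -> H01 Omega phi -> 0 < M ->
  ng v <= M -> ng w <= M ->
  mu.-integrable Omega (EFin \o (fun p => (f (v p) - f (w p)) * phi p)) /\
  `|\int[mu]_(p in Omega) ((f (v p) - f (w p)) * phi p)| <= c M * ng (v - w) * ng phi.
Proof.
have [c c0 cP] := integral_growth_le; exists c; first exact: c0.
move=> v w phi M Hv Hw Hp M0 vM wM; have Hd := siB_ si1 Hv Hw.
have mfw : measurable_fun Omega (fun p => (f (v p) - f (w p)) * phi p).
  by apply: measurable_funM; [apply: measurable_funB; exact: mf|exact: mH].
have mh : measurable_fun Omega (fun p => growth k0 k1 l1 (v p) (w p) * `|(v - w) p| * `|phi p|).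
  by apply: measurable_funM; [apply: measurable_funM; [exact: mgrowth|]|];
    apply: measurableT_comp => //; [exact: msub|exact: mH].
have fh p : `|(f (v p) - f (w p)) * phi p| <= growth k0 k1 l1 (v p) (w p) * `|(v - w) p| * `|phi p|.
  by rewrite normrM ler_wpM2r// fct_subE; exact: (growth_lipschitz C1f hk1 hl1 df_le).
have B X Y : 0 < X -> 0 < Y -> ng (v - w) <= X -> ng phi <= Y ->
    mu.-integrable Omega (EFin \o (fun p => (f (v p) - f (w p)) * phi p)) /\
    `|\int[mu]_(p in Omega) ((f (v p) - f (w p)) * phi p)| <= c M * X * Y.
  move=> X0 Y0 dX pY; apply: (integral_bound mfw mh fh).
  exact: (cP _ _ _ _ _ _ _ Hv Hw Hd Hp M0 X0 Y0 vM wM dX pY).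
have pos (e : R) u : 0 < e -> 0 < ng u + e by move=> e0; rewrite ltr_wpDl ?nB_ge0.
have le (e : R) u : 0 < e -> ng u <= ng u + e by move=> e0; rewrite lerDl ltW.
split; first by have [] := B _ _ (pos 1 _ ltr01) (pos 1 _ ltr01) (le 1 _ ltr01) (le 1 _ ltr01).
apply: (le_mul_limit (c0 M) (nB_ge0 _ _) (nB_ge0 _ _)) => e e0.
by have [] := B _ _ (pos e _ e0) (pos e _ e0) (le e _ e0) (le e _ e0).
Qed.

(** Integrates [primitive_taylor]. The quadratic remainder makes the potential differentiable along
    the curve, with derivative the pairing of f(u) with the velocity. *)
Lemma nemytskii_taylor : exists2 c : R -> R, (forall M, 0 <= c M) &
  forall v w (M : R), H01 Omega v -> H01 Omega w -> 0 < M -> ng v <= M -> ng w <= M ->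
  mu.-integrable Omega (EFin \o
    (fun p => primitive f (v p) - primitive f (w p) - f (w p) * (v p - w p))) /\
  `|\int[mu]_(p in Omega) (primitive f (v p) - primitive f (w p) - f (w p) * (v p - w p))|
    <= c M * ng (v - w) ^+ 2.
Proof.
have [c c0 cP] := integral_growth_le; exists (fun M => 2 * c M); first by move=> M; rewrite mulr_ge0.
move=> v w M Hv Hw M0 vM wM; have Hd := siB_ si1 Hv Hw.
pose g p := primitive f (v p) - primitive f (w p) - f (w p) * (v p - w p).
have mg : measurable_fun Omega g.
  apply: measurable_funB; first by apply: measurable_funB; exact: mF.
  by apply: measurable_funM; [exact: mf|exact: msub].
have mh : measurable_fun Omega (fun p => growth k0 k1 l1 (v p) (w p) * `|(v - w) p| * `|(v - w) p|).
  by apply: measurable_funM; [apply: measurable_funM; [exact: mgrowth|]|];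
    apply: measurableT_comp => //; exact: msub.
have gh p : `|g p| <= 2 * (growth k0 k1 l1 (v p) (w p) * `|(v - w) p| * `|(v - w) p|).
  apply: (le_trans (primitive_taylor C1f hk0 hk1 hl1 df_le _ _)).
  by rewrite -mulrA ler_wpM2l// -mulrA -expr2 real_normK ?num_real.
have B X : 0 < X -> ng (v - w) <= X ->
    mu.-integrable Omega (EFin \o g) /\ `|\int[mu]_(p in Omega) g p| <= 2 * c M * X * X.
  move=> X0 dX; apply: (integral_bound mg _ gh); first exact: measurable_funM.
  have -> : 2 * c M * X * X = 2 * (c M * X * X) + 0 * 0 by ring.
  apply: (integral_lincomb_le mO mh (Q := cst 0)).
  - exact: measurable_cst.
  - exact: measurable_funM.
  - by move=> p _; rewrite !mulr_ge0 ?growth_ge0.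
  - by move=> p _; exact: lexx.
  - by move=> p _; rewrite !mulr_ge0 ?growth_ge0//= mul0r addr0.
  - by [].
  - by [].
  - exact: (cP _ _ _ _ _ _ _ Hv Hw Hd Hd M0 X0 X0 vM wM dX dX).
  - by rewrite integral0.
have pos (e : R) u : 0 < e -> 0 < ng u + e by move=> e0; rewrite ltr_wpDl ?nB_ge0.
have le (e : R) u : 0 < e -> ng u <= ng u + e by move=> e0; rewrite lerDl ltW.
split; first by have [] := B _ (pos 1 _ ltr01) (le 1 _ ltr01).
have c2 : 0 <= 2 * c M by exact: (mulr_ge0 _ (c0 M)).
rewrite expr2 mulrA; apply: (le_mul_limit c2 (nB_ge0 _ _) (nB_ge0 _ _)) => e e0.
by have [] := B _ (pos e _ e0) (le e _ e0).
Qed.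

Definition nonlin v phi : R := \int[mu]_(p in Omega) (f (v p) * phi p).
Definition potential v : R := \int[mu]_(p in Omega) primitive f (v p).

Lemma nonlin_integrable v phi : H01 Omega v -> H01 Omega phi ->
  mu.-integrable Omega (EFin \o (fun p => f (v p) * phi p)).
Proof.
move=> Hv Hp; have [c _ cP] := nemytskii_diff.
have M0 : 0 < ng v + 1 by rewrite ltr_wpDl ?nB_ge0.
have vM : ng v <= ng v + 1 by rewrite lerDl.
have oM : ng 0 <= ng v + 1 by rewrite (nB0 sig) ltW.
have [i1 _] := cP v 0 phi _ Hv (si0 si1) Hp M0 vM oM.
have i2 := integrableZl mO (f 0) (L2_integrable oO bO (H01_L2 Hp)).
apply: eq_integrable (integrableD mO i1 i2) => // p _ /=.
by rewrite -EFinM -EFinD; congr EFin; ring.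
Qed.

Lemma potential_integrable v : H01 Omega v ->
  mu.-integrable Omega (EFin \o (fun p => primitive f (v p))).
Proof.
move=> Hv; have [c _ cP] := nemytskii_taylor.
have M0 : 0 < ng v + 1 by rewrite ltr_wpDl ?nB_ge0.
have vM : ng v <= ng v + 1 by rewrite lerDl.
have oM : ng 0 <= ng v + 1 by rewrite (nB0 sig) ltW.
have [i1 _] := cP v 0 _ Hv (si0 si1) M0 vM oM.
have i2 := integrableZl mO (f 0) (L2_integrable oO bO (H01_L2 Hv)).
have i3 := L2_integrable oO bO (L2_cst oO bO (primitive f 0)).
apply: eq_integrable (integrableD mO (integrableD mO i1 i2) i3) => // p _ /=.
by rewrite -EFinM -!EFinD; congr EFin; rewrite subr0; ring.
Qed.

Lemma nonlin_lin v a phi psi : H01 Omega v -> H01 Omega phi -> H01 Omega psi ->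
  nonlin v (a *: phi + psi) = a * nonlin v phi + nonlin v psi.
Proof.
move=> Hv Hp Hs; have i1 := nonlin_integrable Hv Hp; have i2 := nonlin_integrable Hv Hs.
rewrite /nonlin -(RintegralZl a mO i1) -(RintegralD mO _ i2).
  by apply: eq_Rintegral => p _; rewrite fct_linE; ring.
exact: (integrableZl mO a i1).
Qed.

(** Lipschitz, Taylor and growth bounds with one constant depending only on a bound of the
    gradients: all that the evolution argument needs to know about [f] apart from linearity in [phi]
    and (H1). *)
Lemma nonlin_estimates : exists2 c : R -> R, (forall M, 0 <= c M) &
  forall v w phi (M : R), H01 Omega v -> H01 Omega w -> H01 Omega phi -> 0 < M ->
  ng v <= M -> ng w <= M ->
  [/\ `|nonlin v phi - nonlin w phi| <= c M * ng (v - w) * ng phi,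
      `|potential v - potential w - nonlin w (v - w)| <= c M * ng (v - w) ^+ 2 &
      `|nonlin v phi| <= c M * ng phi].
Proof.
have [c1 c10 P1] := nemytskii_diff; have [c2 c20 P2] := nemytskii_taylor.
have [K K0 KP] := poincare oO bO n0.
pose C := `|f 0| * l2norm Omega (cst 1) * K.
have C0 : 0 <= C by rewrite !mulr_ge0 ?l2norm_ge0 ?(ltW K0).
have L1 : L2 Omega (cst 1) by exact: (L2_cst oO bO).
(* The last two summands serve the growth bound: comparison with the zero function gives [c1 M * M],
   and the constant value f(0) gives [C]. *)
exists (fun M => c1 M + c2 M + (c1 M * `|M| + C)).
  move=> M; exact: (addr_ge0 (addr_ge0 (c10 M) (c20 M)) (addr_ge0 (mulr_ge0 (c10 M) (normr_ge0 M)) C0)).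
move=> v w phi M Hv Hw Hp M0 vM wM; have Hd := siB_ si1 Hv Hw.
have A1 := c10 M; have A2 := c20 M.
have A3 : 0 <= c1 M * `|M| by rewrite mulr_ge0.
have diffE z : H01 Omega z -> nonlin v phi - nonlin z phi =
    \int[mu]_(p in Omega) ((f (v p) - f (z p)) * phi p).
  move=> Hz; rewrite /nonlin -(RintegralB mO (nonlin_integrable Hv Hp) (nonlin_integrable Hz Hp)).
  by apply: eq_Rintegral => p _; rewrite mulrBl.
split.
- have [_] := P1 v w phi M Hv Hw Hp M0 vM wM; rewrite (diffE _ Hw) => /le_trans; apply.
  apply: ler_wpM2r; first exact: nB_ge0.
  apply: ler_wpM2r; first exact: nB_ge0.
  by have [] := le_sum4 A1 A2 A3 C0.
- have [_] := P2 v w M Hv Hw M0 vM wM.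
  have -> : \int[mu]_(p in Omega) (primitive f (v p) - primitive f (w p) - f (w p) * (v p - w p))
      = potential v - potential w - nonlin w (v - w).
    rewrite /potential /nonlin -(RintegralB mO (potential_integrable Hv) (potential_integrable Hw)).
    by rewrite -(RintegralB mO (integrableB mO (potential_integrable Hv) (potential_integrable Hw))
      (nonlin_integrable Hw Hd)).
  move=> /le_trans; apply; apply: ler_wpM2r; first exact: sqr_ge0.
  by have [] := le_sum4 A1 A2 A3 C0.
have oM : ng 0 <= M by rewrite (nB0 sig) ltW.
have [_] := P1 v 0 phi M Hv (si0 si1) Hp M0 vM oM; rewrite -(diffE _ (si0 si1)) subr0 => B1.
have B2 : `|nonlin 0 phi| <= C * ng phi.
  have -> : nonlin 0 phi = f 0 * l2dot Omega (cst 1) phi.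
    rewrite /nonlin -(RintegralZl (f 0) mO (L2_integrableM mO L1 (H01_L2 Hp))).
    by apply: eq_Rintegral => p _; rewrite /cst /= mul1r.
  rewrite normrM /C -!mulrA; apply: ler_wpM2l; first exact: normr_ge0.
  apply: (le_trans (si_CS si2 L1 (H01_L2 Hp))); rewrite -l2norm_seminorm.
  by apply: ler_wpM2l; [exact: l2norm_ge0|exact: KP].
have B3 : c1 M * ng v * ng phi <= c1 M * `|M| * ng phi.
  apply: ler_wpM2r; first exact: nB_ge0.
  exact: (ler_wpM2l A1 (le_trans vM (ler_norm M))).
have B4 : 0 <= (c1 M + c2 M) * ng phi by exact: (mulr_ge0 (addr_ge0 A1 A2) (nB_ge0 _ _)).
exact: (norm_le_sum4 B1 B3 B2 B4).
Qed.

Lemma potential_le_nonlin (p : R) v : (forall s, p * primitive f s <= s * f s) ->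
  H01 Omega v -> p * potential v <= nonlin v v.
Proof.
move=> Hp Hv; have iF := potential_integrable Hv.
rewrite /potential /nonlin -(RintegralZl p mO iF).
apply: (le_Rintegral mO (integrableZl mO p iF) (nonlin_integrable Hv Hv)) => x _.
by rewrite /= mulrC; have := Hp (v x); rewrite mulrC [v x * _]mulrC.
Qed.

End nemytskii.

(** * Evolution in an abstract energy space *)

Section near_in.
Context (R : realType) (T : R).
Implicit Types (t s e : R) (P Q : R -> Prop) (p q r : R -> R).

(** Neighbourhoods relative to [0, T], with s = t included; at the endpoints they are one-sided. *)
Definition near_in t P : Prop :=
  exists2 d : R, 0 < d & forall s, 0 <= s <= T -> `|s - t| < d -> P s.

Lemma near_inI t P Q : near_in t P -> near_in t Q -> near_in t (fun s => P s /\ Q s).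
Proof.
move=> [d d0 dP] [e e0 eQ]; exists (Num.min d e); first by rewrite lt_min d0.
by move=> s sT; rewrite lt_min => /andP[sd se]; split; [exact: dP|exact: eQ].
Qed.

Lemma near_inS t P Q : (forall s, 0 <= s <= T -> P s -> Q s) -> near_in t P -> near_in t Q.
Proof. by move=> PQ [d d0 dP]; exists d => // s sT st; apply: PQ => //; exact: dP. Qed.

Lemma near_inT t P : (forall s, 0 <= s <= T -> P s) -> near_in t P.
Proof. by move=> PT; exists 1 => // s sT _; exact: PT. Qed.

Definition small t q : Prop := forall e, 0 < e -> near_in t (fun s => `|q s| <= e).

(** For t in [0, T] the case s = t forces [r t = 0]. *)
Definition littleo_in t r : Prop := forall e, 0 < e -> near_in t (fun s => `|r s| <= e * `|s - t|).

Lemma smallD t p q : small t p -> small t q -> small t (fun s => p s + q s).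
Proof.
move=> sp sq e e0; have e2 : 0 < e / 2 by lra.
apply: near_inS (near_inI (sp _ e2) (sq _ e2)) => s _ [ps qs].
by rewrite (le_trans (ler_normD _ _))//; lra.
Qed.

Lemma small_bounded t p q (C : R) : near_in t (fun s => `|p s| <= C) -> small t q ->
  small t (fun s => p s * q s).
Proof.
move=> pC sq e e0; have C1 : 0 < `|C| + 1 by rewrite ltr_wpDl.
have eC : 0 < e / (`|C| + 1) by rewrite divr_gt0.
apply: near_inS (near_inI pC (sq _ eC)) => s _ [ps qs]; rewrite normrM.
have -> : e = (`|C| + 1) * (e / (`|C| + 1)) by rewrite mulrC divfK ?gt_eqF.
by apply: ler_pM => //; rewrite (le_trans ps)// (le_trans (ler_norm C))// lerDl.
Qed.

Lemma smallZ t (c : R) q : small t q -> small t (fun s => c * q s).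
Proof. by apply: (@small_bounded _ (fun=> c) _ `|c|); exact: near_inT. Qed.

Lemma small_le t p q : near_in t (fun s => `|q s| <= p s) -> small t p -> small t q.
Proof.
move=> qp sp e e0; apply: near_inS (near_inI qp (sp e e0)) => s _ [h1 h2].
by rewrite (le_trans h1)// (le_trans (ler_norm _)).
Qed.

Lemma small_id t : small t (fun s => s - t).
Proof. by move=> e e0; exists e => // s _ /ltW. Qed.

Lemma littleo_in_small t r : littleo_in t r -> small t r.
Proof.
move=> ro e e0; apply: near_inS (near_inI (ro _ e0) (small_id t ltr01)) => s _ [h1 h2].
by rewrite (le_trans h1)// ler_piMr// ltW.
Qed.

Lemma littleo_in_le t r r' : near_in t (fun s => `|r' s| <= r s) -> littleo_in t r -> littleo_in t r'.
Proof.
move=> qp sp e e0; apply: near_inS (near_inI qp (sp e e0)) => s _ [h1 h2].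
by rewrite (le_trans h1)// (le_trans (ler_norm _)).
Qed.

Lemma littleo_in_mul t q : small t q -> littleo_in t (fun s => `|s - t| * q s).
Proof.
move=> sq e e0; apply: near_inS (sq e e0) => s _ h1.
by rewrite normrM normr_id mulrC ler_wpM2r.
Qed.

Lemma littleo_inD t r r' : littleo_in t r -> littleo_in t r' -> littleo_in t (fun s => r s + r' s).
Proof.
move=> sp sq e e0; have e2 : 0 < e / 2 by lra.
apply: near_inS (near_inI (sp _ e2) (sq _ e2)) => s _ [ps qs].
by rewrite (le_trans (ler_normD _ _))//; lra.
Qed.

Lemma littleo_in_bounded t p r (C : R) : near_in t (fun s => `|p s| <= C) -> littleo_in t r ->
  littleo_in t (fun s => p s * r s).
Proof.
move=> pC sq e e0; have C1 : 0 < `|C| + 1 by rewrite ltr_wpDl.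
have eC : 0 < e / (`|C| + 1) by rewrite divr_gt0.
apply: near_inS (near_inI pC (sq _ eC)) => s _ [ps qs]; rewrite normrM.
have -> : e = (`|C| + 1) * (e / (`|C| + 1)) by rewrite mulrC divfK ?gt_eqF.
by rewrite -mulrA; apply: ler_pM => //; rewrite (le_trans ps)// (le_trans (ler_norm C))// lerDl.
Qed.

Lemma littleo_inZ t (c : R) r : littleo_in t r -> littleo_in t (fun s => c * r s).
Proof. by apply: (@littleo_in_bounded _ (fun=> c) _ `|c|); exact: near_inT. Qed.

Lemma littleo_in_eq t r r' : (forall s, 0 <= s <= T -> r' s = r s) -> littleo_in t r -> littleo_in t r'.
Proof.
by move=> E ro e e0; apply: near_inS (ro e e0) => s sT; rewrite E.
Qed.

Lemma small_eq t r r' : (forall s, 0 <= s <= T -> r' s = r s) -> small t r -> small t r'.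
Proof.
by move=> E ro e e0; apply: near_inS (ro e e0) => s sT; rewrite E.
Qed.

(* The derivative within [0, T], one-sided at the endpoints. *)
Definition diff_in (u : R -> R) t (d : R) : Prop := littleo_in t (fun s => u s - u t - d * (s - t)).

Lemma diff_inD (u v : R -> R) t (c d : R) : diff_in u t c -> diff_in v t d ->
  diff_in (fun s => u s + v s) t (c + d).
Proof.
by move=> D1 D2; apply: littleo_in_eq (littleo_inD D1 D2) => s _ /=; ring.
Qed.

Lemma diff_inZ (a : R) (u : R -> R) t (c : R) : diff_in u t c ->
  diff_in (fun s => a * u s) t (a * c).
Proof. by move=> D; apply: littleo_in_eq (littleo_inZ a D) => s _ /=; ring. Qed.

Lemma diff_in_small (u : R -> R) t d : diff_in u t d -> small t (fun s => u s - u t).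
Proof.
move=> /littleo_in_small D; apply: small_eq (smallD D (smallZ d (small_id t))) => s _ /=.
by rewrite subrK.
Qed.

(** The intermediate point is interior, where differentiability relative to [0, T] is ordinary
    differentiability; at the ends only continuity within the interval is used. *)
Lemma diff_in_mvt (u d : R -> R) (a b : R) : 0 <= a -> a < b -> b <= T ->
  (forall t, 0 <= t <= T -> diff_in u t (d t)) ->
  exists2 x, a < x < b & u b - u a = d x * (b - a).
Proof.
move=> a0 ab bT Du.
have cw : {within `[a, b], continuous u}.
  apply/subspace_continuousP => x; rewrite /= in_itv/= => /andP[ax xb].
  have xT : 0 <= x <= T by apply/andP; split; lra.
  apply/cvgrPdist_le => e e0; have [r r0 rP] := diff_in_small (Du x xT) e0.
  rewrite near_withinE; near=> y; rewrite /= in_itv/= => /andP[ay yb].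
  rewrite distrC; apply: rP; first by apply/andP; split; lra.
  by rewrite distrC; near: y; exact: cvgr_dist_lt.
have dx x : x \in `]a, b[%R -> is_derive x 1 u (d x).
  rewrite in_itv/= => /andP[ax xb]; have xT : 0 <= x <= T by apply/andP; split; lra.
  suff cv : h^-1 *: ((u \o shift x) (h *: 1) - u x) @[h --> 0^'] --> d x.
    apply: DeriveDef; first by apply/cvg_ex; exists (d x).
    by apply/cvg_lim; [exact: Rhausdorff|exact: cv].
  apply/cvgrPdist_le => e e0; have [r r0 rP] := Du x xT e e0.
  near=> h; have h0 : h != 0 by near: h; exact: nbhs_dnbhs_neq.
  have hr : `|h| < Num.min r (Num.min (x - a) (b - x)).
    by near: h; apply: dnbhs0_lt; rewrite !lt_min r0 !subr_gt0 ax.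
  move: hr; rewrite !lt_min => /andP[hr /andP[]]; rewrite !ltr_norml => /andP[h1 h2] /andP[h3 h4].
  have -> : (u \o shift x) (h *: 1) = u (x + h) by rewrite /= [h *: 1]mulr1 addrC.
  have xhT : 0 <= x + h <= T by apply/andP; split; lra.
  have := rP (x + h) xhT; rewrite addrAC subrr add0r => /(_ hr) H.
  rewrite -(ler_pM2l (_ : 0 < `|h|)) ?normr_gt0// -normrM mulrBr.
  rewrite [h * (_ *: _)]mulrA divff// mul1r mulrC distrC [`|h| * e]mulrC (le_trans _ H)//.
by have [x] := MVT ab dx cw; rewrite in_itv; exists x.
Unshelve. all: by end_near. Qed.

End near_in.

Lemma le0_small (R : realType) (x C : R) : 0 <= C -> (forall e, 0 < e -> x <= C * e) -> x <= 0.
Proof.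
move=> C0 H; apply/ler_addgt0Pr => e e0; rewrite add0r.
have C1 : 0 < C + 1 by rewrite ltr_wpDl.
have := H (e / (C + 1)) (divr_gt0 e0 C1) => /le_trans; apply.
by rewrite mulrA ler_pdivrMr// mulrC ler_wpM2l ?(ltW e0)// lerDl.
Qed.

(** Here a, m, k, G, F stand for |u|^2, (u, u_t), |u_t|^2, |grad u|^2 and the potential, at a time
    where the Nehari functional is nonnegative. *)
Lemma virial_le_energy (R : realType) (p lam a m k G F : R) : 2 < p -> 0 < lam ->
  p * F <= G -> 2 * m <= a + k -> lam * a <= G -> 0 <= k -> 0 <= G ->
  a + G + 2 * m <= 4 * p * (1 + lam) / ((p - 2) * lam) * (2^-1 * k + 2^-1 * G - F).
Proof.
move=> p2 lam0 pF CS lg k0 G0.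
have p0 : 0 < p by lra.
have q0 : 0 < (p - 2) * lam by rewrite mulr_gt0//; lra.
pose C := 4 * p * (1 + lam) / ((p - 2) * lam).
have E : C * (2^-1 * k + 2^-1 * G - p^-1 * G) <= C * (2^-1 * k + 2^-1 * G - F).
  rewrite ler_wpM2l//; first by rewrite divr_ge0 ?(ltW q0)// !mulr_ge0//; lra.
  by rewrite lerD2l lerN2 ler_pdivlMl.
apply: le_trans E.
(* The factor (p - 2) lam in the denominator of C cancels the 1/2 - 1/p in front of G and leaves 2(1
   + lam)/lam, enough to absorb 2a + G. *)
have -> : C * (2^-1 * k + 2^-1 * G - p^-1 * G) =
    (2 * p * (1 + lam) / ((p - 2) * lam)) * k + (2 / lam + 2) * G.
  by rewrite /C; field; rewrite !gt_eqF//; lra.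
have aG : a <= G / lam by rewrite ler_pdivlMr// mulrC.
have k1 : k <= (2 * p * (1 + lam) / ((p - 2) * lam)) * k.
  rewrite ler_peMl// ler_pdivlMr// mul1r.
  have : 0 <= p * lam by rewrite mulr_ge0// ltW.
  by lra.
have : (2 / lam + 2) * G = 2 * (G / lam) + 2 * G by field; rewrite gt_eqF.
lra.
Qed.

(** * The damped equation in an abstract energy space *)

Section evolution.
Context (R : realType) (V : lmodType R) (X Y D : V -> Prop) (l g : V -> V -> R).
Hypotheses (sil : semi_inner X l) (sig : semi_inner Y g).
Implicit Types (v w phi : V) (s t : R).
Local Notation h := (fun u v => l u v + g u v).
Local Notation nl := (seminorm_of l).
Local Notation ng := (seminorm_of g).
Local Notation nh := (seminorm_of h).

Hypothesis YX : forall v, Y v -> X v.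
Context (P : R).
Hypotheses (P0 : 0 < P) (nhP : forall v, Y v -> nh v <= P * ng v).
Hypothesis Ycomplete : forall v : nat -> V, (forall k, Y (v k)) ->
  (forall k, nh (v k.+1 - v k) <= 2^-1 ^+ k) ->
  exists2 w, Y w & nh (v k - w) @[k --> \oo] --> 0.
(** In the application: membership in [H01] and the gradient depend only on the almost everywhere
    class. It lets a limit found in [Y] identify a given element of [X]. *)
Hypothesis Ysat : forall w v, Y w -> X v -> nl (w - v) = 0 -> Y v /\ ng (w - v) = 0.
Hypotheses (DY : forall v, D v -> Y v)
  (Ddense : forall v (e : R), Y v -> 0 < e -> exists2 phi, D phi & nh (phi - v) < e).
(** For a test function [phi], [psi] is minus its Laplacian. *)
Hypothesis Dadjoint : forall phi, D phi -> exists2 psi, X psi & forall v, Y v -> g v phi = l v psi.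

Context (b : V -> V -> R) (Phi : V -> R) (c : R -> R).
Hypothesis b_lin : forall v a phi psi, Y v -> Y phi -> Y psi ->
  b v (a *: phi + psi) = a * b v phi + b v psi.
Hypothesis c0 : forall M, 0 <= c M.
Hypothesis b_est : forall v w phi (M : R), Y v -> Y w -> Y phi -> 0 < M -> ng v <= M -> ng w <= M ->
  [/\ `|b v phi - b w phi| <= c M * ng (v - w) * ng phi,
      `|Phi v - Phi w - b w (v - w)| <= c M * ng (v - w) ^+ 2 &
      `|b v phi| <= c M * ng phi].

Context (T : R) (u ut : R -> V) (utt : R -> V -> R).
Hypotheses (T0 : 0 < T) (Yu : forall t, 0 <= t <= T -> Y (u t))
  (Xut : forall t, 0 <= t <= T -> X (ut t)).
Hypothesis u_cont : forall t, 0 <= t <= T -> small T t (fun s => nh (u s - u t)).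
Hypothesis ut_cont : forall t, 0 <= t <= T -> small T t (fun s => nl (ut s - ut t)).
Hypothesis u_diff : forall t, 0 <= t <= T ->
  littleo_in T t (fun s => nl (u s - u t - (s - t) *: ut t)).
Hypothesis utt_lin : forall t a phi psi, 0 <= t <= T -> Y phi -> Y psi ->
  utt t (a *: phi + psi) = a * utt t phi + utt t psi.
Hypothesis utt_bounded : forall t, 0 <= t <= T -> exists C, forall phi, Y phi -> `|utt t phi| <= C * nh phi.
Hypothesis utt_cont : forall t e, 0 <= t <= T -> 0 < e ->
  near_in T t (fun s => forall phi, Y phi -> `|utt s phi - utt t phi| <= e * nh phi).
Hypothesis ut_diff : forall t e, 0 <= t <= T -> 0 < e ->
  near_in T t (fun s => forall phi, Y phi ->
    `|l (ut s) phi - l (ut t) phi - (s - t) * utt t phi| <= e * `|s - t| * nh phi).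

(** The equation solved for the damping term: the functional that [ut t] should represent through
    [g]. It is defined at every time, before [ut t] is known to lie in [Y]. *)
Let Lf t phi := b (u t) phi - utt t phi - g (u t) phi - l (ut t) phi.

(** What remains of an almost everywhere statement: good times near every t, possibly different ones
    for each [phi]. *)
Hypothesis weak_dense : forall phi t d, D phi -> 0 <= t <= T -> 0 < d ->
  exists s, [/\ 0 <= s <= T, `|s - t| < d, Y (ut s) & g (ut s) phi = Lf s phi].

Let silY : semi_inner Y l.
Proof.
apply: (semi_inner_sub YX (si0 sig) _ sil) => a v w; exact: (siP sig).
Qed.
Let sih : semi_inner Y h. Proof. exact: (semi_innerD silY sig). Qed.

Let nlh v : Y v -> nl v <= nh v.
Proof. by move=> Yv; rewrite ler_wsqrtr// lerDl; exact: (si_ge0 sig). Qed.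
Let ngh v : Y v -> ng v <= nh v.
Proof. by move=> Yv; rewrite ler_wsqrtr// lerDr; exact: (si_ge0 silY). Qed.

Let Lf_lin t a phi psi : 0 <= t <= T -> Y phi -> Y psi ->
  Lf t (a *: phi + psi) = a * Lf t phi + Lf t psi.
Proof.
move=> tT Yp Ys; have Yut := Yu tT.
rewrite /Lf b_lin// utt_lin// (si_sym sig (Yut) (siP sig a Yp Ys)) (siPl sig a Yp Ys Yut).
rewrite (si_sym sil (Xut tT) (YX (siP sig a Yp Ys))) (siPl sil a (YX Yp) (YX Ys) (Xut tT)).
rewrite (si_sym sig Yp Yut) (si_sym sig Ys Yut) (si_sym sil (YX Yp) (Xut tT)).
by rewrite (si_sym sil (YX Ys) (Xut tT)); ring.
Qed.

Let LfB t phi psi : 0 <= t <= T -> Y phi -> Y psi -> Lf t (phi - psi) = Lf t phi - Lf t psi.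
Proof.
move=> tT Yp Ys; have := @Lf_lin t (-1) psi phi tT Ys Yp.
by rewrite scaleN1r addrC => ->; ring.
Qed.

Let Lf_bounded t : 0 <= t <= T -> exists2 C, 0 <= C & forall phi, Y phi -> `|Lf t phi| <= C * nh phi.
Proof.
move=> tT; have [C CP] := utt_bounded tT; have Yut := Yu tT.
pose M := ng (u t) + 1; have M0 : 0 < M by rewrite ltr_wpDl ?nB_ge0.
have uM : ng (u t) <= M by rewrite lerDl.
exists (c M + `|C| + ng (u t) + nl (ut t)); first by rewrite !addr_ge0 ?nB_ge0.
move=> phi Yp; have [_ _ B] := b_est Yut Yut Yp M0 uM uM.
have G := si_CS sig Yut Yp; have L := si_CS sil (Xut tT) (YX Yp).
have gp := ngh Yp; have lp := nlh Yp; have N0 := nB_ge0 h phi.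
have B' : `|b (u t) phi| <= c M * nh phi by apply: (le_trans B); rewrite ler_wpM2l.
have G' : `|g (u t) phi| <= ng (u t) * nh phi by apply: (le_trans G); rewrite ler_wpM2l ?nB_ge0.
have L' : `|l (ut t) phi| <= nl (ut t) * nh phi by apply: (le_trans L); rewrite ler_wpM2l ?nB_ge0.
have C' : `|utt t phi| <= `|C| * nh phi by apply: (le_trans (CP _ Yp)); rewrite ler_wpM2r ?ler_norm.
by rewrite /Lf !mulrDl; do 3 (apply: (le_trans (ler_normB _ _)); apply: lerD => //).
Qed.

(** Each of the four terms is continuous in the dual norm and receives a quarter of e. Continuity of
    [ut] in [Y] is not among the inputs; it is derived from this. *)
Let Lf_cont t e : 0 <= t <= T -> 0 < e ->
  near_in T t (fun s => forall phi, Y phi -> `|Lf s phi - Lf t phi| <= e * nh phi).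
Proof.
move=> tT e0; have Yut := Yu tT.
pose M := ng (u t) + 1; have M0 : 0 < M by rewrite ltr_wpDl ?nB_ge0.
have uM : ng (u t) <= M by rewrite lerDl.
have e4 : 0 < e / 4 by lra.
have C1 : 0 < c M + 1 by rewrite ltr_wpDl.
have ec : 0 < e / 4 / (c M + 1) by rewrite divr_gt0.
have H1 := near_inI (u_cont tT ltr01) (u_cont tT ec).
have H2 := near_inI (u_cont tT e4) (near_inI (ut_cont tT e4) (utt_cont tT e4)).
apply: near_inS (near_inI H1 H2) => s sT [[h1 h2] [h3 [h4 h5]]] phi Yp.
have Yus := Yu sT; have Yd := siB_ sig Yus Yut.
rewrite (ger0_norm (nB_ge0 h _)) in h1 h2 h3; rewrite (ger0_norm (nB_ge0 l _)) in h4.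
have usM : ng (u s) <= M.
  by have := nB_le_dist sig Yus Yut; have := ngh Yd; rewrite /M; lra.
have [B _ _] := b_est Yus Yut Yp M0 usM uM.
have N0 := nB_ge0 h phi.
have B' : `|b (u s) phi - b (u t) phi| <= e / 4 * nh phi.
  apply: (le_trans B); apply: ler_pM; rewrite ?mulr_ge0 ?nB_ge0 ?ngh//.
  apply: (@le_trans _ _ ((c M + 1) * (e / 4 / (c M + 1)))).
    apply: ler_pM; rewrite ?nB_ge0 ?lerDl//; exact: le_trans (ngh Yd) h2.
  by rewrite mulrC divfK ?gt_eqF.
have G' : `|g (u s) phi - g (u t) phi| <= e / 4 * nh phi.
  rewrite -(siBl sig Yus Yut Yp); apply: (le_trans (si_CS sig Yd Yp)).
  by apply: ler_pM; rewrite ?nB_ge0 ?ngh//; exact: le_trans (ngh Yd) h3.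
have L' : `|l (ut s) phi - l (ut t) phi| <= e / 4 * nh phi.
  rewrite -(siBl sil (Xut sT) (Xut tT) (YX Yp)).
  apply: (le_trans (si_CS sil (siB_ sil (Xut sT) (Xut tT)) (YX Yp))).
  by apply: ler_pM; rewrite ?nB_ge0 ?nlh.
have U' := h5 phi Yp.
have -> : Lf s phi - Lf t phi = (b (u s) phi - b (u t) phi) - (utt s phi - utt t phi)
   - (g (u s) phi - g (u t) phi) - (l (ut s) phi - l (ut t) phi) by rewrite /Lf; ring.
have -> : e * nh phi = e / 4 * nh phi + e / 4 * nh phi + e / 4 * nh phi + e / 4 * nh phi by field.
by do 3 (apply: (le_trans (ler_normB _ _)); apply: lerD => //).
Qed.

(** Once the derivatives sit on [phi], both sides are continuous in t, so an identity at a dense set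
    of times holds at every time. *)
Let Lf_adjoint phi psi : D phi -> X psi -> (forall v, Y v -> g v phi = l v psi) ->
  forall t, 0 <= t <= T -> l (ut t) psi = Lf t phi.
Proof.
move=> Dp Xp gE t tT; have Yp := DY Dp.
have C0' : 0 <= nl psi + nh phi by rewrite addr_ge0 ?nB_ge0.
apply/eqP; rewrite -subr_eq0 -normr_le0; apply: (le0_small C0') => e e0.
have [d d0 dP] := near_inI (ut_cont tT e0) (Lf_cont tT e0).
have [s [sT sd Yus gs]] := weak_dense Dp tT d0.
have [h1 h2] := dP s sT sd; rewrite (ger0_norm (nB_ge0 l _)) in h1.
have -> : l (ut t) psi - Lf t phi = (Lf s phi - Lf t phi) - l (ut s - ut t) psi.
  by rewrite (siBl sil (Xut sT) (Xut tT) Xp) -(gE _ Yus) gs; ring.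
apply: (le_trans (ler_normB _ _)); rewrite addrC mulrDl; apply: lerD.
  apply: (le_trans (si_CS sil (siB_ sil (Xut sT) (Xut tT)) Xp)).
  by rewrite mulrC ler_wpM2l ?nB_ge0.
by rewrite [leRHS]mulrC; exact: h2.
Qed.

(** The crude constant [C] supplies the continuity that carries the sharp constant [K] from the
    dense set to [Y]. *)
Let dense_le v (F : V -> R) (C K : R) : 0 <= C -> Y v -> 0 <= K ->
  (forall phi psi, Y phi -> Y psi -> F (phi - psi) = F phi - F psi) ->
  (forall phi, Y phi -> `|F phi| <= C * nh phi) ->
  (forall phi, D phi -> `|F phi| <= K * nh phi) -> `|F v| <= K * nh v.
Proof.
move=> C0' Yv K0 FB FC FD; rewrite -subr_le0.
apply: (@le0_small _ _ (K + C)); first exact: addr_ge0.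
move=> e e0; have [phi Dp pv] := Ddense Yv e0; have Yp := DY Dp.
have Yd := siB_ sih Yp Yv.
have H1 := FD phi Dp; have H2 := FC _ Yd; have H3 := nB_le_dist sih Yp Yv.
have H4 : `|F v| <= `|F phi| + `|F (phi - v)|.
  have -> : F v = F phi - F (phi - v) by rewrite FB//; ring.
  exact: ler_normB.
have H5 : K * nh phi <= K * (nh v + nh (phi - v)) by rewrite ler_wpM2l.
have H6 : (K + C) * nh (phi - v) <= (K + C) * e by rewrite ler_wpM2l ?addr_ge0// ltW.
by move: H1 H2 H4 H5 H6; rewrite mulrDr !mulrDl; lra.
Qed.

Let Lf_grad s : 0 <= s <= T -> Y (ut s) -> forall phi, Y phi -> g (ut s) phi = Lf s phi.
Proof.
move=> sT Yus v Yv; have [C C0' CP] := Lf_bounded sT.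
apply/eqP; rewrite -subr_eq0 -normr_le0.
have := @dense_le v (fun phi => g (ut s) phi - Lf s phi) (ng (ut s) + C) 0.
rewrite mul0r; apply => //.
- by rewrite addr_ge0 ?nB_ge0.
- by move=> phi psi Yp Yq; rewrite (siBr sig Yp Yq Yus) LfB//; ring.
- move=> phi Yp; rewrite mulrDl; apply: (le_trans (ler_normB _ _)); apply: lerD.
    by apply: (le_trans (si_CS sig Yus Yp)); rewrite ler_wpM2l ?nB_ge0 ?ngh.
  exact: CP.
move=> phi Dp; have [psi Xp gE] := Dadjoint Dp.
by rewrite (gE _ Yus) (Lf_adjoint Dp Xp gE sT) subrr normr0 mul0r.
Qed.

(** Test the difference z of the velocities with z itself: [g z z] is the difference of the two
    functionals at z, hence at most 2e times the norm of z, and the Poincare constant [P] turns [g]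
    into the full norm. *)
Let ut_dist s s' t e : 0 <= e -> 0 <= s <= T -> 0 <= s' <= T -> 0 <= t <= T -> Y (ut s) -> Y (ut s') ->
  (forall phi, Y phi -> `|Lf s phi - Lf t phi| <= e * nh phi) ->
  (forall phi, Y phi -> `|Lf s' phi - Lf t phi| <= e * nh phi) ->
  nh (ut s - ut s') <= 2 * e * P ^+ 2.
Proof.
move=> e0 sT s'T tT Ys Ys' sL s'L; set z := ut s - ut s'; have Yz : Y z by exact: (siB_ sig).
have Pz := nhP Yz; have gz0 := nB_ge0 g z.
have h0 := nB_ge0 h z.
have z2 : ng z ^+ 2 <= 2 * e * nh z.
  rewrite (sqr_nB sig Yz) {1}/z (siBl sig Ys Ys' Yz) (Lf_grad sT Ys Yz) (Lf_grad s'T Ys' Yz).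
  have := sL z Yz; have := s'L z Yz; rewrite !ler_norml => /andP[h1 h2] /andP[h3 h4].
  have -> : 2 * e * nh z = e * nh z + e * nh z by ring.
  by lra.
have [ez|ez] := leP (nh z) 0.
  by apply: (le_trans ez); exact: (mulr_ge0 (mulr_ge0 (ler0n _ 2) e0) (sqr_ge0 _)).
have : nh z ^+ 2 <= P ^+ 2 * (2 * e * nh z).
  apply: (@le_trans _ _ ((P * ng z) ^+ 2)); first by rewrite ler_pXn2r ?nnegrE ?mulr_ge0 ?(ltW P0).
  by rewrite exprMn ler_wpM2l ?sqr_ge0.
by rewrite expr2 mulrA ler_pM2r// mulrC.
Qed.

(** Along good times tending to t the velocities are Cauchy in [Y] by [ut_dist]. Their limit is
    [ut t] because [ut] is continuous in [X]. *)
Lemma weak_velocity t : 0 <= t <= T -> Y (ut t).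
Proof.
move=> tT; have [phi0 Dp0 _] := Ddense (si0 sig) ltr01.
(* Makes the bound of [ut_dist] equal to 2^-k. The test function [phi0] only serves to extract good
   times from [weak_dense]. *)
pose e k : R := 2^-1 ^+ k / (2 * P ^+ 2).
have P2 : 0 < 2 * P ^+ 2 by rewrite mulr_gt0// exprn_gt0.
have q0 k : 0 < 2^-1 ^+ k :> R by rewrite exprn_gt0.
have e0 k : 0 < e k by rewrite divr_gt0.
have /choice[sq Psq] k : exists s, [/\ 0 <= s <= T, Y (ut s), nl (ut s - ut t) <= 2^-1 ^+ k &
    forall phi, Y phi -> `|Lf s phi - Lf t phi| <= e k * nh phi].
  have [d d0 dP] := near_inI (ut_cont tT (q0 k)) (Lf_cont tT (e0 k)).
  have [s [sT sd Yus _]] := weak_dense Dp0 tT d0.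
  have [h1 h2] := dP s sT sd; rewrite (ger0_norm (nB_ge0 l _)) in h1.
  by exists s.
have [k|k|w Yw cw] := @Ycomplete (fun k => ut (sq k)).
- by have [] := Psq k.
- have [s1 Y1 _ L1] := Psq k.+1; have [s2 Y2 _ L2] := Psq k.
  have L1' phi : Y phi -> `|Lf (sq k.+1) phi - Lf t phi| <= e k * nh phi.
    move=> Yp; apply: (le_trans (L1 phi Yp)); rewrite ler_wpM2r ?nB_ge0//.
    by rewrite ler_pM2r ?invr_gt0// exprS ler_piMl ?(ltW (q0 k))//; lra.
  apply: (le_trans (ut_dist (ltW (e0 k)) s1 s2 tT Y1 Y2 L1' L2)).
  rewrite /e (_ : _ * _ * _ = 2^-1 ^+ k)//; field; rewrite !gt_eqF//.
have Xw := YX Yw.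
suff wt : nl (w - ut t) = 0 by have [] := Ysat Yw (Xut tT) wt.
apply/eqP; rewrite eq_le nB_ge0 andbT.
have lim0 : nh (ut (sq k) - w) + 2^-1 ^+ k @[k --> \oo] --> (0 + 0 : R).
  by apply: cvgD cw _; apply: cvg_expr; rewrite ger0_norm; lra.
rewrite -[leRHS]addr0; apply: (ler_cvg_to (cvg_cst _) lim0); apply: nearW => k.
have [sT Ys hs _] := Psq k.
apply: (le_trans (nB_dist sil Xw (YX Ys) (Xut tT))); apply: lerD => //.
by rewrite (nBC sil Xw (YX Ys)); apply: nlh; exact: (siB_ sig).
Qed.

Lemma weak_velocity_grad t phi : 0 <= t <= T -> Y phi ->
  g (ut t) phi = b (u t) phi - utt t phi - g (u t) phi - l (ut t) phi.
Proof. by move=> tT; apply: Lf_grad => //; exact: weak_velocity. Qed.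

Lemma weak_velocity_cont t : 0 <= t <= T -> small T t (fun s => nh (ut s - ut t)).
Proof.
move=> tT e e0; have P2 : 0 < 2 * P ^+ 2 by rewrite mulr_gt0// exprn_gt0.
have e1 : 0 < e / (2 * P ^+ 2) by rewrite divr_gt0.
apply: near_inS (Lf_cont tT e1) => s sT sL; rewrite (ger0_norm (nB_ge0 h _)).
have tL phi : Y phi -> `|Lf t phi - Lf t phi| <= e / (2 * P ^+ 2) * nh phi.
  by move=> Yp; rewrite subrr normr0 mulr_ge0 ?nB_ge0 ?(ltW e1).
apply: (le_trans (ut_dist (ltW e1) sT tT tT (weak_velocity sT) (weak_velocity tT) sL tL)).
rewrite (_ : _ * _ * _ = e)//; field; rewrite !gt_eqF//.
Qed.

Let l_diff psi t : X psi -> 0 <= t <= T -> diff_in T (fun s => l (u s) psi) t (l (ut t) psi).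
Proof.
move=> Xp tT; have := littleo_inZ (nl psi) (u_diff tT); apply: littleo_in_le.
apply: near_inT => s sT; have Xd := YX (siB_ sig (Yu sT) (Yu tT)).
have Xs := siZ sil (s - t) (Xut tT).
have -> : l (u s) psi - l (u t) psi - l (ut t) psi * (s - t) = l (u s - u t - (s - t) *: ut t) psi.
  rewrite (siBl sil Xd Xs Xp) (siBl sil (YX (Yu sT)) (YX (Yu tT)) Xp).
  by rewrite (siZl sil _ (Xut tT) Xp) [(s - t) * _]mulrC.
by rewrite mulrC; apply: (si_CS sil (siB_ sil Xd Xs) Xp).
Qed.

(** Differentiability is given only in [X]. Paired with a test function it becomes differentiability
    of [g (u s) phi] with derivative [Lf s phi], whose continuity is uniform in [phi]; density and
    the choice of the error itself as argument give the norm. *)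
Lemma weak_strong_diff t : 0 <= t <= T -> littleo_in T t (fun s => nh (u s - u t - (s - t) *: ut t)).
Proof.
move=> tT e e0; have P2 : 0 < P ^+ 2 by rewrite exprn_gt0.
have e1 : 0 < e / P ^+ 2 by rewrite divr_gt0.
have [d d0 dP] := Lf_cont tT e1; exists d => // s sT sd.
rewrite (ger0_norm (nB_ge0 h _)); set z := u s - _ - _.
have Yd := siB_ sig (Yu sT) (Yu tT); have Yut := weak_velocity tT.
have Yz : Y z by exact: (siB_ sig Yd (siZ sig _ Yut)).
have gzE phi : Y phi -> g z phi = g (u s) phi - g (u t) phi - (s - t) * Lf t phi.
  move=> Yp; rewrite (siBl sig Yd (siZ sig _ Yut) Yp) (siBl sig (Yu sT) (Yu tT) Yp).
  by rewrite (siZl sig _ Yut Yp) (Lf_grad tT Yut Yp).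
have K0 : 0 <= e / P ^+ 2 * `|s - t| by rewrite mulr_ge0 ?(ltW e1).
have gz : `|g z z| <= e / P ^+ 2 * `|s - t| * nh z.
  apply: (@dense_le z (g z) (ng z)) => //; first exact: nB_ge0.
  - by move=> phi psi Yp Yq; exact: (siBr sig).
  - move=> phi Yp; apply: (le_trans (si_CS sig Yz Yp)); rewrite ler_wpM2l ?nB_ge0 ?ngh//.
  move=> phi Dp; have Yp := DY Dp; have [psi Xp gE] := Dadjoint Dp.
  have [st|st] := eqVneq s t.
    by rewrite (gzE _ Yp) st !subrr mul0r subrr normr0 mulr0 mul0r.
  (* The mean value theorem for [g (u s) phi], written as an [l]-pairing with the adjoint; its
     intermediate point depends on [phi], but stays within the distance where [Lf] is controlled
     uniformly. *)
  have [x [xT xt xE]] : exists x, [/\ 0 <= x <= T, `|x - t| <= `|s - t| &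
      g (u s) phi - g (u t) phi = Lf x phi * (s - t)].
    have mv (a b' : R) : 0 <= a -> a < b' -> b' <= T -> exists2 x, a < x < b' &
        g (u b') phi - g (u a) phi = Lf x phi * (b' - a).
      move=> a0 ab bT; have aT : 0 <= a <= T by apply/andP; split; lra.
      have bT' : 0 <= b' <= T by apply/andP; split; lra.
      have [x xab xE] := diff_in_mvt a0 ab bT (fun t tT => l_diff Xp tT).
      exists x => //; have xT : 0 <= x <= T by case/andP: xab => ? ?; apply/andP; split; lra.
      by rewrite (gE _ (Yu bT')) (gE _ (Yu aT)) xE (Lf_adjoint Dp Xp gE xT).
    move: (sT) (tT) => /andP[s0 sT'] /andP[t0 tT'].
    case: (ltgtP s t) st => // st _.
      have [x /andP[sx xt] xE] := mv s t s0 st tT'.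
      exists x; split; [by apply/andP; split; lra|by rewrite !ltr0_norm; lra|].
      by rewrite -opprB xE -mulrN opprB.
    have [x /andP[sx xt] xE] := mv t s t0 st sT'.
    by exists x; split; [apply/andP; split; lra|rewrite !gtr0_norm; lra|].
  rewrite gzE// xE [Lf x phi * _]mulrC -mulrBr normrM mulrC mulrAC.
  apply: (ler_wpM2r (normr_ge0 _)).
  exact: (dP x xT (le_lt_trans xt sd) phi Yp).
have Pz := nhP Yz; have h0 := nB_ge0 h z.
have [ez|ez] := leP (nh z) 0; first by apply: (le_trans ez); rewrite mulr_ge0// ltW.
have : nh z ^+ 2 <= P ^+ 2 * (e / P ^+ 2 * `|s - t| * nh z).
  apply: (@le_trans _ _ ((P * ng z) ^+ 2)).
    by rewrite ler_pXn2r ?nnegrE ?mulr_ge0 ?(ltW P0) ?nB_ge0.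
  rewrite exprMn ler_wpM2l ?sqr_ge0// (sqr_nB sig Yz); exact: le_trans (ler_norm _) gz.
rewrite expr2 mulrA ler_pM2r//.
by have -> : P ^+ 2 * (e / P ^+ 2 * `|s - t|) = e * `|s - t| by field; rewrite gt_eqF.
Qed.

Let u_lipschitz t : 0 <= t <= T -> exists2 C, 0 <= C &
  near_in T t (fun s => nh (u s - u t) <= C * `|s - t|).
Proof.
move=> tT; have Yut := weak_velocity tT; exists (nh (ut t) + 1); first by rewrite addr_ge0 ?nB_ge0.
apply: near_inS (weak_strong_diff tT ltr01) => s sT; rewrite (ger0_norm (nB_ge0 h _)) mul1r => H.
have Yd := siB_ sih (Yu sT) (Yu tT); have Ys := siZ sih (s - t) Yut.
have := nB_le_dist sih Yd Ys; rewrite (nBZ sih _ Yut) => /le_trans; apply.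
by rewrite mulrDl mul1r [nh _ * _]mulrC lerD2l.
Qed.

Let sqr_dist_littleo t : 0 <= t <= T -> littleo_in T t (fun s => nh (u s - u t) ^+ 2).
Proof.
move=> tT; have [C C0' CP] := u_lipschitz tT.
apply: littleo_in_le (littleo_in_mul (smallZ C (u_cont tT))).
apply: near_inS CP => s _ H; rewrite ger0_norm ?sqr_ge0// expr2 mulrCA mulrA.
by rewrite ler_wpM2r ?nB_ge0.
Qed.

Let quadratic_diff (B : V -> V -> R) t : semi_inner Y B -> (forall v, Y v -> seminorm_of B v <= nh v) ->
  0 <= t <= T -> diff_in T (fun s => B (u s) (u s)) t (2 * B (ut t) (u t)).
Proof.
move=> siB Bh tT; have Yut := weak_velocity tT; have Yt := Yu tT.
have H1 := littleo_inZ (2 * seminorm_of B (u t)) (weak_strong_diff tT).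
apply: littleo_in_le (littleo_inD H1 (sqr_dist_littleo tT)); apply: near_inT => s sT.
have Ys := Yu sT; have Yd := siB_ sih Ys Yt.
have Yz := siB_ sih Yd (siZ sih (s - t) Yut).
have -> : B (u s) (u s) - B (u t) (u t) - 2 * B (ut t) (u t) * (s - t) =
    2 * B (u s - u t - (s - t) *: ut t) (u t) + B (u s - u t) (u s - u t).
  rewrite (siBl siB Yd (siZ sih (s - t) Yut) Yt) (siBB siB Ys Yt) (siBl siB Ys Yt Yt).
  by rewrite (siZl siB _ Yut Yt); ring.
apply: (le_trans (ler_normD _ _)); apply: lerD.
  rewrite normrM ger0_norm// -mulrA ler_pM2l//; apply: (le_trans (si_CS siB Yz Yt)).
  by rewrite mulrC ler_wpM2l ?nB_ge0// Bh.
rewrite ger0_norm ?(si_ge0 siB)// -(sqr_nB siB Yd) ler_pXn2r ?nnegrE ?nB_ge0//; exact: Bh.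
Qed.

Let potential_diff t : 0 <= t <= T -> diff_in T (fun s => Phi (u s)) t (b (u t) (ut t)).
Proof.
move=> tT; have Yut := weak_velocity tT; have Yt := Yu tT.
pose M := ng (u t) + 1; have M0 : 0 < M by rewrite ltr_wpDl ?nB_ge0.
have uM : ng (u t) <= M by rewrite lerDl.
have H1 := littleo_inZ (c M) (weak_strong_diff tT).
have H2 := littleo_inZ (c M) (sqr_dist_littleo tT).
apply: littleo_in_le (littleo_inD H2 H1).
apply: near_inS (u_cont tT ltr01) => s sT; rewrite (ger0_norm (nB_ge0 h _)) => h1.
have Ys := Yu sT; have Yd := siB_ sih Ys Yt; have Yc := siZ sih (s - t) Yut.
have Yz := siB_ sih Yd Yc.
have usM : ng (u s) <= M.
  by have := nB_le_dist sig Ys Yt; have := ngh Yd; rewrite /M; lra.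
have [_ B1 _] := b_est Ys Yt Yz M0 usM uM; have [_ _ B2] := b_est Yt Yt Yz M0 uM uM.
have -> : Phi (u s) - Phi (u t) - b (u t) (ut t) * (s - t) =
    (Phi (u s) - Phi (u t) - b (u t) (u s - u t)) + b (u t) (u s - u t - (s - t) *: ut t).
  have -> : u s - u t - (s - t) *: ut t = - (s - t) *: ut t + (u s - u t) by rewrite scaleNr addrC.
  by rewrite (b_lin _ Yt Yut Yd); ring.
apply: (le_trans (ler_normD _ _)); apply: lerD.
  apply: (le_trans B1); rewrite ler_wpM2l// ler_pXn2r ?nnegrE ?nB_ge0//; exact: ngh.
by apply: (le_trans B2); rewrite ler_wpM2l// ngh.
Qed.

(** Half of a product rule: only [ut] is differentiated, in the dual, while [w] is merely continuous
    in [Y]. *)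
Let dual_diff t (w : R -> V) : 0 <= t <= T -> (forall s, 0 <= s <= T -> Y (w s)) ->
  small T t (fun s => nh (w s - w t)) ->
  littleo_in T t (fun s => l (ut s) (w s) - l (ut t) (w s) - utt t (w t) * (s - t)).
Proof.
move=> tT Yw cw; have [C CP] := utt_bounded tT; have Ywt := Yw t tT.
have H1 := littleo_in_mul (smallZ `|C| cw).
have H2 : littleo_in T t (fun s => l (ut s) (w s) - l (ut t) (w s) - (s - t) * utt t (w s)).
  move=> e e0; have N0 : 0 < nh (w t) + 1 by rewrite ltr_wpDl ?nB_ge0.
  have e1 : 0 < e / (nh (w t) + 1) by rewrite divr_gt0.
  apply: near_inS (near_inI (ut_diff tT e1) (cw _ ltr01)) => s sT [h1 h2].
  rewrite (ger0_norm (nB_ge0 h _)) in h2; have Yws := Yw s sT.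
  apply: (le_trans (h1 _ Yws)); have := nB_le_dist sih Yws Ywt => h3.
  have -> : e * `|s - t| = e / (nh (w t) + 1) * `|s - t| * (nh (w t) + 1).
    by field; rewrite gt_eqF.
  by apply: ler_wpM2l; [rewrite mulr_ge0 ?(ltW e1)|lra].
have H1' : littleo_in T t (fun s => (s - t) * utt t (w s - w t)).
  apply: littleo_in_le H1; apply: near_inT => s sT; rewrite normrM ler_wpM2l//.
  apply: (le_trans (CP _ (siB_ sih (Yw s sT) Ywt))).
  by rewrite ler_wpM2r ?nB_ge0// ler_norm.
apply: littleo_in_eq (littleo_inD H2 H1') => s sT; have Yws := Yw s sT.
have -> : utt t (w s - w t) = utt t (w s) - utt t (w t).
  by have := utt_lin (-1) tT Ywt Yws; rewrite scaleN1r addrC => ->; ring.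
by ring.
Qed.

(** With [w s = ut s + ut t] the difference in [dual_diff] is that of squares, so the kinetic energy
    is differentiated although [ut] is differentiable only in the dual. *)
Let kinetic_diff t : 0 <= t <= T -> diff_in T (fun s => l (ut s) (ut s)) t (2 * utt t (ut t)).
Proof.
move=> tT; have Yut := weak_velocity tT.
have Yw s : 0 <= s <= T -> Y (ut s + ut t) by move=> sT; exact: (siD sih (weak_velocity sT) Yut).
have cw : small T t (fun s => nh (ut s + ut t - (ut t + ut t))).
  by apply: small_eq (weak_velocity_cont tT) => s _; rewrite opprD addrA addrK.
apply: littleo_in_eq (dual_diff tT Yw cw) => s sT; have Yus := weak_velocity sT.
have -> : utt t (ut t + ut t) = 2 * utt t (ut t).
  by have := utt_lin 1 tT Yut Yut; rewrite scale1r => ->; ring.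
rewrite (siDr silY Yus Yut Yus) (siDr silY Yus Yut Yut) (si_sym silY Yut Yus); ring.
Qed.

Let cross_diff t : 0 <= t <= T ->
  diff_in T (fun s => l (u s) (ut s)) t (utt t (u t) + l (ut t) (ut t)).
Proof.
move=> tT; have Yut := weak_velocity tT; have Yt := Yu tT.
apply: littleo_in_eq (littleo_inD (dual_diff tT Yu (u_cont tT)) (l_diff (Xut tT) tT)) => s sT /=.
have Ys := Yu sT; have Yus := weak_velocity sT.
by rewrite (si_sym silY Ys Yus) (si_sym silY Ys Yut) (si_sym silY Yt Yut); ring.
Qed.

Let En s := 2^-1 * l (ut s) (ut s) + 2^-1 * g (u s) (u s) - Phi (u s).
Let Ne v := g v v - b v v.
Let Ps s := l (u s) (u s) + g (u s) (u s) + 2 * l (u s) (ut s).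

(** The equation is used at [phi = ut t], an element of [Y] at every time by [weak_velocity]. The
    potential and elastic terms cancel and the damping remains. *)
Lemma energy_diff t : 0 <= t <= T ->
  diff_in T En t (- g (ut t) (ut t) - l (ut t) (ut t)).
Proof.
move=> tT; have Yut := weak_velocity tT.
have D1 := diff_inZ 2^-1 (kinetic_diff tT).
have D2 := diff_inZ 2^-1 (quadratic_diff sig ngh tT).
have D3 := diff_inZ (-1) (potential_diff tT).
have := diff_inD (diff_inD D1 D2) D3; rewrite /diff_in; apply: littleo_in_eq => s _.
have U : utt t (ut t) = b (u t) (ut t) - g (ut t) (u t) - l (ut t) (ut t) - g (ut t) (ut t).
  by rewrite (weak_velocity_grad tT Yut) (si_sym sig (Yu tT) Yut); ring.
by rewrite U /En; field.
Qed.

(** The equation is used at [phi = u t]. Its two damping terms cancel the derivatives of the squared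
    norms in [Ps], which is why [Ps] contains the full norm of [u]. *)
Lemma virial_diff t : 0 <= t <= T ->
  diff_in T Ps t (2 * (l (ut t) (ut t) - Ne (u t))).
Proof.
move=> tT; have Yut := weak_velocity tT; have Yt := Yu tT.
have D1 := quadratic_diff silY nlh tT.
have D2 := quadratic_diff sig ngh tT.
have D3 := diff_inZ 2 (cross_diff tT).
have := diff_inD (diff_inD D1 D2) D3; rewrite /diff_in; apply: littleo_in_eq => s _.
have U : utt t (u t) = b (u t) (u t) - g (u t) (u t) - l (ut t) (u t) - g (ut t) (u t).
  by rewrite (weak_velocity_grad tT Yt); ring.
by rewrite U /Ps /Ne; ring.
Qed.

Lemma nehari_cont t : 0 <= t <= T -> small T t (fun s => Ne (u s) - Ne (u t)).
Proof.
move=> tT; have Yt := Yu tT.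
pose M := ng (u t) + 1; have M0 : 0 < M by rewrite ltr_wpDl ?nB_ge0.
have uM : ng (u t) <= M by rewrite lerDl.
have S1 := diff_in_small (quadratic_diff sig ngh tT).
have S2 := smallZ (2 * (c M * M)) (u_cont tT).
have S3 : small T t (fun s => b (u t) (u t) - b (u s) (u s)).
  apply: small_le S2; apply: near_inS (u_cont tT ltr01) => s sT; rewrite (ger0_norm (nB_ge0 h _)) => h1.
  have Ys := Yu sT; have Yd := siB_ sih Ys Yt; have hd := ngh Yd.
  have usM : ng (u s) <= M by have := nB_le_dist sig Ys Yt; rewrite /M; lra.
  have [B1 _ _] := b_est Ys Yt Ys M0 usM uM; have [_ _ B2] := b_est Yt Yt Yd M0 uM uM.
  have -> : b (u t) (u t) - b (u s) (u s) = - (b (u s) (u s) - b (u t) (u s)) - b (u t) (u s - u t).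
    have := @b_lin (u t) (-1) (u t) (u s) Yt Yt Ys; rewrite scaleN1r addrC => ->; ring.
  apply: (le_trans (ler_normB _ _)); rewrite normrN -mulrA mulr_natl mulr2n; apply: lerD.
    apply: (le_trans B1); rewrite -!mulrA ler_wpM2l// mulrC.
    by apply: ler_pM; rewrite ?nB_ge0.
  apply: (le_trans B2); rewrite -mulrA ler_wpM2l//; apply: (le_trans hd).
  rewrite ler_peMl ?nB_ge0// /M lerDr nB_ge0//.
by apply: small_eq (smallD S1 S3) => s _; rewrite /Ne; ring.
Qed.

Lemma unstable_invariant (lam p : R) : 0 < lam -> (forall v, Y v -> lam * l v v <= g v v) ->
  2 < p -> (forall v, Y v -> p * Phi v <= b v v) -> Ne (u 0) < 0 ->
  4 * p * (1 + lam) / ((p - 2) * lam) * En 0 < Ps 0 ->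
  forall t, 0 <= t <= T -> Ne (u t) < 0.
Proof.
move=> lam0 lamP p2 pP N0 init t tT; rewrite ltNge; apply/negP => Nt.
pose A := [set s | 0 <= s <= t /\ 0 <= Ne (u s)].
have tA : A t by split=> //; rewrite lexx andbT; case/andP: tT.
have infA : has_inf A by split; [exists t|exists 0 => s [/andP[]]].
pose t0 := inf A.
have t0t : t0 <= t by apply: inf_lbound => //; case: infA.
have t00 : 0 <= t0 by apply: lb_le_inf; [exists t|move=> s [/andP[]]].
have t0T : 0 <= t0 <= T by rewrite t00 (le_trans t0t)//; case/andP: tT.
have below s : 0 <= s -> s < t0 -> Ne (u s) < 0.
  move=> s0 st; rewrite ltNge; apply/negP => Ns.
  have : t0 <= s.
    by apply: inf_lbound; [case: infA|split=> //; rewrite s0 (le_trans (ltW st))].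
  by rewrite leNgt st.
(* The set of bad times is closed by [nehari_cont], so its infimum is a bad time. *)
have Nt0 : 0 <= Ne (u t0).
  rewrite leNgt; apply/negP => neg.
  have e0 : 0 < - Ne (u t0) / 2 by lra.
  have [d d0 dP] := nehari_cont t0T e0.
  have [s [sT Ns] sd] := inf_adherent d0 infA.
  have t0s : t0 <= s by apply: inf_lbound; [case: infA|].
  have sT' : 0 <= s <= T by case/andP: sT => -> /= /le_trans; apply; case/andP: tT.
  have sd' : `|s - t0| < d by rewrite ger0_norm ?subr_ge0// ltrBlDl.
  by have := dP s sT' sd'; rewrite ler_norml => /andP[]; lra.
have t0p : 0 < t0.
  by rewrite lt_def t00 andbT; apply/eqP => z; move: Nt0; rewrite z leNgt N0.
have t0T' : t0 <= T by case/andP: t0T.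
have [x /andP[x0 xt] xE] := diff_in_mvt (lexx 0) t0p t0T' virial_diff.
have [y /andP[y0 yt] yE] := diff_in_mvt (lexx 0) t0p t0T' energy_diff.
have xT : 0 <= x <= T by apply/andP; split; lra.
have yT : 0 <= y <= T by apply/andP; split; lra.
have Pinc : Ps 0 <= Ps t0.
  rewrite -subr_ge0 xE mulr_ge0 ?subr0 ?(ltW t0p)// mulr_ge0//.
  by rewrite subr_ge0 (le_trans (ltW (below x (ltW x0) xt)))// (si_ge0 sil (Xut xT)).
have Edec : En t0 <= En 0.
  rewrite -subr_le0 yE mulr_le0_ge0 ?subr0 ?(ltW t0p)//.
  have := si_ge0 sil (Xut yT); have := si_ge0 sig (weak_velocity yT); lra.
have C0' : 0 < 4 * p * (1 + lam) / ((p - 2) * lam).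
  by rewrite divr_gt0// ?mulr_gt0//; lra.
have Yt0 := Yu t0T; have Xt0 := Xut t0T.
have E1 : 4 * p * (1 + lam) / ((p - 2) * lam) * En t0 <= 4 * p * (1 + lam) / ((p - 2) * lam) * En 0.
  by rewrite ler_wpM2l// ltW.
suff : Ps t0 <= 4 * p * (1 + lam) / ((p - 2) * lam) * En t0 by lra.
(* At a bad time the gradient term dominates the nonlinear one, so (H1) bounds the potential by the
   gradient. *)
have gP : p * Phi (u t0) <= g (u t0) (u t0) by apply: (le_trans (pP _ Yt0)); rewrite -subr_ge0.
have CS : 2 * l (u t0) (ut t0) <= l (u t0) (u t0) + l (ut t0) (ut t0).
  have := si_ge0 sil (siB_ sil (YX Yt0) Xt0); rewrite (siBB sil (YX Yt0) Xt0); lra.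
have lg := lamP _ Yt0.
have l0 := si_ge0 sil Xt0; have g0 := si_ge0 sig Yt0.
rewrite /Ps /En; move: gP CS lg l0 g0.
move: (l (u t0) (u t0)) (l (u t0) (ut t0)) (l (ut t0) (ut t0)) (g _ _) (Phi _).
move=> a m k G F gP CS lg l0 g0.
exact: (virial_le_energy p2 lam0).
Qed.

End evolution.

(** * Weak solutions *)

Section convergence.
Context (R : realType) (T : R).
Implicit Types (t : R) (F : R -> R).

Lemma cvg_within_small t F :
  F s @[s --> within `[0, T] (nbhs t)] --> 0 -> small T t F.
Proof.
move=> /cvgrPdist_le FT e e0; have := FT e e0; rewrite near_withinE => -[d /= d0 dP].
exists d => // s sT st; have := dP s; rewrite sub0r normrN; apply.
  by rewrite /ball/= distrC.
by rewrite /= in_itv.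
Qed.

(** The limits of difference quotients leave out s = t, while [littleo_in] includes it; hence the
    separate condition on [F t]. *)
Lemma cvg_within_littleo t F (G : R -> R) : F t = 0 ->
  (forall s, 0 <= s <= T -> s != t -> `|F s| <= `|s - t| * G s) ->
  G s @[s --> within `[0, T] (dnbhs t)] --> 0 -> littleo_in T t F.
Proof.
move=> Ft FG /cvgrPdist_le GT e e0; have := GT e e0; rewrite near_withinE => -[d /= d0 dP].
exists d => // s sT st; have [->|sNt] := eqVneq s t.
  by rewrite Ft normr0 subrr normr0 mulr0.
apply: (le_trans (FG s sT sNt)); rewrite mulrC ler_wpM2r//.
apply: (le_trans (ler_norm _)).
have := dP s; rewrite sub0r normrN; apply=> //.
by rewrite /ball_/= distrC.
Qed.

(** A null set contains no interval of positive length, and the d-neighbourhood of t within [0, T]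
    contains one because T > 0. *)
Lemma ae_dense (Q : R -> Prop) t d : 0 < T -> 0 <= t <= T -> 0 < d ->
  {ae @lebesgue_measure R, forall s : measurableTypeR R, `[0, T]%classic s -> Q s} ->
  exists s, [/\ 0 <= s <= T, `|s - t| < d & Q s].
Proof.
move=> T0 /andP[t0 tT] d0 [N [mN N0 QN]]; apply: contrapT => nQ.
pose a := Num.max 0 (t - d); pose b := Num.min T (t + d).
have ab : a < b by rewrite /a /b gt_max !lt_min T0; apply/andP; split; apply/andP; split; lra.
pose J : set (measurableTypeR R) := `]a, b[%classic.
have mJ : measurable J by exact: measurable_itv.
have JN : J `<=` N.
  move=> s; rewrite /J /= in_itv/= gt_max lt_min => /andP[/andP[h1 h2] /andP[h3 h4]].
  apply: QN => /= H; apply: nQ; exists s; split.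
  - by rewrite (ltW h1) (ltW h3).
  - by rewrite ltr_norml; apply/andP; split; lra.
  - by apply: H; rewrite in_itv/= (ltW h1) (ltW h3).
have := le_measure (@lebesgue_measure R) (mem_set mJ) (mem_set mN) JN.
have JE : lebesgue_measure J = (b - a)%:E.
  by rewrite /J lebesgue_measure_itv/= lte_fin ab -EFinD.
move=> JN0; have : (lebesgue_measure J <= 0)%E by rewrite -N0.
by rewrite JE lee_fin leNgt subr_gt0 ab.
Qed.

End convergence.

Lemma si_sumr (R : realType) (V : lmodType R) (X : V -> Prop) (B : V -> V -> R)
    (J : Type) (r : seq J) (f : J -> V) w : semi_inner X B -> X w -> (forall j, X (f j)) ->
  X (\sum_(j <- r) f j) /\ B w (\sum_(j <- r) f j) = \sum_(j <- r) B w (f j).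
Proof.
move=> siB Xw Xf; elim: r => [|j r [Xs IH]].
  by rewrite !big_nil; split; [exact: (si0 siB)|rewrite (si_sym siB Xw (si0 siB)) (si0l siB Xw)].
rewrite !big_cons; split; first exact: (siD siB).
by rewrite (siDr siB (Xf j) Xs Xw) IH.
Qed.

(** * Dual norms, adjoints and saturation *)

Section dual.
Context (R : realType) (n : nat) (Omega : set 'rV[R]_n).
Hypotheses (oO : open Omega) (bO : bounded_set Omega).
Local Notation mu := (lebesgue_rV R n).
Local Notation test := (test_function Omega).
Implicit Types (phi v w : 'rV[R]_n -> R) (k m : ('rV[R]_n -> R) -> R).

Let mO : measurable Omega. Proof. exact: domain_measurable. Qed.
Let si2 := l2_semi_inner mO.
Let si1 := h1_semi_inner oO bO.
Let sig := grad_semi_inner_H01 oO bO.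
Local Opaque Rintegral l2dot l2norm graddot h1norm.

Lemma Hm1_0 k : Hm1 Omega k -> k 0 = 0.
Proof.
move=> [kL _]; have := kL 1 0 0 (si0 si1) (si0 si1).
by rewrite scale1r addr0 mul1r => /eqP; rewrite -subr_eq0 opprD addNKr oppr_eq0 => /eqP.
Qed.

Lemma Hm1Z k a v : Hm1 Omega k -> H01 Omega v -> k (a *: v) = a * k v.
Proof.
by move=> Hk Hv; have [kL _] := Hk; rewrite -[a *: v]addr0 (kL a v 0 Hv (si0 si1)) (Hm1_0 Hk) addr0.
Qed.

Lemma Hm1_lin a k m : Hm1 Omega k -> Hm1 Omega m -> Hm1 Omega (a *: k + m).
Proof.
move=> [kL [C kC]] [mL [C' mC]]; split.
  move=> b u v Hu Hv; change ((a *: k + m) (b *: u + v)) with (a * k (b *: u + v) + m (b *: u + v)).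
  change ((a *: k + m) u) with (a * k u + m u); change ((a *: k + m) v) with (a * k v + m v).
  by rewrite (kL _ _ _ Hu Hv) (mL _ _ _ Hu Hv); ring.
exists (`|a| * C + C') => v Hv; change ((a *: k + m) v) with (a * k v + m v).
apply: (le_trans (ler_normD _ _)); rewrite normrM mulrDl -mulrA.
by apply: lerD; [apply: ler_wpM2l => //; exact: kC|exact: mC].
Qed.

Lemma Hm1_le k v : Hm1 Omega k -> H01 Omega v -> `|k v| <= hm1norm Omega k * h1norm Omega v.
Proof.
move=> Hk Hv; have [kL [C kC]] := Hk.
(* An element of norm 0 cannot be scaled to the unit sphere; boundedness of the functional makes it
   vanish there. *)
have := h1norm_ge0 Omega v; rewrite le_eqVlt => /predU1P[v0|v0].
  by have := kC v Hv; rewrite -v0 !mulr0.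
rewrite -ler_pdivrMr// mulrC.
have Hw := siZ si1 (h1norm Omega v)^-1 Hv.
apply: sup_ubound.
  exists `|C| => _ [z [Hz z1] <-]; apply: (le_trans (kC z Hz)).
  apply: (@le_trans _ _ (`|C| * h1norm Omega z)).
    by apply: ler_wpM2r; [exact: h1norm_ge0|exact: ler_norm].
  by rewrite ler_piMr.
exists ((h1norm Omega v)^-1 *: v).
  split=> //; rewrite (h1norm_seminorm oO Hw) (nBZ si1 _ Hv) -(h1norm_seminorm oO Hv).
  by rewrite gtr0_norm ?invr_gt0// mulVf// gt_eqF.
by rewrite (Hm1Z _ Hk Hv) normrM gtr0_norm ?invr_gt0.
Qed.

(** The adjoint is minus the Laplacian of [phi]. The identity is the definition of the weak
    derivatives of [v], tested with the partial derivatives of [phi]. *)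
Lemma test_adjoint phi : test phi ->
  exists2 psi, L2 Omega psi & forall v, H01 Omega v -> graddot Omega v phi = l2dot Omega v psi.
Proof.
move=> tp; pose f (i : 'I_n) : 'rV[R]_n -> R := - partial i (partial i phi).
have tpi i := test_partial i tp.
have Lf i : L2 Omega (f i) by apply: (siN si2); exact/test_L2/test_partial.
exists (\sum_i f i) => [|v Hv]; first by have [] := si_sumr (index_enum 'I_n) si2 (si0 si2) Lf.
have Hv1 := H01_H1 Hv; have Hp1 := test_H1 oO bO tp.
have [_ ->] := si_sumr (index_enum 'I_n) si2 (H01_L2 Hv) Lf.
rewrite (graddotE oO Hv1 Hp1); apply: eq_bigr => i _.
have [Lw wE] := wpartialP i Hv1.
have Lpp : L2 Omega (partial i (partial i phi)) by exact/test_L2/test_partial.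
rewrite (siNr si2 Lpp (H01_L2 Hv)) (wE _ (tpi i)) opprK.
have Lb : L2 Omega (wpartial Omega i phi) by exact: (wpartial_L2 i Hp1).
have La : L2 Omega (partial i phi) by exact: test_L2.
rewrite (si_sym si2 Lw Lb) (si_sym si2 Lw La).
exact: (l2dot_ae_eq mO Lb La Lw (wpartial_test oO bO i tp)).
Qed.

Lemma H01_saturated w v : H01 Omega w -> L2 Omega v -> l2norm Omega (w - v) = 0 ->
  H01 Omega v /\ seminorm_of (graddot Omega) (w - v) = 0.
Proof.
move=> Hw Lv wv0; have Lw := H01_L2 Hw; have Ld := siB_ si2 Lw Lv.
have ae0 := l2norm_eq0_ae mO Ld wv0.
have aewv : ae_eq mu Omega w v.
  by apply: filterS ae0 => x /[apply]; rewrite fct_subE => /eqP; rewrite subr_eq0 => /eqP.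
have Hv : H01 Omega v by exact: (H01_ae_eq oO bO Hw Lv aewv).
split=> //; have Hd := siB_ si1 Hw Hv.
have -> : seminorm_of (graddot Omega) (w - v) = Num.sqrt (graddot Omega (w - v) (w - v)) by [].
rewrite (graddot_ae_eq oO bO Ld (si0 si2) ae0).
by rewrite (si0l sig Hd) sqrtr0.
Qed.

End dual.

Lemma nB_eq (R : realType) (V : lmodType R) (X : V -> Prop) (B : V -> V -> R) (v w : V) :
  semi_inner X B -> X v -> X w -> seminorm_of B (v - w) = 0 -> B v v = B w w.
Proof.
move=> siB Xv Xw d0; rewrite -(sqr_nB siB Xv) -(sqr_nB siB Xw); congr (_ ^+ 2).
have d1 := nB_le_dist siB Xv Xw; have d2 := nB_le_dist siB Xw Xv.
rewrite (nBC siB Xw Xv) d0 addr0 in d2; rewrite d0 addr0 in d1.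
by apply/eqP; rewrite eq_le d1 d2.
Qed.

Lemma isolate_third (R : realType) (a b c d e : R) : a + b + c + d = e -> c = e - a - b - d.
Proof. by move=> <-; ring. Qed.

Section application.
Context (R : realType) (n : nat) (Omega : set 'rV[R]_n).
Hypotheses (n0 : (0 < n)%N) (oO : open Omega) (bO : bounded_set Omega).
Context (f : R -> R) (k0 k1 l1 : R).
Hypotheses (C1f : C1_fun f) (hk0 : 0 < k0) (hk1 : 0 < k1) (hl1 : 0 < l1).
Hypothesis df_le : forall s : R, `|derive1 f s| <= k0 + k1 * `|s| `^ l1.
Hypothesis subcritical : (2 < n)%N -> (l1 + 2) * (n%:R - 2) <= 2 * n%:R.
Local Notation test := (test_function Omega).
Local Notation ng := (seminorm_of (graddot Omega)).
Implicit Types (phi v w : 'rV[R]_n -> R).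

Let mO : measurable Omega. Proof. exact: domain_measurable. Qed.
Let si2 := l2_semi_inner mO.
Let si1 := h1_semi_inner oO bO.
Let sig := grad_semi_inner_H01 oO bO.
Local Opaque Rintegral l2dot l2norm graddot h1norm nonlin potential.

(** The initial condition gives [u 0 = u0] only almost everywhere. The estimates of
    [nonlin_estimates] at distance zero show that the nonlinear terms do not see the difference. *)
Lemma nonlin_congr v w : H01 Omega v -> H01 Omega w -> ng (v - w) = 0 ->
  nonlin Omega f v v = nonlin Omega f w w /\ potential Omega f v = potential Omega f w.
Proof.
move=> Hv Hw d0; have [c c0 cP] := nonlin_estimates n0 oO bO C1f hk0 hk1 hl1 df_le subcritical.
have Hd := siB_ si1 Hv Hw.
pose M := ng v + ng w + 1.
have M0 : 0 < M by rewrite ltr_wpDl// addr_ge0 ?nB_ge0.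
have vM : ng v <= M by rewrite /M -addrA lerDl addr_ge0 ?nB_ge0.
have wM : ng w <= M by rewrite /M -addrA addrC -addrA lerDl addr_ge0 ?nB_ge0.
have [B1 _ _] := cP v w v M Hv Hw Hv M0 vM wM.
have [_ B2 B3] := cP v w (v - w) M Hv Hw Hd M0 vM wM.
have [_ _ B4] := cP w w (v - w) M Hw Hw Hd M0 wM wM.
move: B1 B2 B4; rewrite d0 expr0n !mulr0 mul0r !normr_le0 => /eqP B1 /eqP B2 /eqP B4.
have E : nonlin Omega f w v = nonlin Omega f w (v - w) + nonlin Omega f w w.
  have := nonlin_lin n0 oO bO C1f hk0 hk1 hl1 df_le subcritical 1 Hw Hd Hw.
  by rewrite scale1r subrK mul1r.
split; first by move: B1; rewrite E B4 add0r => /eqP; rewrite subr_eq0 => /eqP.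
by move: B2; rewrite B4 subr0 => /eqP; rewrite subr_eq0 => /eqP.
Qed.

Lemma weak_solution_unstable (lambda p T : R) u0 u1 (u : R -> 'rV[R]_n -> R) :
  first_dirichlet_eigenvalue Omega lambda -> 2 < p ->
  (forall s, p * primitive f s <= s * f s) ->
  H01 Omega u0 -> L2 Omega u1 -> nehari Omega f u0 < 0 ->
  h1norm Omega u0 ^+ 2 + 2 * l2dot Omega u0 u1 >
    4 * p * (1 + lambda) / ((p - 2) * lambda) * energy Omega f u0 u1 ->
  0 < T -> weak_solution Omega f u0 u1 T u ->
  forall t, 0 <= t <= T -> H01 Omega (u t) /\ nehari Omega f (u t) < 0.
Proof.
move=> lam p2 pF Hu0 Lu1 N0 init T0 [ut [utt [[uC uC1 [uD utD] utL2] [uu0 utu1 weak]]]] t tT.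
have [lam0 lamP] := first_eigenvalue_le oO bO n0 lam.
have I s : 0 <= s <= T -> `[0, T]%classic s by rewrite /= in_itv.
have Hu s : 0 <= s <= T -> H01 Omega (u s) by move=> /I /uC[].
split; first exact: Hu.
have [_ utC0 uDq] := uC1.
have Lut s : 0 <= s <= T -> L2 Omega (ut s) by move=> /I /utC0[].
have [K K0 KP] := poincare oO bO n0.
have [c c0 cP] := nonlin_estimates n0 oO bO C1f hk0 hk1 hl1 df_le subcritical.
pose nh := seminorm_of (fun u v => l2dot Omega u v + graddot Omega u v).
have nhE v : H01 Omega v -> nh v = h1norm Omega v.
  by move=> Hv; rewrite (h1norm_seminorm oO Hv).
have P0 : 0 < K + 1 by rewrite ltr_wpDl// ltW.
have nhP v : H01 Omega v -> nh v <= (K + 1) * ng v.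
  move=> Hv; apply: (@le_trans _ _ (l2norm Omega v + ng v)); last first.
    by rewrite mulrDl mul1r; apply: lerD => //; exact: KP.
  rewrite (nhE v Hv) -(@ler_pXn2r _ 2)// ?nnegrE ?addr_ge0 ?l2norm_ge0 ?h1norm_ge0 ?nB_ge0//.
  rewrite (sqr_h1norm oO bO (H01_H1 Hv)) -(sqr_nB sig Hv) sqrrD.
  by rewrite -addrA lerD2l lerDr mulrn_wge0// mulr_ge0 ?l2norm_ge0 ?nB_ge0.
have Yc (v : nat -> 'rV[R]_n -> R) : (forall k, H01 Omega (v k)) ->
    (forall k, nh (v k.+1 - v k) <= 2^-1 ^+ k) ->
    exists2 w, H01 Omega w & nh (v k - w) @[k --> \oo] --> 0.
  move=> Hv dv; have [|z [Hz cz _]] := @H01_complete _ _ _ oO bO v Hv.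
    by move=> k; rewrite -(nhE _ (siB_ si1 (Hv _) (Hv _))); exact: dv.
  exists z; first exact: Hz.
  rewrite (_ : (fun k => _) = fun k => h1norm Omega (v k - z)); first exact: cz.
  by apply/funext => k; rewrite (nhE _ (siB_ si1 (Hv _) Hz)).
have Dd v (e : R) : H01 Omega v -> 0 < e -> exists2 phi, test phi & nh (phi - v) < e.
  move=> Hv e0; have [_ /(_ e e0)[phi tp pv]] := (H01P Omega v).1 Hv.
  by exists phi; [exact: tp|rewrite (nhE _ (siB_ si1 (test_H01 oO bO tp) Hv))].
have u_cont s : 0 <= s <= T -> small T s (fun r => nh (u r - u s)).
  move=> sT; have [_ /cvg_within_small] := uC s (I s sT); apply: small_eq => r rT.
  by rewrite (nhE _ (siB_ si1 (Hu _ rT) (Hu _ sT))).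
have ut_cont s : 0 <= s <= T -> small T s (fun r => seminorm_of (l2dot Omega) (ut r - ut s)).
  by move=> sT; have [_ /cvg_within_small] := utC0 s (I s sT).
have quot (a : R) (x y z : 'rV[R]_n -> R) : a != 0 ->
    x - y - a *: z = a *: (a^-1 *: (x - y) - z).
  by move=> a0; rewrite scalerBr scalerA divff// scale1r.
have u_diff s : 0 <= s <= T ->
    littleo_in T s (fun r => seminorm_of (l2dot Omega) (u r - u s - (r - s) *: ut s)).
  move=> sT; apply: cvg_within_littleo (uDq s (I s sT)).
    by rewrite !subrr scale0r subrr (nB0 si2).
  move=> r rT rs; rewrite quot ?subr_eq0// (nBZ si2).
    by rewrite normrM normr_id ger0_norm ?nB_ge0.
  apply: (siB_ si2 _ (Lut s sT)); apply: (siZ si2).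
  exact: (siB_ si2 (H01_L2 (Hu r rT)) (H01_L2 (Hu s sT))).
have [utD1 uttC uttq] := utD.
have Hutt s : 0 <= s <= T -> Hm1 Omega (utt s) by move=> /I /uttC[].
have HmU s : 0 <= s <= T -> Hm1 Omega (l2_hm1 Omega (ut s)).
  by move=> /I /utD1[].
have utt_lin s a phi psi : 0 <= s <= T -> H01 Omega phi -> H01 Omega psi ->
    utt s (a *: phi + psi) = a * utt s phi + utt s psi.
  by move=> /Hutt[+ _]; apply.
have utt_bd s : 0 <= s <= T -> exists C, forall phi, H01 Omega phi -> `|utt s phi| <= C * nh phi.
  by move=> /Hutt[_ [C CP]]; exists C => phi Hp; rewrite (nhE _ Hp); exact: CP.
have HmB k m : Hm1 Omega k -> Hm1 Omega m -> Hm1 Omega (k - m).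
  by move=> Hk Hm; rewrite addrC -scaleN1r; exact: (Hm1_lin (-1) Hm Hk).
have HmZ a k : Hm1 Omega k -> Hm1 Omega (a *: k).
  by move=> Hk; have := HmB _ _ Hk Hk; rewrite subrr -[a *: k]addr0; exact: Hm1_lin.
have utt_cont s e : 0 <= s <= T -> 0 < e ->
    near_in T s (fun r => forall phi, H01 Omega phi -> `|utt r phi - utt s phi| <= e * nh phi).
  move=> sT e0; have [_ /cvg_within_small /(_ e e0)] := uttC s (I s sT).
  apply: near_inS => r rT H phi Hp; rewrite (nhE _ Hp).
  apply: (le_trans (Hm1_le oO bO (HmB _ _ (Hutt r rT) (Hutt s sT)) Hp)).
  by apply: ler_wpM2r; [exact: h1norm_ge0|exact: le_trans (ler_norm _) H].
have ut_diff s e : 0 <= s <= T -> 0 < e ->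
    near_in T s (fun r => forall phi, H01 Omega phi ->
      `|l2dot Omega (ut r) phi - l2dot Omega (ut s) phi - (r - s) * utt s phi| <=
      e * `|r - s| * nh phi).
  move=> sT e0.
  (* The error of the difference quotient, a functional. Its dual norm tends to 0, and [Hm1_le]
     turns this into a bound uniform in the test function. *)
  pose k r := (r - s)^-1 *: (l2_hm1 Omega (ut r) - l2_hm1 Omega (ut s)) - utt s.
  have Hk r : 0 <= r <= T -> Hm1 Omega (k r).
    by move=> rT; exact: (HmB _ _ (HmZ _ _ (HmB _ _ (HmU r rT) (HmU s sT))) (Hutt s sT)).
  have := cvg_norm (uttq s (I s sT)); rewrite normr0 => ck.
  have : littleo_in T s (fun r => `|r - s| * hm1norm Omega (k r)).
    apply: (@cvg_within_littleo R T s _ (fun r => `|hm1norm Omega (k r)|)).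
    - by rewrite subrr normr0 mul0r.
    - by move=> r _ _; rewrite normrM normr_id.
    - exact: ck.
  move=> /(_ e e0); apply: near_inS => r rT; rewrite normrM normr_id => H phi Hp.
  have [->|rs] := eqVneq r s.
    by rewrite !subrr mul0r subrr normr0 mulr0 mul0r.
  have rs0 : r - s != 0 by rewrite subr_eq0.
  have -> : l2dot Omega (ut r) phi - l2dot Omega (ut s) phi - (r - s) * utt s phi = (r - s) * k r phi.
    change (k r phi) with ((r - s)^-1 * (l2dot Omega (ut r) phi - l2dot Omega (ut s) phi) - utt s phi).
    by field.
  rewrite normrM (nhE _ Hp) mulrC; apply: (le_trans (ler_wpM2r (normr_ge0 _) (Hm1_le oO bO (Hk r rT) Hp))).
  rewrite mulrAC; apply: ler_wpM2r; first exact: h1norm_ge0.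
  by rewrite mulrC; apply: (le_trans _ H); rewrite ler_wpM2l// ler_norm.
have wd phi s d : test phi -> 0 <= s <= T -> 0 < d ->
    exists r, [/\ 0 <= r <= T, `|r - s| < d, H01 Omega (ut r) &
      graddot Omega (ut r) phi = nonlin Omega f (u r) phi - utt r phi - graddot Omega (u r) phi
        - l2dot Omega (ut r) phi].
  move=> tp sT d0; have [utH _ _] := utL2.
  have ae2 := weak phi (test_H01 oO bO tp).
  pose Q r := H01 Omega (ut r) /\ utt r phi + graddot Omega (u r) phi + graddot Omega (ut r) phi
    + l2dot Omega (ut r) phi = nonlin Omega f (u r) phi.
  (* For a fixed test function, the equation and the membership of [ut r] in [H01] hold together off
     one null set of times. *)
  have aeQ : {ae @lebesgue_measure R, forall r : measurableTypeR R, `[0, T]%classic r -> Q r}.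
    by apply: filterS2 utH ae2 => r h1 h2 rT; split; [exact: h1|exact: (h2 rT)].
  have [r [rT rs [Hr Er]]] := ae_dense T0 sT d0 aeQ.
  exists r; split; [exact: rT|exact: rs|exact: Hr|].
  exact: (isolate_third Er).
have T00 : 0 <= (0 : R) <= T by rewrite lexx ltW.
have H0 := Hu 0 T00; have L0 := Lut 0 T00.
have l00 : l2norm Omega (u 0 - u0) = 0.
  have Ld := siB_ si2 (H01_L2 H0) (H01_L2 Hu0); have [md _] := Ld.
  apply: (l2norm_ae0 mO md); apply: filterS uu0 => x /[apply] E.
  by rewrite fct_subE E subrr.
have [_ g00] := H01_saturated oO bO H0 (H01_L2 Hu0) l00.
have [nonE potE] := nonlin_congr H0 Hu0 g00.
have gE : graddot Omega (u 0) (u 0) = graddot Omega u0 u0.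
  exact: (nB_eq sig H0 Hu0 g00).
have neE v : nehari Omega f v = graddot Omega v v - nonlin Omega f v v by [].
have utE : l2dot Omega (ut 0) (ut 0) = l2dot Omega u1 u1.
  by rewrite (l2dot_ae_eq mO L0 Lu1 L0 utu1) (si_sym si2 Lu1 L0) (l2dot_ae_eq mO L0 Lu1 Lu1 utu1).
have uE : l2dot Omega (u 0) (u 0) = l2dot Omega u0 u0.
  have L := H01_L2 H0; have L' := H01_L2 Hu0.
  by rewrite (l2dot_ae_eq mO L L' L uu0) (si_sym si2 L' L) (l2dot_ae_eq mO L L' L' uu0).
have uutE : l2dot Omega (u 0) (ut 0) = l2dot Omega u0 u1.
  have L := H01_L2 H0; have L' := H01_L2 Hu0.
  by rewrite (l2dot_ae_eq mO L L' L0 uu0) (si_sym si2 L' L0) (l2dot_ae_eq mO L0 Lu1 L' utu1) (si_sym si2 Lu1 L').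
have pot v : H01 Omega v -> p * potential Omega f v <= nonlin Omega f v v.
  by move=> Hv; exact: (potential_le_nonlin n0 oO bO C1f hk0 hk1 hl1 df_le subcritical pF Hv).
have nl v a phi psi : H01 Omega v -> H01 Omega phi -> H01 Omega psi ->
    nonlin Omega f v (a *: phi + psi) = a * nonlin Omega f v phi + nonlin Omega f v psi.
  by move=> Hv; exact: (nonlin_lin n0 oO bO C1f hk0 hk1 hl1 df_le subcritical a Hv).
have N0' : graddot Omega (u 0) (u 0) - nonlin Omega f (u 0) (u 0) < 0.
  by rewrite gE nonE -neE; exact: N0.
have init' : 4 * p * (1 + lambda) / ((p - 2) * lambda) *
    (2^-1 * l2dot Omega (ut 0) (ut 0) + 2^-1 * graddot Omega (u 0) (u 0) - potential Omega f (u 0)) <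
    l2dot Omega (u 0) (u 0) + graddot Omega (u 0) (u 0) + 2 * l2dot Omega (u 0) (ut 0).
  rewrite utE gE potE uE uutE.
  move: init; rewrite (sqr_h1norm oO bO (H01_H1 Hu0)) /energy (sqr_l2norm oO (H01_L2 Hu0)).
  by rewrite (sqr_l2norm oO Lu1); exact.
have e1 := @unstable_invariant R _ (L2 Omega) (H01 Omega) test (l2dot Omega) (graddot Omega)
  si2 sig (@H01_L2 R n Omega) (K + 1) P0 nhP Yc (H01_saturated oO bO).
have e2 := e1 (@test_H01 _ _ _ oO bO) Dd (test_adjoint oO bO).
have e3 := e2 _ _ c nl c0 cP T u ut utt.
have e4 := e3 Hu Lut u_cont ut_cont u_diff utt_lin utt_bd utt_cont ut_diff wd.
rewrite neE; exact: (e4 _ _ lam0 lamP p2 pot N0' init' t tT).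
Qed.

End application.

Theorem lemma3p2 (R : realType) (n : nat) (hn : (1 <= n)%N)
  (Omega : set 'rV[R]_n) (hOmega : bounded_smooth_domain Omega)
  (f : R -> R) (hf : C1_fun f)
  (p : R) (hp : 2 < p)
  (hH1 : forall s : R, p * primitive f s <= s * f s)
  (alpha beta q : R) (halpha : 0 < alpha) (hbeta : 0 < beta)
  (hq1 : 1 < q) (hq2 : (q%:E < critical_exponent R n - 1)%E)
  (hH2 : forall s : R, `|f s| <= alpha + beta * `|s| `^ q)
  (k0 k1 l1 : R) (hk0 : 0 < k0) (hk1 : 0 < k1)
  (hl1 : 0 < l1) (hl2 : (l1%:E < critical_exponent R n - 2%:E)%E)
  (hH3 : forall s : R, `|derive1 f s| <= k0 + k1 * `|s| `^ l1)
  (lambda1 : R) (hlambda1 : first_dirichlet_eigenvalue Omega lambda1)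
  (u0 u1 : 'rV[R]_n -> R) (hu0 : H01 Omega u0) (hu1 : L2 Omega u1)
  (u0_unstable : unstable_set Omega f u0)
  (hinit : h1norm Omega u0 ^+ 2 + 2 * l2dot Omega u0 u1 >
    4 * p * (1 + lambda1) / ((p - 2) * lambda1) * energy Omega f u0 u1)
  (u : R -> 'rV[R]_n -> R) (t : R) (ht0 : 0 <= t)
  (htT : (t%:E < Tmax Omega f u0 u1 u)%E) :
  unstable_set Omega f (u t).
Proof.
have [_ oO _ bO _] := hOmega.
have sub : (2 < n)%N -> (l1 + 2) * (n%:R - 2) <= 2 * n%:R.
  move=> n2; have n2' : (0 : R) < n%:R - 2 by rewrite subr_gt0 ltr_nat.
  move: hl2; rewrite /critical_exponent leqNgt n2 /= -EFinB lte_fin ltrBrDr => /ltW.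
  by rewrite ler_pdivlMr.
(* A time below the supremum lies below some T on whose interval [u] is a weak solution. *)
have [_ [T [T0 wT] <-]] := ereal_sup_gt htT.
rewrite lte_fin => tT; have tT' : 0 <= t <= T by rewrite ht0 ltW.
have [_ N0] := u0_unstable.
exact: (weak_solution_unstable hn oO bO hf hk0 hk1 hl1 hH3 sub hlambda1 hp hH1
  hu0 hu1 N0 hinit T0 wT tT').
Qed.
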